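(* Let $\mathbb{D}=\{z\in\mathbb{C}:|z|<1\}$ and let $f=h+\overline{g}$ be a sense-preserving univalent harmonic mapping of $\mathbb{D}$ with $h(z)=z+\sum_{n=2}^\infty a_nz^n$ and $g(z)=\sum_{n=2}^\infty b_nz^n$ (so $f\in\mathcal{S}^0_H$), which is stable univalent, i.e. $h+\mu\overline{g}$ is univalent in $\mathbb{D}$ for every $|\mu|=1$. Let $m,q\in\mathbb{N}$, $\omega_m\in\mathcal{B}_m$ and $\omega_q\in\mathcal{B}_q$. Then for $s,p\in\mathbb{N}$, $$|Df(\omega_m(z))|^s+|f(\omega_q(z))|^p\le1\quad\text{and}\quad|\mathscr{D}f(\omega_m(z))|^s+|f(\omega_q(z))|^p\le1$$ for $|z|=r\le r_{3,s,m,p,q}$, where $r_{3,s,m,p,q}$ is the unique root in $(0,1)$ of $$\frac{r^{sm}(1+r^m)^s}{(1-r^m)^{3s}}+\left(\frac{r^q}{(1-r^q)^2}\right)^p-1=0.$$ The radius $r_{3,s,m,p,q}$ is best possible.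
   Context: For $n\in\mathbb{N}$, $\mathcal{B}_n$ denotes the set of analytic functions $\omega:\mathbb{D}\to\mathbb{C}$ with $|\omega(z)|\le1$ in $\mathbb{D}$, $\omega(0)=\omega'(0)=\cdots=\omega^{(n-1)}(0)=0$ and $\omega^{(n)}(0)\neq0$. For a harmonic $f$, $Df=zf_z-\overline{z}f_{\overline{z}}$ and $\mathscr{D}f=zf_z+\overline{z}f_{\overline{z}}$, and $Df(\omega_m(z))$ means $(Df)(\omega_m(z))$ (similarly for $\mathscr{D}$). ''Best possible'' means that for every $r>r_{3,s,m,p,q}$ there exist such $f,\omega_m,\omega_q$ and $z$ with $|z|=r$ for which the inequality fails. *)

(* Defs.v *)
From Stdlib Require Import Reals.
From Coquelicot Require Import Coquelicot.
Open Scope R_scope.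

Definition inD (z : C) : Prop := Cmod z < 1.

Definition has_cderiv (f : C -> C) (z l : C) : Prop :=
  @is_derive C_AbsRing C_NormedModule f z l.

Definition holo_D_with (f f' : C -> C) : Prop :=
  forall z, inD z -> has_cderiv f z (f' z).

Definition univalent_D (f : C -> C) : Prop :=
  forall z1 z2, inD z1 -> inD z2 -> f z1 = f z2 -> z1 = z2.

Definition in_B (n : nat) (omega : C -> C) : Prop :=
  (forall z, inD z -> Cmod (omega z) <= 1) /\
  exists d : nat -> C -> C,
    d O = omega /\
    (forall k z, inD z -> has_cderiv (d k) z (d (S k) z)) /\
    (forall k, (k < n)%nat -> d k (RtoC 0) = RtoC 0) /\
    d n (RtoC 0) <> RtoC 0.

Definition stable_SH0 (h h' g g' : C -> C) : Prop :=
  holo_D_with h h' /\ holo_D_with g g' /\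
  h (RtoC 0) = RtoC 0 /\ h' (RtoC 0) = RtoC 1 /\
  g (RtoC 0) = RtoC 0 /\ g' (RtoC 0) = RtoC 0 /\
  (forall z, inD z -> Cmod (g' z) < Cmod (h' z)) /\
  univalent_D (fun z => Cplus (h z) (Cconj (g z))) /\
  (forall mu : C, Cmod mu = 1 ->
     univalent_D (fun z => Cplus (h z) (Cmult mu (Cconj (g z))))).

Definition harm (h g : C -> C) (z : C) : C := Cplus (h z) (Cconj (g z)).

(* D f = z f_z - conj(z) f_{conj z} = z h'(z) - conj(z g'(z)) *)
Definition Dop (h' g' : C -> C) (z : C) : C :=
  Cminus (Cmult z (h' z)) (Cconj (Cmult z (g' z))).

(* script D f = z f_z + conj(z) f_{conj z} = z h'(z) + conj(z g'(z)) *)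
Definition Dscr (h' g' : C -> C) (z : C) : C :=
  Cplus (Cmult z (h' z)) (Cconj (Cmult z (g' z))).

Definition F3 (s m p q : nat) (r : R) : R :=
  r ^ (s * m) * (1 + r ^ m) ^ s / (1 - r ^ m) ^ (3 * s)
  + (r ^ q / (1 - r ^ q) ^ 2) ^ p - 1.

(* Main.v *)
(* By Schwarz's lemma [|omega_n(z)| <= |z|^n], so everything reduces to the bounds
   [|h'| + |g'| <= (1 + r) / (1 - r)^3] and [|h| + |g| <= r / (1 - r)^2].  If [h + lam g] identified two points for some [|lam| = 1], then
   [|h(z) - h(w)| = |g(z) - g(w)|] and some [h + mu conj(g)] would identify them too; so every
   [h + lam g] is a normalized univalent function, and the bounds are the growth and distortion
   theorems for a [lam] that aligns the two summands.

   The growth theorem comes from [|z f'(z) / f(z)| <= (1 + r) / (1 - r)], integrated along rays.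
   For this, let [g] be the odd univalent function with [g(t)^2 = f(t^2)].  The logarithmic energy
   of a charge of total mass zero is nonnegative; apply this to the image under [g] of the
   difference of the harmonic measures at [b] and [-b].  Since [log |(g(z) - g(w)) / (z - w)|] is
   harmonic in each variable, the energy is computed by Poisson's formula, and its nonnegativity
   is exactly the bound of [t g'(t) / g(t)], that is of [z f'(z) / f(z)] at [z = t^2].

   The Koebe function with [omega_m = z^m] and [omega_q = z^q] shows that the radius is optimal. *)
Require Import Defs.
From Stdlib Require Import Reals Ranalysis5 Lra Lia Psatz ClassicalEpsilon.
From Coquelicot Require Import Coquelicot.
Open Scope R_scope.

(** * Complex derivatives and integrals of curves *)

(** The classical route to the growth theorem expands [f] in a power series and bounds its second
    coefficient through the area theorem; the energy argument asks only for Cauchy's formula on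
    circles. Its obstacle is that [log |z - w|] is singular on the diagonal, so energies are taken
    with [log (|z - w|^2 + e)] instead. On the unit circle the choice [e = (1 - sg)^2 / sg] turns
    this kernel, up to a constant, into [log |1 - sg conj(z) w|^2], which is still harmonic in each
    variable. The error caused on the image curve is at most a multiple of the mean of
    [e / (|z - w|^2 + e)], which is exactly [(1 - sg) / (1 + sg)] and vanishes as [sg] tends to 1.
    The charge sits on the whole unit circle, so the odd function is first dilated to [g(r w)] with
    [r < 1], which is univalent on a larger disc. Goursat's theorem is proved on cones over a curve,
    by bisection of the parameter rectangle: a cone over a circle contracts it to any inner point,
    which gives Cauchy's formula, and a cone over a segment is a triangle, which gives
    primitives. *)

Lemma lt_Rmin (x a b : R) : x < Rmin a b -> x < a /\ x < b.
Proof. intros H. pose proof (Rmin_l a b). pose proof (Rmin_r a b). lra. Qed.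

Lemma Rmin_div_mult (a e k : R) : 0 < k -> Rmin a (e / k) * k <= e.
Proof.
intros Hk. apply Rle_trans with (e / k * k); [apply Rmult_le_compat_r; [lra|apply Rmin_r]|].
apply Req_le. field. lra.
Qed.

Lemma has_cderiv_eps (f : C -> C) (z l : C) :
  has_cderiv f z l <->
  forall eps, 0 < eps -> exists d, 0 < d /\ forall w, Cmod (w - z) < d ->
    Cmod (f w - f z - l * (w - z)) <= eps * Cmod (w - z).
Proof.
split.
- intros [_ H] eps He.
  destruct (H z (fun P HP => HP) (mkposreal eps He)) as [d Hd].
  exists d; split; [apply cond_pos|].
  intros w Hw. specialize (Hd w Hw). simpl in Hd.
  rewrite (Cmult_comm l). exact Hd.
- intros H. split; [apply is_linear_scal_l|].
  intros x Hx eps.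
  assert (E : z = x).
  { apply (is_filter_lim_locally_unique (K := C_AbsRing) (V := AbsRing_NormedModule C_AbsRing)). exact Hx. }
  subst x.
  destruct (H eps (cond_pos eps)) as [d [Hd0 Hd]].
  exists (mkposreal d Hd0). intros w Hw.
  specialize (Hd w Hw). rewrite (Cmult_comm l) in Hd. exact Hd.
Qed.

Lemma has_cderiv_abs (f : C -> C) (z l : C) :
  has_cderiv f z l <-> is_derive (K := C_AbsRing) (V := AbsRing_NormedModule C_AbsRing) f z l.
Proof.
split; intros [H1 H2]; split; try apply is_linear_scal_l; exact H2.
Qed.

Lemma has_cderiv_const (c z : C) : has_cderiv (fun _ => c) z 0.
Proof. exact (@is_derive_const C_AbsRing C_NormedModule c z). Qed.

Lemma has_cderiv_id (z : C) : has_cderiv (fun w => w) z 1.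
Proof. apply has_cderiv_abs. exact (@is_derive_id C_AbsRing z). Qed.

Lemma has_cderiv_plus (f g : C -> C) (z l m : C) :
  has_cderiv f z l -> has_cderiv g z m -> has_cderiv (fun w => f w + g w)%C z (l + m).
Proof. exact (@is_derive_plus C_AbsRing C_NormedModule f g z l m). Qed.

Lemma has_cderiv_mult (f g : C -> C) (z l m : C) :
  has_cderiv f z l -> has_cderiv g z m ->
  has_cderiv (fun w => f w * g w)%C z (l * g z + f z * m).
Proof.
intros Hf Hg. apply has_cderiv_abs in Hf. apply has_cderiv_abs in Hg. apply has_cderiv_abs.
exact (@is_derive_mult C_AbsRing f g z l m Hf Hg Cmult_comm).
Qed.

Lemma has_cderiv_comp (f g : C -> C) (z l m : C) :
  has_cderiv f (g z) l -> has_cderiv g z m -> has_cderiv (fun w => f (g w)) z (m * l).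
Proof.
intros Hf Hg. apply has_cderiv_abs in Hg.
exact (@is_derive_comp C_AbsRing C_NormedModule f g z l m Hf Hg).
Qed.

Lemma has_cderiv_eq (f : C -> C) (z l m : C) :
  has_cderiv f z l -> l = m -> has_cderiv f z m.
Proof. intros H <-. exact H. Qed.

Lemma has_cderiv_ext_loc (f g : C -> C) (z l : C) (d : R) :
  0 < d -> (forall w, Cmod (w - z) < d -> f w = g w) ->
  has_cderiv f z l -> has_cderiv g z l.
Proof.
intros Hd He Hf. apply has_cderiv_eps. intros eps Heps.
destruct (proj1 (has_cderiv_eps f z l) Hf eps Heps) as [d' [Hd' H]].
exists (Rmin d d'). split; [now apply Rmin_pos|].
intros w Hw. rewrite <- !He.
- apply H. eapply Rlt_le_trans; [exact Hw|apply Rmin_r].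
- replace (z - z)%C with (RtoC 0) by ring. now rewrite Cmod_0.
- eapply Rlt_le_trans; [exact Hw|apply Rmin_l].
Qed.

Lemma has_cderiv_ext (f g : C -> C) (z l : C) :
  (forall w, f w = g w) -> has_cderiv f z l -> has_cderiv g z l.
Proof. intros H. apply (has_cderiv_ext_loc f g z l 1); [lra|]. intros; apply H. Qed.

Lemma has_cderiv_continuous (f : C -> C) (z l : C) :
  has_cderiv f z l -> forall eps, 0 < eps -> exists d, 0 < d /\
    forall w, Cmod (w - z) < d -> Cmod (f w - f z) < eps.
Proof.
intros Hf eps He.
destruct (proj1 (has_cderiv_eps f z l) Hf 1 Rlt_0_1) as [d [Hd H]].
set (k := Cmod l + 1).
assert (Hk : 0 < k) by (unfold k; pose proof (Cmod_ge_0 l); lra).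
exists (Rmin d (eps / k)). split.
{ apply Rmin_pos; [exact Hd|]. now apply Rdiv_lt_0_compat. }
intros w Hw.
destruct (lt_Rmin _ _ _ Hw) as [H1 H2].
specialize (H w H1).
replace (f w - f z)%C with ((f w - f z - l * (w - z)) + l * (w - z))%C by ring.
eapply Rle_lt_trans; [apply Cmod_triangle|]. rewrite Cmod_mult.
apply Rmult_lt_compat_r with (r := k) in H2; [|exact Hk].
replace (eps / k * k) with eps in H2 by (field; lra).
unfold k in H2. lra.
Qed.

Lemma has_cderiv_Cinv (u : C) : u <> 0 -> has_cderiv Cinv u (- / (u * u)).
Proof.
intros Hu. pose proof (proj1 (Cmod_gt_0 u) Hu) as Hp.
apply has_cderiv_eps. intros eps He.
set (m := Cmod u) in *.
(* The remainder is [(w - u)^2 / (u^2 w)]. The first bound keeps [|w| >= m / 2], so the remainder is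
   at most [|w - u|^2 * 2 / m^3], and the second bound makes this at most [eps * |w - u|]. *)
exists (Rmin (m / 2) (eps * (m * m * m / 2))). split.
{ apply Rmin_pos; [lra|]. apply Rmult_lt_0_compat; [exact He|].
  assert (0 < m * m * m) by (repeat apply Rmult_lt_0_compat; exact Hp). lra. }
intros w Hw.
destruct (lt_Rmin _ _ _ Hw) as [H1 H2].
assert (Hwm : m / 2 <= Cmod w).
{ pose proof (Cmod_triangle w (u - w)) as T. replace (w + (u - w))%C with u in T by ring.
  fold m in T. replace (u - w)%C with (- (w - u))%C in T by ring. rewrite Cmod_opp in T. lra. }
assert (Hwn : w <> 0) by (apply Cmod_gt_0; lra).
replace (/ w - / u - - / (u * u) * (w - u))%C with ((w - u) * ((w - u) / (u * u * w)))%C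
  by (field; auto).
rewrite Cmod_mult, Rmult_comm. apply Rmult_le_compat_r; [apply Cmod_ge_0|].
rewrite Cmod_div by (repeat apply Cmult_neq_0; auto).
rewrite !Cmod_mult. fold m.
apply Rle_div_l; [apply Rlt_gt; repeat apply Rmult_lt_0_compat; lra|].
apply Rlt_le. eapply Rlt_le_trans; [exact H2|].
apply Rmult_le_compat_l; [lra|].
assert (0 <= m * m) by (apply Rmult_le_pos; lra). nra.
Qed.

Lemma has_cderiv_unique (f : C -> C) (z l m : C) :
  has_cderiv f z l -> has_cderiv f z m -> l = m.
Proof.
intros H1 H2. rewrite <- (is_C_derive_unique f z l); [now apply is_C_derive_unique|].
all: first [exact H1 | exact H2 | now apply has_cderiv_abs].
Qed.

Lemma has_cderiv_inv (f : C -> C) (z l : C) :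
  has_cderiv f z l -> f z <> 0 -> has_cderiv (fun w => / f w)%C z (- l / (f z * f z)).
Proof.
intros Hf Hn.
eapply has_cderiv_eq; [exact (has_cderiv_comp Cinv f z _ l (has_cderiv_Cinv _ Hn) Hf)|].
field; auto.
Qed.

Lemma has_cderiv_opp (f : C -> C) (z l : C) :
  has_cderiv f z l -> has_cderiv (fun w => - f w)%C z (- l).
Proof. exact (@is_derive_opp C_AbsRing C_NormedModule f z l). Qed.

Lemma has_cderiv_minus (f g : C -> C) (z l m : C) :
  has_cderiv f z l -> has_cderiv g z m -> has_cderiv (fun w => f w - g w)%C z (l - m).
Proof. exact (@is_derive_minus C_AbsRing C_NormedModule f g z l m). Qed.

Lemma has_cderiv_scal (c : C) (f : C -> C) (z l : C) :
  has_cderiv f z l -> has_cderiv (fun w => c * f w)%C z (c * l).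
Proof.
intros Hf. eapply has_cderiv_eq; [exact (has_cderiv_mult _ f z _ l (has_cderiv_const c z) Hf)|].
cbv beta; ring.
Qed.

Lemma has_cderiv_div (f g : C -> C) (z l m : C) :
  has_cderiv f z l -> has_cderiv g z m -> g z <> 0 ->
  has_cderiv (fun w => f w / g w)%C z ((l * g z - f z * m) / (g z * g z)).
Proof.
intros Hf Hg Hn.
eapply has_cderiv_eq; [exact (has_cderiv_mult f _ z l _ Hf (has_cderiv_inv g z m Hg Hn))|].
cbv beta; field; auto.
Qed.

Lemma has_cderiv_pow (n : nat) (z : C) :
  has_cderiv (fun w => w ^ n)%C z (RtoC (INR n) * z ^ pred n)%C.
Proof.
induction n as [|n IH].
- eapply has_cderiv_eq; [exact (has_cderiv_const 1 z)|]. simpl. ring.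
- eapply has_cderiv_eq; [exact (has_cderiv_mult _ _ z _ _ (has_cderiv_id z) IH)|].
  rewrite S_INR, RtoC_plus. destruct n as [|n]; simpl pred; [simpl; ring|]. simpl Cpow. ring.
Qed.

(** Curves are treated by coordinates, so that the real theory of derivatives and of [RInt] applies
    to each of them; [ccont_eps] and [cder_eps] recover the description by the complex modulus. *)
Definition ccont (f : R -> C) (t : R) : Prop :=
  continuous (fun s => Re (f s)) t /\ continuous (fun s => Im (f s)) t.

Definition cder (f : R -> C) (t : R) (l : C) : Prop :=
  is_derive (fun s => Re (f s)) t (Re l) /\ is_derive (fun s => Im (f s)) t (Im l).

Lemma continuous_eps (f : R -> R) (t : R) :
  continuous f t <->
  forall eps, 0 < eps -> exists d, 0 < d /\ forall s, Rabs (s - t) < d -> Rabs (f s - f t) < eps.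
Proof.
unfold continuous; rewrite <- continuity_pt_filterlim. split.
- intros H eps He. destruct (H eps He) as [d [Hd H']]. exists d; split; [exact Hd|].
  intros s Hs. destruct (Req_dec t s) as [->|Hn].
  + replace (f s - f s) with 0 by ring. now rewrite Rabs_R0.
  + apply H'. split; [split; [exact I|exact Hn]|exact Hs].
- intros H eps He. destruct (H eps He) as [d [Hd H']]. exists d; split; [exact Hd|].
  intros s [_ Hs]. apply H'. exact Hs.
Qed.

Lemma im_le_Cmod (z : C) : Rabs (Im z) <= Cmod z.
Proof. eapply Rle_trans; [apply Rmax_r|apply Rmax_Cmod]. Qed.

Lemma Cmod_le_Re_Im (z : C) : Cmod z <= Rabs (Re z) + Rabs (Im z).
Proof.
destruct z as [x y]. replace (x, y) with (RtoC x + Ci * RtoC y)%C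
  by (apply injective_projections; simpl; ring).
eapply Rle_trans; [apply Cmod_triangle|]. rewrite Cmod_mult, Cmod_Ci, !Cmod_R.
apply Req_le. simpl. rewrite ?Rmult_0_l, ?Rmult_0_r. f_equal; [|rewrite Rmult_1_l]; f_equal; ring.
Qed.

Lemma ccont_eps (f : R -> C) (t : R) :
  ccont f t <->
  forall eps, 0 < eps -> exists d, 0 < d /\ forall s, Rabs (s - t) < d -> Cmod (f s - f t) < eps.
Proof.
unfold ccont. rewrite !continuous_eps. split.
- intros [H1 H2] eps He.
  destruct (H1 (eps / 2) ltac:(lra)) as [d1 [P1 Q1]].
  destruct (H2 (eps / 2) ltac:(lra)) as [d2 [P2 Q2]].
  exists (Rmin d1 d2). split; [now apply Rmin_pos|]. intros s Hs.
  eapply Rle_lt_trans; [apply Cmod_le_Re_Im|].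
  destruct (lt_Rmin _ _ _ Hs) as [Hs1 Hs2]. specialize (Q1 s Hs1). specialize (Q2 s Hs2).
  unfold Re, Im in *. simpl. unfold Rminus in *. lra.
- intros H. split; intros eps He; destruct (H eps He) as [d [Hd Q]]; exists d; (split; [exact Hd|]);
    intros s Hs; specialize (Q s Hs); eapply Rle_lt_trans; [|exact Q| |exact Q].
  + apply (re_le_Cmod (f s - f t)).
  + apply (im_le_Cmod (f s - f t)).
Qed.

Lemma ccont_const (c : C) (t : R) : ccont (fun _ => c) t.
Proof. split; apply continuous_const. Qed.

Lemma ccont_plus (f g : R -> C) (t : R) :
  ccont f t -> ccont g t -> ccont (fun s => f s + g s)%C t.
Proof.
intros [H1 H2] [H3 H4]. split.
- exact (continuous_plus (V := R_NormedModule) _ _ t H1 H3).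
- exact (continuous_plus (V := R_NormedModule) _ _ t H2 H4).
Qed.

Lemma ccont_opp (f : R -> C) (t : R) : ccont f t -> ccont (fun s => - f s)%C t.
Proof.
intros [H1 H2]. split.
- exact (continuous_opp (V := R_NormedModule) _ t H1).
- exact (continuous_opp (V := R_NormedModule) _ t H2).
Qed.

Lemma ccont_minus (f g : R -> C) (t : R) :
  ccont f t -> ccont g t -> ccont (fun s => f s - g s)%C t.
Proof. intros H1 H2. exact (ccont_plus f _ t H1 (ccont_opp g t H2)). Qed.

Lemma ccont_mult (f g : R -> C) (t : R) :
  ccont f t -> ccont g t -> ccont (fun s => f s * g s)%C t.
Proof.
intros [H1 H2] [H3 H4]. split.
- apply (continuous_minus (V := R_NormedModule) (fun s => Re (f s) * Re (g s)) (fun s => Im (f s) * Im (g s))).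
  + exact (continuous_mult _ _ t H1 H3).
  + exact (continuous_mult _ _ t H2 H4).
- apply (continuous_plus (V := R_NormedModule) (fun s => Re (f s) * Im (g s)) (fun s => Im (f s) * Re (g s))).
  + exact (continuous_mult _ _ t H1 H4).
  + exact (continuous_mult _ _ t H2 H3).
Qed.

Lemma ccont_comp (F : C -> C) (f : R -> C) (t : R) (l : C) :
  has_cderiv F (f t) l -> ccont f t -> ccont (fun s => F (f s)) t.
Proof.
intros HF Hf. apply ccont_eps. intros eps He.
destruct (has_cderiv_continuous F _ l HF eps He) as [d [Hd H]].
destruct (proj1 (ccont_eps f t) Hf d Hd) as [d' [Hd' H']].
exists d'; split; [exact Hd'|]. intros s Hs. apply H, H', Hs.
Qed.

Lemma ccont_inv (f : R -> C) (t : R) : ccont f t -> f t <> 0 -> ccont (fun s => / f s)%C t.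
Proof. intros Hf Hn. exact (ccont_comp Cinv f t _ (has_cderiv_Cinv _ Hn) Hf). Qed.

Lemma ccont_div (f g : R -> C) (t : R) :
  ccont f t -> ccont g t -> g t <> 0 -> ccont (fun s => f s / g s)%C t.
Proof. intros Hf Hg Hn. exact (ccont_mult f _ t Hf (ccont_inv g t Hg Hn)). Qed.

Lemma ccont_RtoC (f : R -> R) (t : R) : continuous f t -> ccont (fun s => RtoC (f s)) t.
Proof. intros H. split; [exact H|]. apply continuous_const. Qed.

Lemma cder_ccont (f : R -> C) (t : R) (l : C) : cder f t l -> ccont f t.
Proof.
intros [H1 H2]. split.
- apply (ex_derive_continuous (V := R_NormedModule)). now exists (Re l).
- apply (ex_derive_continuous (V := R_NormedModule)). now exists (Im l).
Qed.

(** * Integrals of complex curves *)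

Definition CInt (f : R -> C) (a b : R) : C :=
  (RInt (fun t => Re (f t)) a b, RInt (fun t => Im (f t)) a b).

Lemma ccont_ex_RInt (f : R -> C) (a b : R) :
  a <= b -> (forall t, a <= t <= b -> ccont f t) ->
  ex_RInt (fun t => Re (f t)) a b /\ ex_RInt (fun t => Im (f t)) a b.
Proof.
intros Hab H. split; apply (ex_RInt_continuous (V := R_CompleteNormedModule));
  rewrite Rmin_left, Rmax_right by exact Hab; intros t Ht; apply (H t Ht).
Qed.

Lemma CInt_ext (f g : R -> C) (a b : R) :
  a <= b -> (forall t, a <= t <= b -> f t = g t) -> CInt f a b = CInt g a b.
Proof.
intros Hab H. unfold CInt. f_equal; apply RInt_ext; rewrite Rmin_left, Rmax_right by exact Hab;
  intros t Ht; rewrite H by lra; reflexivity.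
Qed.

Lemma CInt_plus (f g : R -> C) (a b : R) :
  a <= b -> (forall t, a <= t <= b -> ccont f t) -> (forall t, a <= t <= b -> ccont g t) ->
  CInt (fun t => f t + g t)%C a b = (CInt f a b + CInt g a b)%C.
Proof.
intros Hab Hf Hg. destruct (ccont_ex_RInt f a b Hab Hf), (ccont_ex_RInt g a b Hab Hg).
unfold CInt. apply injective_projections.
- now apply (RInt_plus (V := R_CompleteNormedModule)).
- now apply (RInt_plus (V := R_CompleteNormedModule)).
Qed.

Lemma CInt_scal (c : C) (f : R -> C) (a b : R) :
  a <= b -> (forall t, a <= t <= b -> ccont f t) ->
  CInt (fun t => c * f t)%C a b = (c * CInt f a b)%C.
Proof.
intros Hab Hf. destruct (ccont_ex_RInt f a b Hab Hf) as [Hr Hi].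
assert (S : forall k (u : R -> R), ex_RInt u a b ->
  ex_RInt (fun t => k * u t) a b /\ RInt (fun t => k * u t) a b = k * RInt u a b).
{ intros k u Hu. split.
  - exact (ex_RInt_scal (V := R_NormedModule) u a b k Hu).
  - exact (RInt_scal (V := R_CompleteNormedModule) u a b k Hu). }
unfold CInt. apply injective_projections; simpl.
- destruct (S (Re c) _ Hr) as [E1 F1], (S (Im c) _ Hi) as [E2 F2].
  unfold Re, Im in *. rewrite <- F1, <- F2.
  exact (RInt_minus (V := R_CompleteNormedModule) _ _ a b E1 E2).
- destruct (S (Re c) _ Hi) as [E1 F1], (S (Im c) _ Hr) as [E2 F2].
  unfold Re, Im in *. rewrite <- F1, <- F2.
  exact (RInt_plus (V := R_CompleteNormedModule) _ _ a b E1 E2).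
Qed.

Lemma CInt_minus (f g : R -> C) (a b : R) :
  a <= b -> (forall t, a <= t <= b -> ccont f t) -> (forall t, a <= t <= b -> ccont g t) ->
  CInt (fun t => f t - g t)%C a b = (CInt f a b - CInt g a b)%C.
Proof.
intros Hab Hf Hg. destruct (ccont_ex_RInt f a b Hab Hf), (ccont_ex_RInt g a b Hab Hg).
unfold CInt. apply injective_projections.
- now apply (RInt_minus (V := R_CompleteNormedModule)).
- now apply (RInt_minus (V := R_CompleteNormedModule)).
Qed.

Lemma CInt_Chasles (f : R -> C) (a b c : R) :
  a <= b -> b <= c -> (forall t, a <= t <= c -> ccont f t) ->
  (CInt f a b + CInt f b c)%C = CInt f a c.
Proof.
intros Hab Hbc Hf.
destruct (ccont_ex_RInt f a b Hab) as [H1 H2]; [intros t Ht; apply Hf; lra|].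
destruct (ccont_ex_RInt f b c Hbc) as [H3 H4]; [intros t Ht; apply Hf; lra|].
apply injective_projections.
- exact (RInt_Chasles (V := R_CompleteNormedModule) _ a b c H1 H3).
- exact (RInt_Chasles (V := R_CompleteNormedModule) _ a b c H2 H4).
Qed.

(** The factor 2 comes from bounding the two coordinates separately. It does no harm: the estimate
    is applied to quantities that tend to zero or that need a bound only up to a constant, and in
    Schwarz's lemma the constant disappears by taking powers. *)
Lemma CInt_bound (f : R -> C) (a b M : R) :
  a <= b -> (forall t, a <= t <= b -> ccont f t) -> (forall t, a <= t <= b -> Cmod (f t) <= M) ->
  Cmod (CInt f a b) <= 2 * ((b - a) * M).
Proof.
intros Hab Hf HM. destruct (ccont_ex_RInt f a b Hab Hf) as [H1 H2].
eapply Rle_trans; [apply Cmod_le_Re_Im|]. simpl.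
assert (A1 := abs_RInt_le_const _ a b M Hab H1).
assert (A2 := abs_RInt_le_const _ a b M Hab H2).
assert (B1 : Rabs (RInt (fun t => Re (f t)) a b) <= (b - a) * M).
{ apply A1. intros t Ht. eapply Rle_trans; [apply re_le_Cmod|now apply HM]. }
assert (B2 : Rabs (RInt (fun t => Im (f t)) a b) <= (b - a) * M).
{ apply A2. intros t Ht. eapply Rle_trans; [apply im_le_Cmod|now apply HM]. }
lra.
Qed.

Lemma CInt_cder (F f : R -> C) (a b : R) :
  a <= b -> (forall t, a <= t <= b -> cder F t (f t)) -> (forall t, a <= t <= b -> ccont f t) ->
  CInt f a b = (F b - F a)%C.
Proof.
intros Hab HF Hf. apply injective_projections; apply is_RInt_unique.
- apply (is_RInt_derive (V := R_CompleteNormedModule) (fun t => Re (F t)));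
    rewrite Rmin_left, Rmax_right by exact Hab; intros t Ht; [apply (HF t Ht)|apply (Hf t Ht)].
- apply (is_RInt_derive (V := R_CompleteNormedModule) (fun t => Im (F t)));
    rewrite Rmin_left, Rmax_right by exact Hab; intros t Ht; [apply (HF t Ht)|apply (Hf t Ht)].
Qed.

Lemma cder_eps (f : R -> C) (t : R) (l : C) :
  cder f t l <-> forall eps, 0 < eps -> exists d, 0 < d /\ forall s, Rabs (s - t) < d ->
    Cmod (f s - f t - l * RtoC (s - t)) <= eps * Rabs (s - t).
Proof.
assert (E : forall (u : R -> R) k, is_derive u t k <-> forall eps, 0 < eps -> exists d, 0 < d /\
  forall s, Rabs (s - t) < d -> Rabs (u s - u t - k * (s - t)) <= eps * Rabs (s - t)).
{ intros u k. split.
  - intros [_ H] eps He. destruct (H t (fun P HP => HP) (mkposreal eps He)) as [d Hd].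
    exists d; split; [apply cond_pos|]. intros s Hs. rewrite (Rmult_comm k). exact (Hd s Hs).
  - intros H. split; [apply is_linear_scal_l|]. intros x Hx eps.
    assert (t = x) by exact (is_filter_lim_locally_unique (V := R_NormedModule) t x Hx). subst x.
    destruct (H eps (cond_pos eps)) as [d [Hd0 Hd]]. exists (mkposreal d Hd0). intros s Hs.
    specialize (Hd s Hs). rewrite (Rmult_comm k) in Hd. exact Hd. }
unfold cder. rewrite !E. split.
- intros [H1 H2] eps He.
  destruct (H1 (eps / 2) ltac:(lra)) as [d1 [P1 Q1]].
  destruct (H2 (eps / 2) ltac:(lra)) as [d2 [P2 Q2]].
  exists (Rmin d1 d2). split; [now apply Rmin_pos|]. intros s Hs.
  eapply Rle_trans; [apply Cmod_le_Re_Im|].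
  destruct (lt_Rmin _ _ _ Hs) as [Hs1 Hs2]. specialize (Q1 s Hs1). specialize (Q2 s Hs2).
  unfold Re, Im in *. simpl.
  match goal with |- Rabs ?x + Rabs ?y <= _ =>
    replace x with (fst (f s) - fst (f t) - fst l * (s - t)) by ring;
    replace y with (snd (f s) - snd (f t) - snd l * (s - t)) by ring end. lra.
- intros H. split; intros eps He; destruct (H eps He) as [d [Hd Q]]; exists d; (split; [exact Hd|]);
    intros s Hs; specialize (Q s Hs); eapply Rle_trans; [|exact Q| |exact Q].
  + eapply Rle_trans; [|apply re_le_Cmod]. apply Req_le. f_equal. simpl. unfold Re. ring.
  + eapply Rle_trans; [|apply im_le_Cmod]. apply Req_le. f_equal. simpl. unfold Im. ring.
Qed.

Lemma cder_eq (f : R -> C) (t : R) (l m : C) : cder f t l -> l = m -> cder f t m.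
Proof. intros H <-. exact H. Qed.

Lemma cder_comp (F : C -> C) (f : R -> C) (t : R) (l m : C) :
  has_cderiv F (f t) l -> cder f t m -> cder (fun s => F (f s)) t (l * m).
Proof.
intros HF Hf. pose proof (proj1 (cder_eps _ _ _) Hf) as Hf'. apply cder_eps. intros eps He.
set (k := Cmod m + 1). set (k' := Cmod l + 1).
assert (Hk : 0 < k) by (unfold k; pose proof (Cmod_ge_0 m); lra).
assert (Hk' : 0 < k') by (unfold k'; pose proof (Cmod_ge_0 l); lra).
destruct (proj1 (has_cderiv_eps F _ l) HF (eps / 2 / k)) as [d1 [P1 Q1]].
{ apply Rdiv_lt_0_compat; lra. }
destruct (Hf' (Rmin 1 (eps / 2 / k'))) as [d2 [P2 Q2]].
{ apply Rmin_pos; [lra|]. apply Rdiv_lt_0_compat; lra. }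
exists (Rmin d2 (d1 / k)). split.
{ apply Rmin_pos; [exact P2|]. now apply Rdiv_lt_0_compat. }
intros s Hs. specialize (Q2 s ltac:(eapply Rlt_le_trans; [exact Hs|apply Rmin_l])).
assert (Hs2 : Rabs (s - t) < d1 / k) by (eapply Rlt_le_trans; [exact Hs|apply Rmin_r]).
set (a := Rabs (s - t)) in *. assert (Ha : 0 <= a) by apply Rabs_pos.
assert (B1 : Cmod (f s - f t - m * RtoC (s - t)) <= 1 * a).
{ eapply Rle_trans; [exact Q2|]. apply Rmult_le_compat_r; [exact Ha|apply Rmin_l]. }
assert (B2 : Cmod (f s - f t - m * RtoC (s - t)) <= eps / 2 / k' * a).
{ eapply Rle_trans; [exact Q2|]. apply Rmult_le_compat_r; [exact Ha|apply Rmin_r]. }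
assert (B3 : Cmod (f s - f t) <= k * a).
{ replace (f s - f t)%C with ((f s - f t - m * RtoC (s - t)) + m * RtoC (s - t))%C by ring.
  eapply Rle_trans; [apply Cmod_triangle|]. rewrite Cmod_mult, Cmod_R. fold a. unfold k. lra. }
assert (B4 : Cmod (f s - f t) < d1).
{ eapply Rle_lt_trans; [exact B3|]. apply Rmult_lt_compat_l with (r := k) in Hs2; [|exact Hk].
  replace (k * (d1 / k)) with d1 in Hs2 by (field; lra). exact Hs2. }
specialize (Q1 _ B4).
replace (F (f s) - F (f t) - l * m * RtoC (s - t))%C with
  ((F (f s) - F (f t) - l * (f s - f t)) + l * (f s - f t - m * RtoC (s - t)))%C by ring.
eapply Rle_trans; [apply Cmod_triangle|]. rewrite Cmod_mult.
assert (B5 : eps / 2 / k * Cmod (f s - f t) <= eps / 2 * a).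
{ apply Rle_trans with (eps / 2 / k * (k * a)).
  - apply Rmult_le_compat_l; [|exact B3]. apply Rlt_le, Rdiv_lt_0_compat; lra.
  - apply Req_le. field. lra. }
assert (B6 : Cmod l * Cmod (f s - f t - m * RtoC (s - t)) <= eps / 2 * a).
{ apply Rle_trans with (k' * (eps / 2 / k' * a)).
  - apply Rmult_le_compat; [apply Cmod_ge_0|apply Cmod_ge_0|unfold k'; lra|exact B2].
  - apply Req_le. field. lra. }
lra.
Qed.

Lemma cder_RtoC (t : R) : cder RtoC t 1.
Proof.
split; [apply (is_derive_id (K := R_AbsRing))|].
exact (is_derive_const (K := R_AbsRing) (V := R_NormedModule) 0 t).
Qed.

Lemma cder_line (a b : C) (t : R) : cder (fun s => a + RtoC s * b)%C t b.
Proof.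
eapply cder_eq.
- refine (cder_comp (fun w => a + w * b)%C RtoC t _ _ _ (cder_RtoC t)).
  apply has_cderiv_plus; [apply has_cderiv_const|].
  apply has_cderiv_mult; [apply has_cderiv_id|apply has_cderiv_const].
- cbv beta; ring.
Qed.

Lemma cder_scal (k : C) (f : R -> C) (t : R) (l : C) :
  cder f t l -> cder (fun s => k * f s)%C t (k * l).
Proof.
intros H. apply (cder_comp (fun w => k * w)%C f t k l); [|exact H].
eapply has_cderiv_eq; [apply has_cderiv_scal, has_cderiv_id|ring].
Qed.

(** The mean value theorem fails for complex valued curves, so it is used on each coordinate; hence
    the factor 2. *)
Lemma cder_bound (f : R -> C) (df : R -> C) (a b K : R) :
  (forall t, a <= t <= b -> cder f t (df t)) -> (forall t, a <= t <= b -> Cmod (df t) <= K) ->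
  forall s t, a <= s <= b -> a <= t <= b -> Cmod (f s - f t) <= 2 * K * Rabs (s - t).
Proof.
intros Hf HK s t Hs Ht.
assert (E : forall (u du : R -> R), (forall r, a <= r <= b -> is_derive u r (du r)) ->
  (forall r, a <= r <= b -> Rabs (du r) <= K) -> Rabs (u s - u t) <= K * Rabs (s - t)).
{ intros u du Hu HuK.
  assert (Hm : forall x, Rmin t s <= x <= Rmax t s -> a <= x <= b).
  { intros x Hx. split.
    - eapply Rle_trans; [|apply Hx]. apply Rmin_glb; lra.
    - eapply Rle_trans; [apply Hx|]. apply Rmax_lub; lra. }
  destruct (MVT_gen u t s du) as [c [Hc ->]].
  - intros x Hx. apply Hu, Hm. lra.
  - intros x Hx. apply continuity_pt_filterlim, (ex_derive_continuous (V := R_NormedModule)).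
    exists (du x). apply Hu, Hm, Hx.
  - rewrite Rabs_mult. apply Rmult_le_compat_r; [apply Rabs_pos|]. apply HuK, Hm, Hc. }
eapply Rle_trans; [apply Cmod_le_Re_Im|].
pose proof (E (fun r => Re (f r)) (fun r => Re (df r)) (fun r Hr => proj1 (Hf r Hr))
  (fun r Hr => Rle_trans _ _ _ (re_le_Cmod _) (HK r Hr))) as E1.
pose proof (E (fun r => Im (f r)) (fun r => Im (df r)) (fun r Hr => proj2 (Hf r Hr))
  (fun r Hr => Rle_trans _ _ _ (im_le_Cmod _) (HK r Hr))) as E2.
unfold Re, Im in *. simpl. unfold Rminus in *. lra.
Qed.

(** * Goursat's theorem on cones *)

(** The supremum of the left ends lies in all the nested intervals [[x n, x n + a / 2^n]]. *)
Lemma dyadic_limit (x : nat -> R) (a : R) :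
  0 <= a -> (forall n, x n <= x (S n) <= x n + a * (/ 2) ^ S n) ->
  exists l, forall n, x n <= l <= x n + a * (/ 2) ^ n.
Proof.
intros Ha Hx.
assert (H2 : forall n, 0 <= (/ 2) ^ n) by (intros; apply pow_le; lra).
assert (Hub : forall n m, x (n + m)%nat <= x n + a * (/ 2) ^ n - a * (/ 2) ^ (n + m)).
{ intros n m. induction m as [|m IH].
  - rewrite Nat.add_0_r. lra.
  - rewrite Nat.add_succ_r. eapply Rle_trans; [apply Hx|]. simpl. simpl in IH. lra. }
assert (Hmono : forall n m, x n <= x (n + m)%nat).
{ intros n m. induction m as [|m IH].
  - rewrite Nat.add_0_r. lra.
  - rewrite Nat.add_succ_r. eapply Rle_trans; [exact IH|apply Hx]. }
assert (Hb : forall n m, x m <= x n + a * (/ 2) ^ n).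
{ intros n m. destruct (Nat.le_ge_cases n m) as [Hnm|Hnm].
  - replace m with (n + (m - n))%nat by lia. eapply Rle_trans; [apply Hub|].
    pose proof (Rmult_le_pos _ _ Ha (H2 (n + (m - n))%nat)). lra.
  - replace n with (m + (n - m))%nat at 1 by lia.
    eapply Rle_trans; [apply (Hmono m (n - m)%nat)|].
    pose proof (Rmult_le_pos _ _ Ha (H2 n)). lra. }
destruct (completeness (fun r => exists n, r = x n)) as [l [Hl1 Hl2]].
- exists (x 0%nat + a * (/ 2) ^ 0). intros r [n ->]. apply Hb.
- exists (x 0%nat). now exists 0%nat.
- exists l. intros n. split; [apply Hl1; now exists n|].
  apply Hl2. intros r [m ->]. apply Hb.
Qed.

Lemma Cmod_sum4_large (z1 z2 z3 z4 : C) (e : R) :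
  4 * e <= Cmod ((z1 + z2) + (z3 + z4)) ->
  ~ e <= Cmod z1 -> ~ e <= Cmod z2 -> ~ e <= Cmod z3 -> e <= Cmod z4.
Proof.
intros H H1 H2 H3.
pose proof (Cmod_triangle (z1 + z2) (z3 + z4)). pose proof (Cmod_triangle z3 z4).
pose proof (Cmod_triangle z1 z2). lra.
Qed.

(* [W x y p q] stands for a quantity attached to the rectangle [x, x + p] * [y, y + q]. *)
Lemma rectangle_bisection (W : R -> R -> R -> R -> C) (x0 y0 a b : R) :
  0 <= a -> 0 <= b ->
  (forall x y k, 0 <= k -> x0 <= x -> x + a * k <= x0 + a -> y0 <= y -> y + b * k <= y0 + b ->
     W x y (a * k) (b * k) =
       Cplus (Cplus (W x y (a * (/ 2 * k)) (b * (/ 2 * k)))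
                    (W (x + a * (/ 2 * k)) y (a * (/ 2 * k)) (b * (/ 2 * k))))
             (Cplus (W x (y + b * (/ 2 * k)) (a * (/ 2 * k)) (b * (/ 2 * k)))
                    (W (x + a * (/ 2 * k)) (y + b * (/ 2 * k)) (a * (/ 2 * k)) (b * (/ 2 * k))))) ->
  (forall u v eps, x0 <= u <= x0 + a -> y0 <= v <= y0 + b -> 0 < eps ->
     exists d, 0 < d /\ forall x y k, 0 <= k < d ->
       x0 <= x -> x + a * k <= x0 + a -> y0 <= y -> y + b * k <= y0 + b ->
       x <= u <= x + a * k -> y <= v <= y + b * k ->
       Cmod (W x y (a * k) (b * k)) <= eps * (k * k)) ->
  W x0 y0 a b = RtoC 0.
Proof.
intros Ha Hb Hadd Hloc.
set (h := fun n => (/ 2) ^ n).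
assert (Hh : forall n, 0 < h n) by (intros; apply pow_lt; lra).
apply Cmod_eq_0.
destruct (Rle_lt_or_eq_dec 0 _ (Cmod_ge_0 (W x0 y0 a b))) as [Hpos|E]; [exfalso|now symmetry].
set (eta := Cmod (W x0 y0 a b)) in *.
pose (big := fun n (p : R * R) => Rle_dec (eta * (h n * h n)) (Cmod (W (fst p) (snd p) (a * h n) (b * h n)))).
(* Moves to the first quarter whose [W] keeps at least a fourth of the current lower bound. The last
   quarter is the default: if the other three fail, [Cmod_sum4_large] shows that it qualifies. *)
pose (step := fun n (p : R * R) => let k := h (S n) in
  if big (S n) p then p
  else if big (S n) (fst p + a * k, snd p) then (fst p + a * k, snd p)
  else if big (S n) (fst p, snd p + b * k) then (fst p, snd p + b * k)
  else (fst p + a * k, snd p + b * k)).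
pose (st := fix st n := match n with O => (x0, y0) | S m => step m (st m) end).
assert (Hstep : forall n p, fst p <= fst (step n p) <= fst p + a * h (S n) /\
                            snd p <= snd (step n p) <= snd p + b * h (S n)).
{ intros n p. pose proof (Rmult_le_pos _ _ Ha (Rlt_le _ _ (Hh (S n)))).
  pose proof (Rmult_le_pos _ _ Hb (Rlt_le _ _ (Hh (S n)))).
  unfold step. repeat destruct (big _ _); simpl; lra. }
assert (Hin : forall n, x0 <= fst (st n) /\ fst (st n) + a * h n <= x0 + a /\
                        y0 <= snd (st n) /\ snd (st n) + b * h n <= y0 + b).
{ induction n as [|n IH]; [unfold h; simpl; lra|].
  simpl st. destruct (Hstep n (st n)) as [S1 S2].
  assert (E : h n = 2 * h (S n)) by (unfold h; simpl; lra). rewrite E in IH. lra. }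
assert (Hbig : forall n, eta * (h n * h n) <= Cmod (W (fst (st n)) (snd (st n)) (a * h n) (b * h n))).
{ induction n as [|n IH].
  - unfold h; simpl. rewrite !Rmult_1_r. apply Rle_refl.
  - simpl st. unfold step.
    destruct (big (S n) (st n)) as [B|B1]; [exact B|].
    destruct (big (S n) (fst (st n) + a * h (S n), snd (st n))) as [B|B2]; [exact B|].
    destruct (big (S n) (fst (st n), snd (st n) + b * h (S n))) as [B|B3]; [exact B|].
    destruct (Hin n) as (I1 & I2 & I3 & I4).
    rewrite (Hadd _ _ (h n) (Rlt_le _ _ (Hh n)) I1 I2 I3 I4) in IH.
    simpl in B1, B2, B3 |- *.
    eapply Cmod_sum4_large; [|exact B1|exact B2|exact B3].
    eapply Rle_trans; [|exact IH]. apply Req_le. unfold h; simpl. field. }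
destruct (dyadic_limit (fun n => fst (st n)) a Ha) as [u Hu]; [intros n; apply (Hstep n (st n))|].
destruct (dyadic_limit (fun n => snd (st n)) b Hb) as [v Hv]; [intros n; apply (Hstep n (st n))|].
(* With [eta / 2], the local estimate on a small rectangle around [(u, v)] contradicts the lower
   bound [eta * (h n * h n)] kept by the bisection. *)
destruct (Hloc u v (eta / 2)) as [d [Hd H]].
- pose proof (Hu 0%nat) as E. simpl in E. lra.
- pose proof (Hv 0%nat) as E. simpl in E. lra.
- lra.
- destruct (pow_lt_1_zero (/ 2) ltac:(rewrite Rabs_pos_eq; lra) d Hd) as [N HN].
  specialize (HN N (Nat.le_refl N)). rewrite Rabs_pos_eq in HN by (apply pow_le; lra).
  destruct (Hin N) as (I1 & I2 & I3 & I4).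
  specialize (H _ _ (h N) (conj (Rlt_le _ _ (Hh N)) HN) I1 I2 I3 I4 (Hu N) (Hv N)).
  pose proof (Hbig N). pose proof (Rmult_lt_0_compat _ _ (Hh N) (Hh N)). nra.
Qed.

(** The integral of [A] along the edge depends only on the end points, through the primitive [P];
    around a closed rectangle these contributions cancel and only the error [F - A] is left. *)
Lemma edge_integral_approx (F P A : C -> C) (psi psi' : R -> C) (x1 x2 K M : R) :
  x1 <= x2 ->
  (forall t, x1 <= t <= x2 -> cder psi t (psi' t)) ->
  (forall t, x1 <= t <= x2 -> ccont psi' t) ->
  (forall t, x1 <= t <= x2 -> ccont (fun r => F (psi r)) t) ->
  (forall w, has_cderiv P w (A w)) -> (forall w, exists l, has_cderiv A w l) ->
  (forall t, x1 <= t <= x2 -> Cmod (psi' t) <= K) ->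
  (forall t, x1 <= t <= x2 -> Cmod (F (psi t) - A (psi t)) <= M) ->
  Cmod (CInt (fun t => F (psi t) * psi' t)%C x1 x2 - (P (psi x2) - P (psi x1)))
    <= 2 * ((x2 - x1) * (M * K)).
Proof.
intros Hx Hpsi Hpsi' HF HP HA HK HM.
assert (CA : forall t, x1 <= t <= x2 -> ccont (fun r => A (psi r)) t).
{ intros t Ht. destruct (HA (psi t)) as [l Hl]. apply (ccont_comp A psi t l Hl).
  exact (cder_ccont _ _ _ (Hpsi t Ht)). }
rewrite <- (CInt_cder (fun t => P (psi t)) (fun t => A (psi t) * psi' t)%C x1 x2 Hx).
- rewrite <- CInt_minus; [|exact Hx| |].
  + apply CInt_bound; [exact Hx| |].
    * intros t Ht. apply ccont_minus; apply ccont_mult; auto.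
    * intros t Ht. replace (F (psi t) * psi' t - A (psi t) * psi' t)%C
        with ((F (psi t) - A (psi t)) * psi' t)%C by ring.
      rewrite Cmod_mult. apply Rmult_le_compat; auto using Cmod_ge_0.
  + intros t Ht. apply ccont_mult; auto.
  + intros t Ht. apply ccont_mult; auto.
- intros t Ht. apply cder_comp; [apply HP|now apply Hpsi].
- intros t Ht. apply ccont_mult; auto.
Qed.

(** The segment from the apex [a] ([s = 0]) to the point [c t] of the base curve ([s = 1]). *)
Definition cone (a : C) (c : R -> C) (s t : R) : C := (a + RtoC s * (c t - a))%C.

Section ConeGoursat.
Variables (F F' : C -> C) (a : C) (c c' : R -> C) (s0 s1 t0 t1 K : R).
Hypothesis (Hs : 0 <= s0 <= s1) (Hs1 : s1 <= 1) (Ht : t0 <= t1).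
Hypothesis Hc : forall t, t0 <= t <= t1 -> cder c t (c' t).
Hypothesis Hc' : forall t, t0 <= t <= t1 -> ccont c' t.
Hypothesis HcK : forall t, t0 <= t <= t1 -> Cmod (c t - a) <= K.
Hypothesis Hc'K : forall t, t0 <= t <= t1 -> Cmod (c' t) <= K.
Hypothesis HF : forall s t, s0 <= s <= s1 -> t0 <= t <= t1 ->
  has_cderiv F (cone a c s t) (F' (cone a c s t)).

(** [hor] and [ver] integrate [F dz] over the images of the edges of parameter rectangles, and [W]
    is the integral over the whole oriented boundary. These images are curved, so the bisection has
    to take place in the parameters. *)
Let hor (t x1 x2 : R) : C := CInt (fun s => F (cone a c s t) * (c t - a))%C x1 x2.
Let ver (s y1 y2 : R) : C := CInt (fun t => F (cone a c s t) * (RtoC s * c' t))%C y1 y2.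
Let W (x y p q : R) : C :=
  Cminus (Cminus (Cplus (hor y x (x + p)) (ver (x + p) y (y + q))) (hor (y + q) x (x + p)))
         (ver x y (y + q)).

Let cone_cder_s (s t : R) : cder (fun r => cone a c r t) s (c t - a).
Proof. apply cder_line. Qed.

Let cone_cder_t (s t : R) : t0 <= t <= t1 -> cder (fun r => cone a c s r) t (RtoC s * c' t)%C.
Proof.
intros H. unfold cone.
eapply cder_eq.
- refine (cder_comp (fun w => a + RtoC s * (w - a))%C c t _ _ _ (Hc t H)).
  apply has_cderiv_plus; [apply has_cderiv_const|].
  apply has_cderiv_scal, has_cderiv_minus; [apply has_cderiv_id|apply has_cderiv_const].
- ring.
Qed.

Let cont_s (s t : R) : s0 <= s <= s1 -> t0 <= t <= t1 -> ccont (fun r => F (cone a c r t)) s.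
Proof.
intros H1 H2. eapply ccont_comp; [exact (HF s t H1 H2)|].
exact (cder_ccont _ _ _ (cone_cder_s s t)).
Qed.

Let cont_t (s t : R) : s0 <= s <= s1 -> t0 <= t <= t1 -> ccont (fun r => F (cone a c s r)) t.
Proof.
intros H1 H2. eapply ccont_comp; [exact (HF s t H1 H2)|].
exact (cder_ccont _ _ _ (cone_cder_t s t H2)).
Qed.

Let hor_Chasles (t x1 x2 x3 : R) :
  t0 <= t <= t1 -> s0 <= x1 -> x1 <= x2 -> x2 <= x3 -> x3 <= s1 ->
  hor t x1 x3 = (hor t x1 x2 + hor t x2 x3)%C.
Proof.
intros. unfold hor. symmetry. apply CInt_Chasles; try lra.
intros s Hs'. apply ccont_mult; [apply cont_s; lra|apply ccont_const].
Qed.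

Let ver_Chasles (s y1 y2 y3 : R) :
  s0 <= s <= s1 -> t0 <= y1 -> y1 <= y2 -> y2 <= y3 -> y3 <= t1 ->
  ver s y1 y3 = (ver s y1 y2 + ver s y2 y3)%C.
Proof.
intros. unfold ver. symmetry. apply CInt_Chasles; try lra.
intros t Ht'. apply ccont_mult; [apply cont_t; lra|].
apply ccont_mult; [apply ccont_const|apply Hc'; lra].
Qed.

(** On a parameter rectangle of scale [k], the image of the boundary has length and diameter of
    order [k], and [F] differs from its affine approximation by a small multiple of [k]; so the
    boundary integral is a small multiple of [k^2], as [rectangle_bisection] requires. *)
Lemma cone_goursat :
  (CInt (fun s => F (cone a c s t0) * (c t0 - a)) s0 s1
   + CInt (fun t => F (cone a c s1 t) * (RtoC s1 * c' t)) t0 t1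
   - CInt (fun s => F (cone a c s t1) * (c t1 - a)) s0 s1
   - CInt (fun t => F (cone a c s0 t) * (RtoC s0 * c' t)) t0 t1)%C = RtoC 0.
Proof.
fold (hor t0 s0 s1) (hor t1 s0 s1) (ver s1 t0 t1) (ver s0 t0 t1).
assert (HK : 0 <= K) by (eapply Rle_trans; [apply Cmod_ge_0|apply (HcK t0); lra]).
assert (E : W s0 t0 (s1 - s0) (t1 - t0) = RtoC 0).
2:{ unfold W in E. replace (s0 + (s1 - s0)) with s1 in E by ring.
    replace (t0 + (t1 - t0)) with t1 in E by ring. exact E. }
apply rectangle_bisection; [lra|lra| |].
- intros x y k Hk X1 X2 Y1 Y2.
  assert (P : 0 <= (s1 - s0) * (/ 2 * k)) by (apply Rmult_le_pos; lra).
  assert (Q : 0 <= (t1 - t0) * (/ 2 * k)) by (apply Rmult_le_pos; lra).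
  replace ((s1 - s0) * k) with ((s1 - s0) * (/ 2 * k) + (s1 - s0) * (/ 2 * k)) in * by field.
  replace ((t1 - t0) * k) with ((t1 - t0) * (/ 2 * k) + (t1 - t0) * (/ 2 * k)) in * by field.
  set (p := (s1 - s0) * (/ 2 * k)) in *. set (q := (t1 - t0) * (/ 2 * k)) in *.
  unfold W. rewrite <- !Rplus_assoc.
  rewrite (hor_Chasles y x (x + p) (x + p + p)), (hor_Chasles (y + q + q) x (x + p) (x + p + p)),
    (ver_Chasles x y (y + q) (y + q + q)), (ver_Chasles (x + p + p) y (y + q) (y + q + q)) by lra.
  ring.
- intros u v eps Hu Hv He.
  (* [A1 * k] bounds [p + q], and [B1 * k * K1] bounds the distance from [ws] to the image of the
     small rectangle; the 2 in [B1] is that of [cder_bound], and the added ones keep everything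
     positive. The constant [e] is fitted so that the four edge errors add up to at most
     [eps * (k * k)]. *)
  set (A1 := s1 - s0 + (t1 - t0) + 1). set (B1 := s1 - s0 + 2 * (t1 - t0) + 1). set (K1 := K + 1).
  assert (HA1 : 0 < A1) by (unfold A1; lra). assert (HB1 : 0 < B1) by (unfold B1; lra).
  assert (HK1 : 0 < K1) by (unfold K1; lra).
  set (e := eps / (8 * A1 * B1 * K1 * K1)).
  assert (He' : 0 < e) by (apply Rdiv_lt_0_compat; [exact He|repeat apply Rmult_lt_0_compat; lra]).
  set (ws := cone a c u v).
  destruct (proj1 (has_cderiv_eps F ws _) (HF u v ltac:(lra) ltac:(lra)) e He') as [d [Hd HE]].
  fold ws in HE.
  exists (d / (B1 * K1)). split; [apply Rdiv_lt_0_compat; [exact Hd|now apply Rmult_lt_0_compat]|].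
  intros x y k [Hk0 Hk] X1 X2 Y1 Y2 U V.
  assert (HkBK : B1 * k * K1 < d).
  { apply Rmult_lt_compat_r with (r := B1 * K1) in Hk; [|now apply Rmult_lt_0_compat].
    replace (d / (B1 * K1) * (B1 * K1)) with d in Hk by (field; lra). lra. }
  set (p := (s1 - s0) * k) in *. set (q := (t1 - t0) * k) in *.
  assert (Hp : 0 <= p) by (apply Rmult_le_pos; lra).
  assert (Hq : 0 <= q) by (apply Rmult_le_pos; lra).
  assert (near : forall s t, x <= s <= x + p -> y <= t <= y + q ->
                 Cmod (cone a c s t - ws) <= B1 * k * K1).
  { intros s t S T. unfold ws, cone.
    replace (a + RtoC s * (c t - a) - (a + RtoC u * (c v - a)))%C
      with (RtoC (s - u) * (c t - a) + RtoC u * (c t - c v))%C by (rewrite RtoC_minus; ring).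
    eapply Rle_trans; [apply Cmod_triangle|]. rewrite !Cmod_mult, !Cmod_R.
    assert (S1 : Rabs (s - u) <= p) by (apply Rabs_le; lra).
    assert (U1 : Rabs u <= 1) by (apply Rabs_le; lra).
    assert (C1 : Cmod (c t - a) <= K) by (apply HcK; lra).
    assert (C2 : Cmod (c t - c v) <= 2 * K * q).
    { eapply Rle_trans; [apply (cder_bound c c' t0 t1 K Hc Hc'K t v); lra|].
      apply Rmult_le_compat_l; [lra|]. apply Rabs_le; lra. }
    assert (M1 : Rabs (s - u) * Cmod (c t - a) <= p * K)
      by (apply Rmult_le_compat; auto using Rabs_pos, Cmod_ge_0).
    assert (M2 : Rabs u * Cmod (c t - c v) <= 1 * (2 * K * q))
      by (apply Rmult_le_compat; auto using Rabs_pos, Cmod_ge_0).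
    apply Rle_trans with ((p + 2 * q) * K); [lra|].
    apply Rmult_le_compat; [lra|exact HK| |unfold K1; lra].
    unfold p, q, B1. lra. }
  (* [A] is the affine approximation of [F] at [ws], and [P] is a primitive of [A]. *)
  set (A := fun w => (F ws + F' ws * (w - ws))%C).
  set (P := fun w => (F ws * w + (F' ws * / 2) * ((w - ws) * (w - ws)))%C).
  assert (HA : forall w, exists l, has_cderiv A w l).
  { intros w. eexists. unfold A. apply has_cderiv_plus; [apply has_cderiv_const|].
    apply has_cderiv_scal, has_cderiv_minus; [apply has_cderiv_id|apply has_cderiv_const]. }
  assert (HP : forall w, has_cderiv P w (A w)).
  { intros w. unfold P. eapply has_cderiv_eq.
    - apply has_cderiv_plus; apply has_cderiv_scal; [apply has_cderiv_id|].
      apply has_cderiv_mult; (apply has_cderiv_minus; [apply has_cderiv_id|apply has_cderiv_const]).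
    - unfold A. cbv beta. field. }
  assert (HEA : forall s t, x <= s <= x + p -> y <= t <= y + q ->
                Cmod (F (cone a c s t) - A (cone a c s t)) <= e * (B1 * k * K1)).
  { intros s t S T. pose proof (near s t S T) as N. unfold A.
    replace (F (cone a c s t) - (F ws + F' ws * (cone a c s t - ws)))%C
      with (F (cone a c s t) - F ws - F' ws * (cone a c s t - ws))%C by ring.
    eapply Rle_trans; [apply HE; lra|]. apply Rmult_le_compat_l; lra. }
  set (M := e * (B1 * k * K1)) in *.
  assert (HM : 0 <= M) by (eapply Rle_trans; [apply Cmod_ge_0|apply (HEA x y); lra]).
  assert (hor_b : forall t, y <= t <= y + q ->
    Cmod (hor t x (x + p) - (P (cone a c (x + p) t) - P (cone a c x t))) <= 2 * (p * (M * K))).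
  { intros t T. eapply Rle_trans.
    - apply (edge_integral_approx F P A (fun s => cone a c s t) (fun _ => (c t - a)%C) x (x + p) K M);
        try assumption; intros; first [lra|apply cone_cder_s|apply ccont_const|apply cont_s; lra
          |apply HcK; lra|apply HEA; lra].
    - apply Req_le. ring. }
  assert (ver_b : forall s, x <= s <= x + p ->
    Cmod (ver s y (y + q) - (P (cone a c s (y + q)) - P (cone a c s y))) <= 2 * (q * (M * K))).
  { intros s S. eapply Rle_trans.
    - apply (edge_integral_approx F P A (fun t => cone a c s t) (fun t => (RtoC s * c' t)%C) y (y + q) K M);
        try assumption; intros; first [lra|apply cone_cder_t; lra
          |apply ccont_mult; [apply ccont_const|apply Hc'; lra]|apply cont_t; lra
          |apply HEA; lra|idtac].
      rewrite Cmod_mult, Cmod_R, <- (Rmult_1_l K).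
      apply Rmult_le_compat; [apply Rabs_pos|apply Cmod_ge_0|apply Rabs_le; lra|apply Hc'K; lra].
    - apply Req_le. ring. }
  pose proof (hor_b y ltac:(lra)) as h1. pose proof (hor_b (y + q) ltac:(lra)) as h2.
  pose proof (ver_b x ltac:(lra)) as v1. pose proof (ver_b (x + p) ltac:(lra)) as v2.
  unfold W.
  match goal with |- Cmod (?X1 + ?X2 - ?X3 - ?X4) <= _ =>
    replace (X1 + X2 - X3 - X4)%C with
      (((X1 - (P (cone a c (x + p) y) - P (cone a c x y)))
       + (X2 - (P (cone a c (x + p) (y + q)) - P (cone a c (x + p) y))))
       + (- (X3 - (P (cone a c (x + p) (y + q)) - P (cone a c x (y + q))))
       + - (X4 - (P (cone a c x (y + q)) - P (cone a c x y)))))%C by ring end.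
  eapply Rle_trans; [apply Cmod_triangle|].
  eapply Rle_trans; [apply Rplus_le_compat; apply Cmod_triangle|].
  rewrite !Cmod_opp.
  apply Rle_trans with (8 * ((p + q) * (M * K))); [|].
  { assert (HMK : 0 <= M * K) by now apply Rmult_le_pos.
    pose proof (Rmult_le_pos _ _ Hp HMK). pose proof (Rmult_le_pos _ _ Hq HMK). lra. }
  apply Rle_trans with (8 * ((A1 * k) * (M * K1))).
  + apply Rmult_le_compat_l; [lra|]. apply Rmult_le_compat.
    * lra.
    * now apply Rmult_le_pos.
    * unfold p, q, A1. lra.
    * apply Rmult_le_compat_l; [exact HM|unfold K1; lra].
  + apply Req_le. unfold M, e. field. lra.
Qed.
End ConeGoursat.

(** * Cauchy's formula *)

Definition holo_disc (R0 : R) (f f' : C -> C) : Prop :=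
  forall z, Cmod z < R0 -> has_cderiv f z (f' z).

Definition cis (t : R) : C := (cos t, sin t).
Definition circ (rho t : R) : C := (RtoC rho * cis t)%C.
(** For [w = rho e^(it)] one has [dw / (2 pi i w) = dt / (2 pi)]. Contour integrals over circles are
    therefore written as means, and Cauchy's kernel becomes the factor [w / (w - a)]. *)
Definition Cmean (phi : R -> C) : C := (CInt phi 0 (2 * PI) / RtoC (2 * PI))%C.

Lemma two_PI_pos : 0 < 2 * PI.
Proof. pose proof PI_RGT_0; lra. Qed.

Lemma two_PI_neq0 : RtoC (2 * PI) <> RtoC 0.
Proof. intros H. pose proof two_PI_pos. apply RtoC_inj in H. lra. Qed.

Lemma Cmod_cis (t : R) : Cmod (cis t) = 1.
Proof.
unfold Cmod, cis; simpl. pose proof (sin2_cos2 t) as H. unfold Rsqr in H.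
replace (cos t * (cos t * 1) + sin t * (sin t * 1)) with 1 by lra. apply sqrt_1.
Qed.

Lemma cis_neq0 (t : R) : cis t <> 0.
Proof. apply Cmod_gt_0. rewrite Cmod_cis. lra. Qed.

Lemma cis_2PI : cis (2 * PI) = cis 0.
Proof. unfold cis. now rewrite cos_2PI, sin_2PI, cos_0, sin_0. Qed.

Lemma cder_cis (t : R) : cder cis t (Ci * cis t)%C.
Proof.
split; simpl.
- replace (0 * cos t - 1 * sin t) with (- sin t) by ring. apply is_derive_Reals, derivable_pt_lim_cos.
- replace (0 * sin t + 1 * cos t) with (cos t) by ring. apply is_derive_Reals, derivable_pt_lim_sin.
Qed.

Lemma cder_circ (rho t : R) : cder (circ rho) t (Ci * circ rho t)%C.
Proof.
eapply cder_eq; [apply (cder_scal rho cis), cder_cis|]. unfold circ. ring.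
Qed.

Lemma ccont_circ (rho t : R) : ccont (circ rho) t.
Proof. exact (cder_ccont _ _ _ (cder_circ rho t)). Qed.

Lemma Cmod_circ (rho t : R) : 0 <= rho -> Cmod (circ rho t) = rho.
Proof. intros H. unfold circ. rewrite Cmod_mult, Cmod_cis, Cmod_R, Rabs_pos_eq by exact H. ring. Qed.

Lemma circ_2PI (rho : R) : circ rho (2 * PI) = circ rho 0.
Proof. unfold circ. now rewrite cis_2PI. Qed.

Lemma Cmod_minus_ge (z w : C) : Cmod z - Cmod w <= Cmod (z - w).
Proof.
pose proof (Cmod_triangle (z - w) w) as H. replace (z - w + w)%C with z in H by ring. lra.
Qed.

Lemma Cmod_sub_sym (z w : C) : Cmod (z - w) = Cmod (w - z).
Proof. rewrite <- Cmod_opp. f_equal. ring. Qed.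

Lemma Csub_neq0 (z w : C) : z <> w -> (z - w)%C <> 0.
Proof. intros H E. apply H. replace z with (z - w + w)%C by ring. rewrite E. ring. Qed.

Lemma circ_sub_ge (rho t : R) (a : C) : 0 <= rho -> rho - Cmod a <= Cmod (circ rho t - a).
Proof. intros H. pose proof (Cmod_minus_ge (circ rho t) a). rewrite Cmod_circ in *; lra. Qed.

Lemma circ_sub_neq0 (rho t : R) (a : C) : Cmod a < rho -> (circ rho t - a)%C <> 0.
Proof.
intros H. apply Cmod_gt_0. pose proof (Cmod_ge_0 a).
pose proof (circ_sub_ge rho t a ltac:(lra)). lra.
Qed.

Lemma ccont_circ_sub (rho t : R) (z : C) : ccont (fun r => circ rho r - z)%C t.
Proof. apply ccont_minus; [apply ccont_circ|apply ccont_const]. Qed.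

Lemma ccont_cauchy_kernel (rho : R) (a : C) (t : R) :
  Cmod a < rho -> ccont (fun t => circ rho t / (circ rho t - a))%C t.
Proof.
intros H. apply ccont_div; [apply ccont_circ|apply ccont_circ_sub|now apply circ_sub_neq0].
Qed.

Lemma Cmean_ext (f g : R -> C) : (forall t, f t = g t) -> Cmean f = Cmean g.
Proof.
intros H. unfold Cmean. f_equal. apply CInt_ext; [pose proof two_PI_pos; lra|]. intros; apply H.
Qed.

Lemma Cmean_plus (f g : R -> C) :
  (forall t, ccont f t) -> (forall t, ccont g t) -> Cmean (fun t => f t + g t)%C = (Cmean f + Cmean g)%C.
Proof.
intros Hf Hg. unfold Cmean. rewrite CInt_plus; auto; [|pose proof two_PI_pos; lra].
field. apply two_PI_neq0.
Qed.

Lemma Cmean_minus (f g : R -> C) :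
  (forall t, ccont f t) -> (forall t, ccont g t) -> Cmean (fun t => f t - g t)%C = (Cmean f - Cmean g)%C.
Proof.
intros Hf Hg. unfold Cmean. rewrite CInt_minus; auto; [|pose proof two_PI_pos; lra].
field. apply two_PI_neq0.
Qed.

Lemma Cmean_scal (c : C) (f : R -> C) :
  (forall t, ccont f t) -> Cmean (fun t => c * f t)%C = (c * Cmean f)%C.
Proof.
intros Hf. unfold Cmean. rewrite CInt_scal; auto; [|pose proof two_PI_pos; lra].
field. apply two_PI_neq0.
Qed.

Lemma Cmean_bound (f : R -> C) (M : R) :
  (forall t, ccont f t) -> (forall t, 0 <= t <= 2 * PI -> Cmod (f t) <= M) -> Cmod (Cmean f) <= 2 * M.
Proof.
intros Hf HM. pose proof two_PI_pos as HP. unfold Cmean. rewrite Cmod_div by apply two_PI_neq0.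
rewrite Cmod_R, Rabs_pos_eq by lra. apply Rle_div_l; [lra|].
eapply Rle_trans; [apply (CInt_bound f 0 (2 * PI) M); auto; lra|]. apply Req_le. ring.
Qed.

Lemma Cmean_const (c : C) : Cmean (fun _ => c) = c.
Proof.
unfold Cmean. pose proof two_PI_pos as HP. pose proof two_PI_neq0 as HN.
rewrite (CInt_cder (fun t => 0 + RtoC t * c)%C); [| lra| |].
- set (p := RtoC (2 * PI)) in *. field. exact HN.
- intros t _. apply cder_line.
- intros t _. apply ccont_const.
Qed.

(* [G'(w) w] is, up to the factor [i], the derivative of [G] along the circle. *)
Lemma Cmean_derivative (G G' : C -> C) (rho : R) :
  (forall t, has_cderiv G (circ rho t) (G' (circ rho t))) ->
  (forall t, ccont (fun r => G' (circ rho r)) t) ->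
  Cmean (fun t => G' (circ rho t) * circ rho t)%C = 0.
Proof.
intros HG HG'. pose proof two_PI_pos as HP. unfold Cmean.
assert (E : CInt (fun t => G' (circ rho t) * (Ci * circ rho t))%C 0 (2 * PI) = 0).
{ rewrite (CInt_cder (fun t => G (circ rho t))); [|lra| |].
  - rewrite circ_2PI. ring.
  - intros t _. apply cder_comp; [apply HG|apply cder_circ].
  - intros t _. apply ccont_mult; [apply HG'|].
    apply ccont_mult; [apply ccont_const|apply ccont_circ]. }
rewrite (CInt_ext _ (fun t => (- Ci) * (G' (circ rho t) * (Ci * circ rho t)))%C); [|lra|].
- rewrite CInt_scal, E; [|lra|].
  + field. apply two_PI_neq0.
  + intros t _. apply ccont_mult; [apply HG'|].
    apply ccont_mult; [apply ccont_const|apply ccont_circ].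
- intros t _. transitivity ((- (Ci * Ci)) * (G' (circ rho t) * circ rho t))%C; [|ring].
  replace (Ci * Ci)%C with (RtoC (-1)); [|apply injective_projections; simpl; ring].
  apply injective_projections; simpl; ring.
Qed.

Lemma ccont_pow (f : R -> C) (n : nat) (t : R) : ccont f t -> ccont (fun s => f s ^ n)%C t.
Proof.
intros H. induction n as [|n IH]; [apply (ccont_const 1)|]. exact (ccont_mult f _ t H IH).
Qed.

Lemma Cmean_inv_pow (rho : R) (n : nat) : 0 < rho -> Cmean (fun t => (/ circ rho t) ^ S n)%C = 0.
Proof.
intros Hr.
assert (HN : forall t, circ rho t <> 0).
{ intros t. apply Cmod_gt_0. rewrite Cmod_circ; lra. }
set (G' := fun w => (- RtoC (INR (S n)) * (/ w) ^ S (S n))%C).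
assert (Hi : forall t, ccont (fun r => / circ rho r)%C t) by (intros t; apply ccont_inv; [apply ccont_circ|apply HN]).
assert (HSn : RtoC (INR (S n)) <> 0).
{ intros H. apply RtoC_inj in H. pose proof (lt_0_INR (S n) ltac:(lia)). lra. }
rewrite (Cmean_ext _ (fun t => (- / RtoC (INR (S n))) * (G' (circ rho t) * circ rho t))%C).
- rewrite Cmean_scal, (Cmean_derivative (fun w => (/ w) ^ S n)%C); [ring| | |].
  + intros t. eapply has_cderiv_eq.
    * apply (has_cderiv_comp (fun w => w ^ S n)%C Cinv); [apply has_cderiv_pow|].
      apply has_cderiv_Cinv, HN.
    * unfold G'. simpl pred. cbn [Cpow]. field. apply HN.
  + intros t. apply ccont_mult; [apply ccont_const|]. now apply ccont_pow.
  + intros t. apply ccont_mult; [|apply ccont_circ].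
    apply ccont_mult; [apply ccont_const|]. now apply ccont_pow.
- intros t. unfold G'. cbn [Cpow]. field. split; [apply HN|exact HSn].
Qed.

(** The passage to the limit in [n] in explicit form; it removes the tails of the geometric and
    logarithmic series. *)
Lemma nonneg_of_geometric (x q K : R) :
  0 <= q < 1 -> (forall n, - (K * q ^ n) <= x) -> 0 <= x.
Proof.
intros Hq H. destruct (Rle_lt_dec 0 x) as [|Hx]; [assumption|exfalso].
assert (HK : 0 < K) by (specialize (H 0%nat); simpl in H; lra).
destruct (pow_lt_1_zero q ltac:(rewrite Rabs_pos_eq; lra) (- x / K)) as [N HN].
{ apply Rdiv_lt_0_compat; lra. }
specialize (HN N (Nat.le_refl N)). rewrite Rabs_pos_eq in HN by (apply pow_le; lra).
specialize (H N). apply Rmult_lt_compat_l with (r := K) in HN; [|exact HK].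
replace (K * (- x / K)) with (- x) in HN by (field; lra). lra.
Qed.


Lemma Cmod_le_pow_0 (z : C) (x M : R) :
  0 <= x < 1 -> (forall n, Cmod z <= M * x ^ n) -> z = 0.
Proof.
intros Hx H. apply Cmod_eq_0, Rle_antisym; [|apply Cmod_ge_0].
assert (0 <= - Cmod z); [|lra].
apply (nonneg_of_geometric _ x M Hx). intros n. specialize (H n). lra.
Qed.
(** The kernel is the sum of the geometric series in [a / w], and [J n] is the mean of its tail
    after [n] terms. Every power after the first has mean zero, so all the [J n] with [n >= 1]
    agree, and they are 0 since the tails decay geometrically. *)
Lemma Cmean_cauchy_kernel (rho : R) (a : C) :
  Cmod a < rho -> Cmean (fun t => circ rho t / (circ rho t - a))%C = 1.
Proof.
intros Ha. pose proof (Cmod_ge_0 a) as Ha0. assert (Hr : 0 < rho) by lra.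
assert (HN : forall t, circ rho t <> 0).
{ intros t. apply Cmod_gt_0. rewrite Cmod_circ; lra. }
pose proof (fun t => circ_sub_neq0 rho t a Ha) as HNa.
set (J := fun n => Cmean (fun t => (a / circ rho t) ^ n * (circ rho t / (circ rho t - a)))%C).
assert (Cac : forall n t, ccont (fun t => (a / circ rho t) ^ n)%C t).
{ intros n t. apply ccont_pow, ccont_div; [apply ccont_const|apply ccont_circ|apply HN]. }
pose proof (fun t => ccont_cauchy_kernel rho a t Ha) as Cker.
assert (Hstep : forall n, J n = (Cmean (fun t => (a / circ rho t) ^ n)%C + J (S n))%C).
{ intros n. unfold J. rewrite <- Cmean_plus.
  - apply Cmean_ext. intros t. cbn [Cpow]. field. split; [apply HNa|apply HN].
  - apply Cac.
  - intros t. apply ccont_mult; [apply Cac|apply Cker]. }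
assert (Hz : forall n, Cmean (fun t => (a / circ rho t) ^ S n)%C = 0).
{ intros n. rewrite (Cmean_ext _ (fun t => a ^ S n * (/ circ rho t) ^ S n)%C).
  - rewrite Cmean_scal, Cmean_inv_pow; [ring|exact Hr|].
    intros t. apply ccont_pow, ccont_inv; [apply ccont_circ|apply HN].
  - intros t. unfold Cdiv. apply Cpow_mult_l. }
assert (HJ : forall n, J (S n) = J 1%nat).
{ induction n as [|n IH]; [reflexivity|]. rewrite <- IH, (Hstep (S n)), Hz. ring. }
assert (HJ1 : J 1%nat = 0).
{ apply (Cmod_le_pow_0 _ (Cmod a / rho) (2 * (rho / (rho - Cmod a)) * (Cmod a / rho))).
  - split; [apply Rdiv_le_0_compat; lra|]. apply Rlt_div_l; lra.
  - intros n. rewrite <- (HJ n). unfold J.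
    eapply Rle_trans; [apply (Cmean_bound _ ((Cmod a / rho) ^ S n * (rho / (rho - Cmod a))))|].
    + intros t. apply ccont_mult; [apply Cac|apply Cker].
    + intros t _. rewrite Cmod_mult, Cmod_pow, !Cmod_div, Cmod_circ by (auto; lra).
      apply Rmult_le_compat_l; [apply pow_le, Rdiv_le_0_compat; lra|].
      apply Rmult_le_compat_l; [lra|]. apply Rinv_le_contravar; [lra|]. apply circ_sub_ge. lra.
    + apply Req_le. simpl. ring. }
transitivity (J 0%nat).
- apply Cmean_ext. intros t. simpl. ring.
- rewrite (Hstep 0%nat), HJ1. simpl. rewrite Cmean_const. ring.
Qed.

(** The quotient [F] is holomorphic away from [a]. [cone_goursat] between the levels [s] and 1,
    whose two radial sides coincide, shows that the integral [ver s] of [F] over the shrunken circle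
    does not depend on [s]. In [ver s] the factor [s] cancels against the denominator of [F], so
    [ver s] tends to 0 by the continuity of [f] at [a]. *)
Lemma cauchy_formula (R0 rho : R) (f f' : C -> C) (a : C) :
  rho < R0 -> Cmod a < rho -> holo_disc R0 f f' ->
  Cmean (fun t => f (circ rho t) * (circ rho t / (circ rho t - a)))%C = f a.
Proof.
intros HrR Ha Hf. pose proof (Cmod_ge_0 a) as Ha0. pose proof two_PI_pos as HP.
pose proof (fun t => circ_sub_neq0 rho t a Ha) as HNa.
set (c := circ rho). set (F := fun w => ((f w - f a) / (w - a))%C).
set (F' := fun w => ((f' w * (w - a) - (f w - f a) * (1 - 0)) / ((w - a) * (w - a)))%C).
assert (Hcone : forall s t, 0 <= s <= 1 -> Cmod (cone a c s t) <= rho).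
{ intros s t Hs. unfold cone, c. replace (a + RtoC s * (circ rho t - a))%C
    with (RtoC (1 - s) * a + RtoC s * circ rho t)%C by (rewrite RtoC_minus; ring).
  eapply Rle_trans; [apply Cmod_triangle|].
  rewrite !Cmod_mult, !Cmod_R, Cmod_circ, !Rabs_pos_eq by lra. nra. }
assert (Hcn : forall s t, 0 < s -> (cone a c s t - a)%C <> 0).
{ intros s t Hs. unfold cone. replace (a + RtoC s * (c t - a) - a)%C with (RtoC s * (c t - a))%C by ring.
  apply Cmult_neq_0; [|apply HNa]. intros H. apply RtoC_inj in H. lra. }
assert (HF : forall s t, 0 < s <= 1 -> has_cderiv F (cone a c s t) (F' (cone a c s t))).
{ intros s t Hs. unfold F, F'.
  eapply has_cderiv_eq; [apply has_cderiv_div|].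
  - apply has_cderiv_minus; [|apply has_cderiv_const]. apply Hf.
    eapply Rle_lt_trans; [apply Hcone; lra|exact HrR].
  - apply has_cderiv_minus; [apply has_cderiv_id|apply has_cderiv_const].
  - apply Hcn; lra.
  - cbv beta. f_equal. ring. }
set (ver := fun s => CInt (fun t => F (cone a c s t) * (RtoC s * (Ci * c t)))%C 0 (2 * PI)).
assert (Hver : forall s, 0 < s <= 1 -> ver 1 = ver s).
{ intros s Hs.
  pose proof (cone_goursat F F' a c (fun t => Ci * c t)%C s 1 0 (2 * PI) (2 * rho)) as G.
  assert (E2 : forall r, cone a c r (2 * PI) = cone a c r 0)
    by (intros r; unfold cone, c; now rewrite circ_2PI).
  assert (Ec : c (2 * PI) = c 0) by apply circ_2PI.
  rewrite (CInt_ext (fun r => F (cone a c r (2 * PI)%R) * (c (2 * PI)%R - a))%C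
    (fun r => F (cone a c r 0) * (c 0 - a))%C s 1) in G; [|lra|intros; now rewrite E2, Ec].
  cbv beta in G. fold (ver 1) (ver s) in G.
  match type of G with _ -> _ -> _ -> _ -> _ -> _ -> _ -> _ -> (?A + _ - _ - _)%C = _ => set (X := A) in G end.
  assert (E : (ver 1 - ver s)%C = 0).
  { transitivity (X + ver 1 - X - ver s)%C; [ring|]. apply G; try lra.
    - intros t _. apply cder_circ.
    - intros t _. apply ccont_mult; [apply ccont_const|apply ccont_circ].
    - intros t _. eapply Rle_trans; [apply (Cmod_triangle (c t) (- a))|].
      rewrite Cmod_opp. unfold c. rewrite Cmod_circ; lra.
    - intros t _. unfold c. rewrite Cmod_mult, Cmod_Ci, Cmod_circ; lra.
    - intros r t Hr _. apply HF. lra. }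
  replace (ver 1) with ((ver 1 - ver s) + ver s)%C by ring. rewrite E. ring. }
assert (Hv1 : ver 1 = 0).
{ apply Cmod_eq_0. apply Rle_antisym; [|apply Cmod_ge_0]. apply le_epsilon. intros eps He.
  set (k := 2 * (2 * PI) * (rho / (rho - Cmod a))).
  assert (Hk : 0 < k).
  { unfold k. apply Rmult_lt_0_compat; [lra|]. apply Rdiv_lt_0_compat; lra. }
  destruct (has_cderiv_continuous f a (f' a) (Hf a ltac:(lra)) (eps / k)) as [d [Hd Hfa]].
  { now apply Rdiv_lt_0_compat. }
  (* As [|c t - a| <= 2 rho], this puts the whole curve at level [s] within [d] of [a]. *)
  set (s := Rmin 1 (d / (4 * rho))).
  assert (Hs : 0 < s <= 1).
  { split; [apply Rmin_pos; [lra|apply Rdiv_lt_0_compat; lra]|apply Rmin_l]. }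
  assert (Hsd : s * (2 * rho) < d).
  { assert (s <= d / (4 * rho)) by apply Rmin_r.
    apply Rle_lt_trans with (d / (4 * rho) * (2 * rho)).
    - apply Rmult_le_compat_r; lra.
    - replace (d / (4 * rho) * (2 * rho)) with (d / 2) by (field; lra). lra. }
  rewrite (Hver s Hs), Rplus_0_l. unfold ver.
  assert (Hsn : RtoC s <> 0) by (intros H; apply RtoC_inj in H; lra).
  rewrite (CInt_ext _ (fun t => (f (cone a c s t) - f a) * (Ci * c t / (c t - a)))%C); [|lra|].
  2:{ intros t _. unfold F. replace (cone a c s t - a)%C with (RtoC s * (c t - a))%C by (unfold cone; ring).
      field. split; [apply HNa|exact Hsn]. }
  eapply Rle_trans; [apply (CInt_bound _ 0 (2 * PI) (eps / k * (rho / (rho - Cmod a))))|].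
  - lra.
  - intros t _. apply ccont_mult.
    + apply ccont_minus; [|apply ccont_const].
      apply (ccont_comp f (cone a c s) t (f' (cone a c s t))).
      * apply Hf. eapply Rle_lt_trans; [apply Hcone; lra|exact HrR].
      * unfold cone. apply ccont_plus; [apply ccont_const|].
        apply ccont_mult; [apply ccont_const|].
        apply ccont_circ_sub.
    + apply ccont_div; [|apply ccont_circ_sub|apply HNa].
      apply ccont_mult; [apply ccont_const|apply ccont_circ].
  - intros t _. rewrite Cmod_mult. apply Rmult_le_compat; try apply Cmod_ge_0.
    + apply Rlt_le, Hfa. unfold cone.
      replace (a + RtoC s * (c t - a) - a)%C with (RtoC s * (c t - a))%C by ring.
      rewrite Cmod_mult, Cmod_R, Rabs_pos_eq by lra.
      eapply Rle_lt_trans; [|exact Hsd]. apply Rmult_le_compat_l; [lra|].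
      eapply Rle_trans; [apply (Cmod_triangle (c t) (- a))|].
      rewrite Cmod_opp. unfold c. rewrite Cmod_circ; lra.
    + rewrite Cmod_div, Cmod_mult, Cmod_Ci by apply HNa. unfold c. rewrite Cmod_circ by lra.
      rewrite Rmult_1_l. apply Rmult_le_compat_l; [lra|]. apply Rinv_le_contravar; [lra|].
      apply circ_sub_ge; lra.
  - apply Req_le. unfold k. field. split; lra. }
assert (Cf : forall t, ccont (fun r => f (c r)) t).
{ intros t. apply (ccont_comp f c t (f' (c t))); [|apply ccont_circ].
  apply Hf. unfold c. rewrite Cmod_circ; lra. }
pose proof (fun t => ccont_cauchy_kernel rho a t Ha) as Cker.
assert (E : (Cmean (fun t => f (c t) * (c t / (c t - a))) - f a)%C = 0).
{ rewrite <- (Cmult_1_r (f a)) at 1. rewrite <- (Cmean_cauchy_kernel rho a Ha).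
  rewrite <- Cmean_scal, <- Cmean_minus; [|intros t; now apply ccont_mult| |exact Cker].
  2:{ intros t. apply ccont_mult; [apply ccont_const|apply Cker]. }
  unfold Cmean.
  rewrite (CInt_ext _ (fun t => (- Ci) * (F (cone a c 1 t) * (RtoC 1 * (Ci * c t))))%C); [|lra|].
  - rewrite CInt_scal; [|lra|].
    + fold (ver 1). rewrite Hv1. field. apply two_PI_neq0.
    + intros t _. apply ccont_mult.
      * apply (ccont_comp F (cone a c 1) t _ (HF 1 t ltac:(lra))).
        unfold cone. apply ccont_plus; [apply ccont_const|].
        apply ccont_mult; [apply ccont_const|].
        apply ccont_circ_sub.
      * apply ccont_mult; [apply ccont_const|]. apply ccont_mult; [apply ccont_const|apply ccont_circ].
  - intros t _. unfold F. replace (cone a c 1 t) with (c t) by (unfold cone; ring).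
    transitivity ((f (c t) - f a) * (- (Ci * Ci)) * (c t / (c t - a)))%C.
    + replace (- (Ci * Ci))%C with (RtoC 1) by (apply injective_projections; simpl; ring).
      fold c. ring.
    + field. apply HNa. }
replace (f a) with (Cmean (fun t => f (c t) * (c t / (c t - a)))%C
  - (Cmean (fun t => f (c t) * (c t / (c t - a)))%C - f a))%C by ring.
rewrite E. ring.
Qed.

(** * Holomorphic derivatives and difference quotients *)

Ltac ccont_step :=
  lazymatch goal with
  | |- ccont (fun _ => ?c) _ => apply ccont_const
  | |- ccont (fun r => Cplus _ _) _ => apply ccont_plus
  | |- ccont (fun r => Cminus _ _) _ => apply ccont_minus
  | |- ccont (fun r => Cmult _ _) _ => apply ccont_mult
  end.

Lemma ccont_bounded (f : R -> C) (a b : R) :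
  a <= b -> (forall t, ccont f t) -> exists M, 0 <= M /\ forall t, a <= t <= b -> Cmod (f t) <= M.
Proof.
intros Hab Hf.
assert (H : forall g : R -> R, (forall t, continuous g t) -> exists M, forall t, a <= t <= b -> Rabs (g t) <= M).
{ intros g Hg. destruct (continuity_ab_maj (fun t => Rabs (g t)) a b Hab) as [m [Hm _]].
  - intros t _. apply (continuity_pt_comp g Rabs); [|apply Rcontinuity_abs].
    apply continuity_pt_filterlim, Hg.
  - exists (Rabs (g m)). exact Hm. }
destruct (H _ (fun t => proj1 (Hf t))) as [M1 H1].
destruct (H _ (fun t => proj2 (Hf t))) as [M2 H2].
exists (M1 + M2). split.
- pose proof (H1 a ltac:(lra)). pose proof (H2 a ltac:(lra)).
  pose proof (Rabs_pos (Re (f a))). pose proof (Rabs_pos (Im (f a))). lra.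
- intros t Ht. eapply Rle_trans; [apply Cmod_le_Re_Im|]. apply Rplus_le_compat; auto.
Qed.

(** Differentiation under the integral sign. A remainder of second order that is uniform in [t]
    replaces any convergence theorem, and it is explicit for the rational kernels below. *)
Lemma has_cderiv_Cmean (phi : R -> C) (k0 : C -> R -> C) (k1 : R -> C) (z : C) (K d : R) :
  0 < d -> (forall t, ccont phi t) -> (forall t, ccont k1 t) ->
  (forall w t, Cmod (w - z) < d -> ccont (k0 w) t) ->
  (forall w t, Cmod (w - z) < d ->
     Cmod (k0 w t - k0 z t - k1 t * (w - z)) <= K * (Cmod (w - z) * Cmod (w - z))) ->
  has_cderiv (fun w => Cmean (fun t => phi t * k0 w t)%C) z (Cmean (fun t => phi t * k1 t)%C).
Proof.
intros Hd Cphi Ck1 Ck0 Hk. pose proof two_PI_pos as HP.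
destruct (ccont_bounded phi 0 (2 * PI) ltac:(lra) Cphi) as [M [HM0 HM]].
apply has_cderiv_eps. intros eps He.
set (B := 2 * (M * (Rabs K + 1)) + 1).
assert (HB : 0 < B).
{ unfold B. pose proof (Rabs_pos K). assert (0 <= M * (Rabs K + 1)) by (apply Rmult_le_pos; lra). lra. }
exists (Rmin d (eps / B)). split; [apply Rmin_pos; [exact Hd|now apply Rdiv_lt_0_compat]|].
intros w Hw.
destruct (lt_Rmin _ _ _ Hw) as [H1 H2].
assert (H0 : Cmod (z - z) < d) by (replace (z - z)%C with (RtoC 0) by ring; now rewrite Cmod_0).
rewrite <- Cmean_minus, (Cmult_comm (Cmean _)), <- Cmean_scal, <- Cmean_minus
  by (intros t; repeat ccont_step; auto).
eapply Rle_trans; [apply (Cmean_bound _ (M * (Rabs K * (Cmod (w - z) * Cmod (w - z)))))|].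
- intros t. repeat ccont_step; auto.
- intros t Ht.
  replace (phi t * k0 w t - phi t * k0 z t - (w - z) * (phi t * k1 t))%C
    with (phi t * (k0 w t - k0 z t - k1 t * (w - z)))%C by ring.
  rewrite Cmod_mult. apply Rmult_le_compat; auto using Cmod_ge_0.
  eapply Rle_trans; [apply Hk, H1|]. apply Rmult_le_compat_r; [|apply Rle_abs].
  apply Rmult_le_pos; apply Cmod_ge_0.
- replace (2 * (M * (Rabs K * (Cmod (w - z) * Cmod (w - z)))))
    with (2 * (M * Rabs K) * Cmod (w - z) * Cmod (w - z)) by ring.
  apply Rmult_le_compat_r; [apply Cmod_ge_0|].
  apply Rle_trans with (B * Cmod (w - z)).
  + apply Rmult_le_compat_r; [apply Cmod_ge_0|]. unfold B. lra.
  + apply Rmult_lt_compat_l with (r := B) in H2; [|exact HB].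
    replace (B * (eps / B)) with eps in H2 by (field; lra). lra.
Qed.

Lemma ccont_inv_circ_sub (rho : R) (w : C) (t : R) :
  Cmod w < rho -> ccont (fun r => / (circ rho r - w))%C t.
Proof. intros H. apply ccont_inv; [apply ccont_circ_sub|now apply circ_sub_neq0]. Qed.

Lemma Cmod_inv_circ_sub (rho t m : R) (z : C) :
  0 <= rho -> 0 < m -> m <= rho - Cmod z -> Cmod (/ (circ rho t - z)) <= / m.
Proof.
intros Hr Hm Hz. rewrite Cmod_inv by (apply circ_sub_neq0; lra).
apply Rinv_le_contravar; [exact Hm|]. pose proof (circ_sub_ge rho t z Hr). lra.
Qed.

Lemma disc_margin (rho : R) (z : C) : Cmod z < rho ->
  exists m, 0 < m /\ m <= rho - Cmod z /\ forall w, Cmod (w - z) < m -> m <= rho - Cmod w.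
Proof.
intros Hz. exists ((rho - Cmod z) / 2). split; [lra|]. split; [lra|].
intros w H. pose proof (Cmod_minus_ge w z). lra.
Qed.

Lemma has_cderiv_cauchy1 (rho : R) (phi : R -> C) (z : C) :
  (forall t, ccont phi t) -> Cmod z < rho ->
  has_cderiv (fun w => Cmean (fun t => phi t * / (circ rho t - w))%C) z
    (Cmean (fun t => phi t * (/ (circ rho t - z) * / (circ rho t - z)))%C).
Proof.
intros Hphi Hz. pose proof (Cmod_ge_0 z) as Hz0. destruct (disc_margin rho z Hz) as (m & Hm & Hmz & Hw).
pose proof (ccont_inv_circ_sub rho) as Hci.
apply (has_cderiv_Cmean phi (fun w t => / (circ rho t - w))%C _ z (/ m * / m * / m) m Hm Hphi).
- intros t. apply ccont_mult; now apply Hci.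
- intros w t H. apply Hci. specialize (Hw w H). lra.
- intros w t H. specialize (Hw w H).
  replace (/ (circ rho t - w) - / (circ rho t - z) - / (circ rho t - z) * / (circ rho t - z) * (w - z))%C
    with (/ (circ rho t - z) * / (circ rho t - z) * / (circ rho t - w) * ((w - z) * (w - z)))%C.
  2:{ field. split; apply circ_sub_neq0; lra. }
  rewrite !Cmod_mult. apply Rmult_le_compat_r; [apply Rmult_le_pos; apply Cmod_ge_0|].
  repeat apply Rmult_le_compat; try (repeat apply Rmult_le_pos; apply Cmod_ge_0);
    apply Cmod_inv_circ_sub; auto; lra.
Qed.

Lemma has_cderiv_cauchy2 (rho : R) (phi : R -> C) (z : C) :
  (forall t, ccont phi t) -> Cmod z < rho ->
  exists l, has_cderiv (fun w => Cmean (fun t => phi t * (/ (circ rho t - w) * / (circ rho t - w)))%C) z l.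
Proof.
intros Hphi Hz. pose proof (Cmod_ge_0 z) as Hz0. destruct (disc_margin rho z Hz) as (m & Hm & Hmz & Hw).
pose proof (ccont_inv_circ_sub rho) as Hci.
eexists.
apply (has_cderiv_Cmean phi (fun w t => / (circ rho t - w) * / (circ rho t - w))%C
  (fun t => 2 * (/ (circ rho t - z) * / (circ rho t - z) * / (circ rho t - z)))%C
  z (3 * (/ m * / m * / m * / m)) m Hm Hphi).
- intros t. repeat ccont_step; now apply Hci.
- intros w t H. specialize (Hw w H). apply ccont_mult; apply Hci; lra.
- intros w t H. specialize (Hw w H).
  set (u := (/ (circ rho t - z))%C). set (v := (/ (circ rho t - w))%C).
  (* All remainders of this kind come from [v - u = u * v * (w - z)]. *)
  replace (v * v - u * u - 2 * (u * u * u) * (w - z))%C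
    with ((u * u * v * v + 2 * (u * u * u * v)) * ((w - z) * (w - z)))%C.
  2:{ unfold u, v. field. split; apply circ_sub_neq0; lra. }
  assert (Hu : Cmod u <= / m) by (apply Cmod_inv_circ_sub; auto; lra).
  assert (Hv : Cmod v <= / m) by (apply Cmod_inv_circ_sub; auto; lra).
  rewrite !Cmod_mult. apply Rmult_le_compat_r; [apply Rmult_le_pos; apply Cmod_ge_0|].
  eapply Rle_trans; [apply Cmod_triangle|]. rewrite !Cmod_mult, Cmod_R, Rabs_pos_eq by lra.
  assert (A1 : Cmod u * Cmod u * Cmod v * Cmod v <= / m * / m * / m * / m).
  { repeat apply Rmult_le_compat; try (repeat apply Rmult_le_pos; apply Cmod_ge_0); assumption. }
  assert (A2 : Cmod u * Cmod u * Cmod u * Cmod v <= / m * / m * / m * / m).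
  { repeat apply Rmult_le_compat; try (repeat apply Rmult_le_pos; apply Cmod_ge_0); assumption. }
  lra.
Qed.

Section Disc.
Variables (R0 : R) (f f' : C -> C).
Hypothesis Hf : holo_disc R0 f f'.

Lemma holo_ccont (g : R -> C) (t : R) :
  Cmod (g t) < R0 -> ccont g t -> ccont (fun r => f (g r)) t.
Proof. intros H. apply (ccont_comp f g t (f' (g t))), Hf, H. Qed.

Let bdry (rho : R) (t : R) : C := (f (circ rho t) * circ rho t)%C.

Let ccont_bdry (rho : R) : 0 <= rho < R0 -> forall t, ccont (bdry rho) t.
Proof.
intros H t. apply ccont_mult; [|apply ccont_circ].
apply holo_ccont; [rewrite Cmod_circ; lra|apply ccont_circ].
Qed.

Lemma cauchy_kernel1 (rho : R) (z : C) :
  rho < R0 -> Cmod z < rho -> Cmean (fun t => bdry rho t * / (circ rho t - z))%C = f z.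
Proof.
intros Hr Hz. rewrite <- (cauchy_formula R0 rho f f' z Hr Hz Hf). apply Cmean_ext.
intros t. unfold bdry, Cdiv. ring.
Qed.

Lemma cauchy_kernel2 (rho : R) (z : C) :
  rho < R0 -> Cmod z < rho ->
  Cmean (fun t => bdry rho t * (/ (circ rho t - z) * / (circ rho t - z)))%C = f' z.
Proof.
intros Hr Hz. pose proof (Cmod_ge_0 z).
apply (has_cderiv_unique f z).
- apply (has_cderiv_ext_loc (fun w => Cmean (fun t => bdry rho t * / (circ rho t - w))%C) _ _ _ (rho - Cmod z)).
  + lra.
  + intros w Hw. apply cauchy_kernel1; [exact Hr|]. pose proof (Cmod_minus_ge w z). lra.
  + apply has_cderiv_cauchy1; [|exact Hz]. apply ccont_bdry. lra.
- apply Hf. lra.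
Qed.

Lemma between (x : R) : 0 <= x < R0 -> exists rho, x < rho < R0.
Proof. intros H. exists ((x + R0) / 2). lra. Qed.

(** By Cauchy's formula [f'] is a mean with the squared kernel, which is differentiable in turn. The
    circle has to enclose [z] and so depends on it; the values of [f''] are therefore picked point
    by point with a choice principle. *)
Lemma holo_derivative : exists f'', holo_disc R0 f' f''.
Proof.
assert (H : forall z, exists l, Cmod z < R0 -> has_cderiv f' z l).
{ intros z. destruct (Rlt_le_dec (Cmod z) R0) as [Hz|Hz]; [|exists 0; lra].
  pose proof (Cmod_ge_0 z) as Hz0.
  destruct (between (Cmod z) (conj Hz0 Hz)) as [rho Hr].
  destruct (has_cderiv_cauchy2 rho (bdry rho) z) as [l Hl]; [apply ccont_bdry; lra|lra|].
  exists l. intros _. revert Hl. apply (has_cderiv_ext_loc _ _ _ _ (rho - Cmod z)); [lra|].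
  intros w Hw. apply cauchy_kernel2; [lra|]. pose proof (Cmod_minus_ge w z). lra. }
exists (fun z => proj1_sig (constructive_indefinite_description _ (H z))).
intros z Hz. exact (proj2_sig (constructive_indefinite_description _ (H z)) Hz).
Qed.

Definition divq (z w : C) : C :=
  if Ceq_dec z w then f' z else ((f z - f w) / (z - w))%C.

Lemma divq_neq (z w : C) : z <> w -> divq z w = ((f z - f w) / (z - w))%C.
Proof. intros H. unfold divq. now destruct (Ceq_dec z w). Qed.

Lemma divq_diag (z : C) : divq z z = f' z.
Proof. unfold divq. now destruct (Ceq_dec z z). Qed.

Lemma divq_mult (z w : C) : (divq z w * (z - w))%C = (f z - f w)%C.
Proof.
destruct (Ceq_dec z w) as [->|H].
- ring.
- rewrite divq_neq by exact H. field. now apply Csub_neq0.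
Qed.

Lemma divq_sym (z w : C) : divq z w = divq w z.
Proof.
destruct (Ceq_dec z w) as [->|H]; [reflexivity|].
rewrite !divq_neq by auto. field. split; apply Csub_neq0; auto.
Qed.

(** Partial fractions off the diagonal, the formula for [f'] on it. The left side does not
    distinguish the two cases, which makes the regularity of [divq] across the diagonal visible. *)
Lemma divq_cauchy (rho : R) (z w : C) :
  rho < R0 -> Cmod z < rho -> Cmod w < rho ->
  Cmean (fun t => bdry rho t * / (circ rho t - w) * / (circ rho t - z))%C = divq z w.
Proof.
intros Hr Hz Hw. pose proof (Cmod_ge_0 z).
assert (Hci : forall u t, Cmod u < rho -> ccont (fun r => bdry rho r * / (circ rho r - u))%C t).
{ intros u t H'. apply ccont_mult; [apply ccont_bdry; lra|].
  now apply ccont_inv_circ_sub. }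
destruct (Ceq_dec z w) as [->|H'].
- rewrite divq_diag, <- (cauchy_kernel2 rho w Hr Hw). apply Cmean_ext. intros t. ring.
- rewrite divq_neq by exact H'.
  pose proof (Csub_neq0 z w H') as H1.
  rewrite <- (cauchy_kernel1 rho z Hr Hz), <- (cauchy_kernel1 rho w Hr Hw), <- Cmean_minus by auto.
  unfold Cdiv. rewrite Cmult_comm, <- Cmean_scal by (intros t; apply ccont_minus; auto).
  apply Cmean_ext. intros t. field. repeat split; auto; apply circ_sub_neq0; lra.
Qed.

Lemma divq_holo (w : C) : Cmod w < R0 -> exists q', holo_disc R0 (fun z => divq z w) q'.
Proof.
intros Hw. pose proof (Cmod_ge_0 w) as Hw0.
assert (H : forall z, exists l, Cmod z < R0 -> has_cderiv (fun z => divq z w) z l).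
{ intros z. destruct (Rlt_le_dec (Cmod z) R0) as [Hz|Hz]; [|exists 0; lra].
  pose proof (Cmod_ge_0 z) as Hz0.
  destruct (between (Rmax (Cmod z) (Cmod w))) as [rho Hr].
  { split; [|now apply Rmax_lub_lt]. eapply Rle_trans; [exact Hz0|apply Rmax_l]. }
  pose proof (Rmax_l (Cmod z) (Cmod w)). pose proof (Rmax_r (Cmod z) (Cmod w)).
  eexists. intros _.
  apply (has_cderiv_ext_loc (fun z => Cmean (fun t => bdry rho t * / (circ rho t - w) * / (circ rho t - z))%C)
           _ _ _ (rho - Cmod z)); [lra| |].
  - intros u Hu. apply divq_cauchy; try lra. pose proof (Cmod_minus_ge u z). lra.
  - apply has_cderiv_cauchy1; [|lra]. intros t. apply ccont_mult; [apply ccont_bdry; lra|].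
    apply ccont_inv_circ_sub. lra. }
exists (fun z => proj1_sig (constructive_indefinite_description _ (H z))).
intros z Hz. exact (proj2_sig (constructive_indefinite_description _ (H z)) Hz).
Qed.

(** Joint continuity up to the diagonal. A difference in one variable produces a third kernel, so
    each variable contributes the bound of [bdry], three factors [/ m], and the 2 of
    [Cmean_bound]. *)
Lemma divq_Lipschitz (r : R) : 0 <= r < R0 -> exists L, 0 <= L /\
  forall z z' w w', Cmod z <= r -> Cmod z' <= r -> Cmod w <= r -> Cmod w' <= r ->
  Cmod (divq z w - divq z' w') <= L * (Cmod (z - z') + Cmod (w - w')).
Proof.
intros Hr. destruct (between r Hr) as [rho Hrho]. pose proof two_PI_pos as HP.
destruct (ccont_bounded (bdry rho) 0 (2 * PI)) as [M [HM0 HM]]; [lra|apply ccont_bdry; lra|].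
set (m := rho - r). assert (Hm : 0 < m) by (unfold m; lra).
exists (2 * (M * / m * / m * / m)).
assert (Hi : 0 < / m) by now apply Rinv_0_lt_compat.
split; [repeat apply Rmult_le_pos; lra|].
assert (One : forall z z' w, Cmod z <= r -> Cmod z' <= r -> Cmod w <= r ->
  Cmod (divq z w - divq z' w) <= 2 * (M * / m * / m * / m) * Cmod (z - z')).
{ intros z z' w Hz Hz' Hw.
  assert (Hci : forall u t, Cmod u <= r -> ccont (fun r => / (circ rho r - u))%C t).
  { intros u t H'. apply ccont_inv_circ_sub. lra. }
  assert (Cb : forall t, ccont (bdry rho) t) by (apply ccont_bdry; lra).
  rewrite <- (divq_cauchy rho z w), <- (divq_cauchy rho z' w), <- Cmean_minus by
    (try lra; intros t; apply ccont_mult; auto; apply ccont_mult; auto).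
  rewrite (Cmean_ext _ (fun t => (z - z') * (bdry rho t * / (circ rho t - w) * / (circ rho t - z) * / (circ rho t - z')))%C).
  2:{ intros t. field. repeat split; apply circ_sub_neq0; lra. }
  rewrite Cmean_scal by (intros t; repeat ccont_step; auto).
  rewrite Cmod_mult, Rmult_comm. apply Rmult_le_compat_r; [apply Cmod_ge_0|].
  apply Cmean_bound; [intros t; repeat ccont_step; auto|].
  intros t Ht. rewrite !Cmod_mult.
  repeat apply Rmult_le_compat; try (repeat apply Rmult_le_pos; apply Cmod_ge_0);
    try (apply Cmod_inv_circ_sub; unfold m in *; lra). now apply HM. }
intros z z' w w' Hz Hz' Hw Hw'.
replace (divq z w - divq z' w')%C with ((divq z w - divq z' w) + (divq w z' - divq w' z'))%C
  by (rewrite (divq_sym w z'), (divq_sym w' z'); ring).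
eapply Rle_trans; [apply Cmod_triangle|]. rewrite Rmult_plus_distr_l.
apply Rplus_le_compat; auto.
Qed.
End Disc.

(** * Primitives and logarithms *)

Lemma Cmod_segment (z w : C) (s r : R) :
  0 <= s <= 1 -> Cmod z < r -> Cmod w < r -> Cmod (z + RtoC s * (w - z)) < r.
Proof.
intros Hs Hz Hw. replace (z + RtoC s * (w - z))%C with (RtoC (1 - s) * z + RtoC s * w)%C
  by (rewrite RtoC_minus; ring).
eapply Rle_lt_trans; [apply Cmod_triangle|].
rewrite !Cmod_mult, !Cmod_R, !Rabs_pos_eq by lra.
pose proof (Rmax_l (Cmod z) (Cmod w)) as H1. pose proof (Rmax_r (Cmod z) (Cmod w)) as H2.
apply Rle_lt_trans with (Rmax (Cmod z) (Cmod w)); [|now apply Rmax_lub_lt].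
apply Rmult_le_compat_l with (r := 1 - s) in H1; [|lra].
apply Rmult_le_compat_l with (r := s) in H2; lra.
Qed.

(** [P] integrates [F] along the ray from 0. The triangle [0, z, w] is the cone with apex 0 over the
    segment from [z] to [w]; its side at [s = 0] degenerates, and the other three give [P w - P z]
    as an integral over the segment. *)
Lemma holo_primitive (R0 : R) (F F' : C -> C) :
  holo_disc R0 F F' -> exists P, holo_disc R0 P F /\ P 0 = 0.
Proof.
intros HF. set (P := fun z => CInt (fun s => F (RtoC s * z) * z)%C 0 1).
assert (HR : forall z, Cmod z < R0 -> Cmod 0 < R0).
{ intros z Hz. rewrite Cmod_0. pose proof (Cmod_ge_0 z). lra. }
assert (Cseg : forall z w t, 0 <= t <= 1 -> Cmod z < R0 -> Cmod w < R0 ->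
  ccont (fun r => F (z + RtoC r * (w - z))%C) t).
{ intros z w t Ht Hz Hw. apply (ccont_comp F _ t (F' (z + RtoC t * (w - z))%C)).
  - apply HF. now apply Cmod_segment.
  - exact (cder_ccont _ _ _ (cder_line z (w - z) t)). }
assert (Hdiff : forall z w, Cmod z < R0 -> Cmod w < R0 ->
  (P w - P z)%C = CInt (fun t => F (z + RtoC t * (w - z)) * (w - z))%C 0 1).
{ intros z w Hz Hw.
  set (c := fun t : R => (z + RtoC t * (w - z))%C).
  pose proof (cone_goursat F F' 0 c (fun _ => (w - z)%C) 0 1 0 1
    (Cmod z + Cmod w)) as G.
  rewrite (CInt_ext (fun s => F (cone 0 c s 0) * (c 0 - 0))%C (fun s => F (RtoC s * z) * z)%C 0 1) in G.
  2:{ lra. }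
  2:{ intros s _. unfold cone. replace (c 0) with z by (unfold c; ring).
      f_equal; [f_equal|]; ring. }
  rewrite (CInt_ext (fun s => F (cone 0 c s 1) * (c 1 - 0))%C (fun s => F (RtoC s * w) * w)%C 0 1) in G.
  2:{ lra. }
  2:{ intros s _. unfold cone. replace (c 1) with w by (unfold c; ring).
      f_equal; [f_equal|]; ring. }
  rewrite (CInt_ext (fun t => F (cone 0 c 1 t) * (1 * (w - z)))%C (fun t => F (c t) * (w - z))%C 0 1) in G.
  2:{ lra. }
  2:{ intros s _. unfold cone. f_equal; [f_equal|]; ring. }
  rewrite (CInt_ext (fun t => F (cone 0 c 0 t) * (0 * (w - z)))%C (fun t => 0 * 0)%C 0 1) in G.
  2:{ lra. }
  2:{ intros s _. ring. }
  rewrite (CInt_scal 0 (fun _ => 0)) in G; [|lra|intros; apply ccont_const].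
  fold (P z) (P w) in G. unfold c in G.
  match type of G with _ -> _ -> _ -> _ -> _ -> _ -> _ -> _ -> (_ + ?A - _ - _)%C = _ => set (X := A) in * end.
  assert (E : (P z + X - P w - 0 * CInt (fun _ => 0) 0 1)%C = 0).
  { apply G; try lra.
    - intros t _. apply cder_line.
    - intros t _. apply ccont_const.
    - intros t Ht. replace (z + RtoC t * (w - z) - 0)%C with (RtoC (1 - t) * z + RtoC t * w)%C
        by (rewrite RtoC_minus; ring).
      eapply Rle_trans; [apply Cmod_triangle|].
      rewrite !Cmod_mult, !Cmod_R, !Rabs_pos_eq by lra.
      pose proof (Cmod_ge_0 z). pose proof (Cmod_ge_0 w). nra.
    - intros t _. pose proof (Cmod_triangle w (- z)). rewrite Cmod_opp in *.
      unfold Cminus. lra.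
    - intros s t Hs Ht. apply HF. unfold cone. apply Cmod_segment; [exact Hs|now apply (HR z)|].
      now apply Cmod_segment. }
  replace X with (P w - P z + (P z + X - P w - 0 * CInt (fun _ => 0) 0 1))%C by ring.
  rewrite E. ring. }
exists P. split.
- intros z Hz. apply has_cderiv_eps. intros eps He.
  destruct (has_cderiv_continuous F z (F' z) (HF z Hz) (eps / 2)) as [d [Hd HFz]]; [lra|].
  exists (Rmin d (R0 - Cmod z)). split; [apply Rmin_pos; lra|]. intros w Hw.
  destruct (lt_Rmin _ _ _ Hw) as [H1 H2].
  assert (Hw' : Cmod w < R0) by (pose proof (Cmod_minus_ge w z); lra).
  rewrite Hdiff by assumption.
  replace (F z * (w - z))%C with (CInt (fun _ => F z * (w - z))%C 0 1).
  2:{ rewrite (CInt_cder (fun t => 0 + RtoC t * (F z * (w - z)))%C); [ring|lra| |].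
      - intros t _. apply cder_line.
      - intros t _. apply ccont_const. }
  rewrite <- CInt_minus; [|lra| |].
  + eapply Rle_trans; [apply (CInt_bound _ 0 1 (eps / 2 * Cmod (w - z)))|].
    * lra.
    * intros t Ht. apply ccont_minus; [|apply ccont_const].
      apply ccont_mult; [now apply Cseg|apply ccont_const].
    * intros t Ht. replace (F (z + RtoC t * (w - z)) * (w - z) - F z * (w - z))%C
        with ((F (z + RtoC t * (w - z)) - F z) * (w - z))%C by ring.
      rewrite Cmod_mult. apply Rmult_le_compat_r; [apply Cmod_ge_0|]. apply Rlt_le, HFz.
      replace (z + RtoC t * (w - z) - z)%C with (RtoC t * (w - z))%C by ring.
      rewrite Cmod_mult, Cmod_R, Rabs_pos_eq by lra.
      pose proof (Cmod_ge_0 (w - z)). nra.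
    * apply Req_le. field.
  + intros t Ht. apply ccont_mult; [now apply Cseg|apply ccont_const].
  + intros t Ht. apply ccont_const.
- unfold P. rewrite (CInt_ext _ (fun _ => 0 * 0)%C); [|lra|intros; ring].
  rewrite (CInt_scal 0 (fun _ => 0)); [ring|lra|intros; apply ccont_const].
Qed.

(** * The complex exponential and holomorphic logarithms *)

Definition cexp (z : C) : C := (RtoC (exp (Re z)) * cis (Im z))%C.

Lemma cis_plus (s t : R) : cis (s + t) = (cis s * cis t)%C.
Proof. unfold cis. rewrite cos_plus, sin_plus. apply injective_projections; simpl; ring. Qed.

Lemma cexp_plus (z w : C) : cexp (z + w) = (cexp z * cexp w)%C.
Proof.
unfold cexp, Re, Im. simpl. rewrite exp_plus, cis_plus, RtoC_mult. ring.
Qed.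

Lemma Cmod_cexp (z : C) : Cmod (cexp z) = exp (Re z).
Proof.
unfold cexp. rewrite Cmod_mult, Cmod_cis, Cmod_R, Rabs_pos_eq, Rmult_1_r; [reflexivity|].
apply Rlt_le, exp_pos.
Qed.

Lemma cexp_0 : cexp 0 = 1.
Proof.
unfold cexp, cis; simpl. rewrite exp_0, cos_0, sin_0. apply injective_projections; simpl; ring.
Qed.

Lemma cexp_neq0 (z : C) : cexp z <> 0.
Proof. apply Cmod_gt_0. rewrite Cmod_cexp. apply exp_pos. Qed.

(** The derivative at 0 comes from those of [exp] and [cis]; the functional equation carries it to
    every point. *)
Lemma has_cderiv_cexp (z : C) : has_cderiv cexp z (cexp z).
Proof.
assert (H0 : has_cderiv cexp 0 1).
{ apply has_cderiv_eps. intros eps He.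
  destruct (proj1 (cder_eps cis 0 _) (cder_cis 0) (eps / 4)) as [d1 [Hd1 H1]]; [lra|].
  destruct (derivable_pt_lim_exp 0 (eps / 4)) as [d2 H2]; [lra|]. rewrite exp_0 in H2.
  destruct (proj1 (continuous_eps exp 0)) with (eps := Rmin 1 (eps / 4)) as [d3 [Hd3 H3]].
  { apply continuity_pt_filterlim, derivable_continuous_pt, derivable_pt_exp. }
  { apply Rmin_pos; lra. }
  exists (Rmin (Rmin d1 d2) d3).
  assert (Hd2 := cond_pos d2). split; [repeat apply Rmin_pos; assumption|].
  intros w Hw. replace (w - 0)%C with w in * by ring.
  assert (W3 : Cmod w < d3) by (eapply Rlt_le_trans; [exact Hw|apply Rmin_r]).
  assert (W1 : Cmod w < d1).
  { eapply Rlt_le_trans; [exact Hw|]. eapply Rle_trans; [apply Rmin_l|apply Rmin_l]. }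
  assert (W2 : Cmod w < d2).
  { eapply Rlt_le_trans; [exact Hw|]. eapply Rle_trans; [apply Rmin_l|apply Rmin_r]. }
  pose proof (re_le_Cmod w) as Rw. pose proof (im_le_Cmod w) as Iw.
  set (x := Re w) in *. set (y := Im w) in *.
  rewrite cexp_0. unfold cexp. fold x y.
  replace w with (RtoC x + Ci * RtoC y)%C at 1 by (apply injective_projections; simpl; unfold x, y, Re, Im; ring).
  assert (B1 : Cmod (cis y - 1 - Ci * RtoC y) <= eps / 4 * Cmod w).
  { specialize (H1 y). rewrite Rminus_0_r in H1. specialize (H1 ltac:(lra)).
    replace (cis 0) with (RtoC 1) in H1.
    2:{ unfold cis. now rewrite cos_0, sin_0. }
    replace (Ci * 1)%C with Ci in H1 by ring.
    eapply Rle_trans; [exact H1|]. apply Rmult_le_compat_l; lra. }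
  assert (B2 : Rabs (exp x - 1 - x) <= eps / 4 * Cmod w).
  { destruct (Req_dec x 0) as [->|Hx].
    - rewrite exp_0. replace (1 - 1 - 0) with 0 by ring. rewrite Rabs_R0.
      apply Rmult_le_pos; [lra|apply Cmod_ge_0].
    - specialize (H2 x Hx ltac:(lra)). rewrite Rplus_0_l in H2.
      replace (exp x - 1 - x) with (((exp x - 1) / x - 1) * x) by (field; exact Hx).
      rewrite Rabs_mult. apply Rmult_le_compat; try apply Rabs_pos; lra. }
  assert (B3 : Rabs (exp x - 1) < Rmin 1 (eps / 4)).
  { specialize (H3 x). rewrite Rminus_0_r, exp_0 in H3. apply H3. lra. }
  pose proof (Rmin_l 1 (eps / 4)) as M1. pose proof (Rmin_r 1 (eps / 4)) as M2.
  assert (B4 : exp x <= 2) by (apply Rabs_def2 in B3; lra).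
  pose proof (exp_pos x) as B5.
  (* The three terms contribute at most [2 * (eps / 4)], [eps / 4] and [eps / 4] times [|w|]. *)
  replace (RtoC (exp x) * cis y - 1 - 1 * (RtoC x + Ci * RtoC y))%C with
    (RtoC (exp x) * (cis y - 1 - Ci * RtoC y) + (RtoC (exp x - 1 - x) + Ci * RtoC y * RtoC (exp x - 1)))%C
    by (rewrite !RtoC_minus; ring).
  eapply Rle_trans; [apply Cmod_triangle|].
  eapply Rle_trans; [apply Rplus_le_compat_l, Cmod_triangle|].
  rewrite !Cmod_mult, !Cmod_R, Cmod_Ci, (Rabs_pos_eq (exp x)) by lra.
  pose proof (Cmod_ge_0 w) as W0.
  assert (C1 : exp x * Cmod (cis y - 1 - Ci * RtoC y) <= 2 * (eps / 4 * Cmod w))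
    by (apply Rmult_le_compat; auto using Cmod_ge_0; lra).
  assert (C2 : 1 * Rabs y * Rabs (exp x - 1) <= Cmod w * (eps / 4))
    by (apply Rmult_le_compat; try apply Rabs_pos; pose proof (Rabs_pos y); lra).
  lra. }
apply (has_cderiv_ext (fun w => cexp z * cexp (w - z))%C).
{ intros w. rewrite <- cexp_plus. f_equal. ring. }
eapply has_cderiv_eq.
- apply has_cderiv_scal, (has_cderiv_comp cexp (fun w => w - z)%C z 1).
  + replace (z - z)%C with (RtoC 0) by ring. exact H0.
  + apply has_cderiv_minus; [apply has_cderiv_id|apply has_cderiv_const].
- ring.
Qed.

Lemma holo_constant (R0 : R) (f : C -> C) :
  holo_disc R0 f (fun _ => 0) -> forall z, Cmod z < R0 -> f z = f 0.
Proof.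
intros Hf z Hz.
assert (H0 : Cmod 0 < R0) by (rewrite Cmod_0; pose proof (Cmod_ge_0 z); lra).
pose proof (cder_bound (fun t => f (0 + RtoC t * (z - 0))%C) (fun _ => 0) 0 1 0) as B.
assert (E : Cmod (f z - f 0) <= 0).
{ replace z with (0 + RtoC 1 * (z - 0))%C at 1 by ring.
  replace (f 0) with (f (0 + RtoC 0 * (z - 0))%C) by (f_equal; ring).
  eapply Rle_trans; [apply B; try lra|].
  - intros t Ht. eapply cder_eq.
    + apply (cder_comp f); [|apply cder_line]. apply Hf. now apply Cmod_segment.
    + ring.
  - intros t _. rewrite Cmod_0. lra.
  - apply Req_le. ring. }
assert (E' : (f z - f 0)%C = 0) by (apply Cmod_eq_0, Rle_antisym; [exact E|apply Cmod_ge_0]).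
replace (f z) with (f z - f 0 + f 0)%C by ring. rewrite E'. ring.
Qed.

(** [L] is the primitive of [q' / q] that vanishes at 0, and [q * exp (- L)] has derivative zero.
    Keeping [q 0] as a factor avoids choosing a logarithm of it. *)
Lemma holo_log (R0 : R) (q q' : C -> C) :
  0 < R0 -> holo_disc R0 q q' -> (forall z, Cmod z < R0 -> q z <> 0) ->
  exists L L', holo_disc R0 L L' /\ forall z, Cmod z < R0 -> q z = (q 0 * cexp (L z))%C.
Proof.
intros HR Hq Hn. destruct (holo_derivative R0 q q' Hq) as [q'' Hq'].
destruct (holo_primitive R0 (fun z => q' z / q z)%C
  (fun z => (q'' z * q z - q' z * q' z) / (q z * q z))%C) as [L [HL HL0]].
{ intros z Hz. apply has_cderiv_div; auto. }
exists L, (fun z => q' z / q z)%C. split; [exact HL|].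
intros z Hz.
assert (E : (q z * cexp (- L z))%C = (q 0 * cexp (- L 0))%C).
{ apply (holo_constant R0 (fun z => q z * cexp (- L z))%C); [|exact Hz].
  intros w Hw. eapply has_cderiv_eq.
  - apply has_cderiv_mult; [now apply Hq|].
    apply (has_cderiv_comp cexp (fun w => - L w)%C); [apply has_cderiv_cexp|].
    apply has_cderiv_opp, HL, Hw.
  - cbv beta. field. now apply Hn. }
rewrite HL0 in E. replace (- 0)%C with (RtoC 0) in E by ring. rewrite cexp_0, Cmult_1_r in E.
rewrite <- E, <- Cmult_assoc, <- cexp_plus. replace (- L z + L z)%C with (RtoC 0) by ring.
rewrite cexp_0. ring.
Qed.

(** * Schwarz's lemma of higher order *)

Lemma eq0_of_small_nearby (f : C -> C) (l : C) (K d : R) :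
  has_cderiv f 0 l -> 0 < d -> (forall z : C, z <> 0 -> Cmod z < d -> Cmod (f z) <= K * Cmod z) -> f 0 = 0.
Proof.
intros Hf Hd HK. apply Cmod_eq_0, Rle_antisym; [|apply Cmod_ge_0].
apply le_epsilon. intros eps He.
destruct (has_cderiv_continuous f 0 l Hf (eps / 2) ltac:(lra)) as [d1 [Hd1 H1]].
set (k := Rabs K + 1). assert (Hk : 0 < k) by (unfold k; pose proof (Rabs_pos K); lra).
set (h := Rmin (Rmin d1 d / 2) (eps / 2 / k)).
assert (Hm : 0 < Rmin d1 d) by now apply Rmin_pos.
assert (Hh : 0 < h).
{ apply Rmin_pos; [lra|]. apply Rdiv_lt_0_compat; lra. }
assert (h1 : h <= Rmin d1 d / 2) by apply Rmin_l.
assert (h2 : h * k <= eps / 2).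
{ apply Rmin_div_mult. lra. }
pose proof (Rmin_l d1 d). pose proof (Rmin_r d1 d).
assert (Eh : Cmod (RtoC h) = h) by (rewrite Cmod_R; apply Rabs_pos_eq; lra).
specialize (H1 (RtoC h)). replace (RtoC h - 0)%C with (RtoC h) in H1 by ring. rewrite Eh in H1.
specialize (H1 ltac:(lra)).
specialize (HK (RtoC h)). rewrite Eh in HK.
specialize (HK ltac:(intros E; apply RtoC_inj in E; lra) ltac:(lra)).
pose proof (Cmod_minus_ge (f 0) (f (RtoC h))) as T. rewrite Cmod_sub_sym in T.
assert (K * h <= h * k).
{ rewrite Rmult_comm. apply Rmult_le_compat_l; [lra|]. unfold k. pose proof (Rle_abs K). lra. }
lra.
Qed.

(** Each factor [z] is split off by the difference quotient at 0, which is holomorphic there. The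
    bound is assumed only for [z <> 0], since this is what survives a division by [z]. *)
Lemma holo_factor_zero (n : nat) : forall (R0 : R) (f f' : C -> C) (K d : R),
  0 < R0 -> holo_disc R0 f f' -> 0 < d ->
  (forall z : C, z <> 0 -> Cmod z < d -> Cmod (f z) <= K * Cmod z ^ n) ->
  exists F F', holo_disc R0 F F' /\ forall z, f z = (z ^ n * F z)%C.
Proof.
induction n as [|n IH]; intros R0 f f' K d HR Hf Hd HK.
{ exists f, f'. split; [exact Hf|]. intros z. simpl. ring. }
assert (H00 : Cmod 0 < R0) by (rewrite Cmod_0; exact HR).
assert (E0 : f 0 = 0).
{ apply (eq0_of_small_nearby f (f' 0) (Rabs K) (Rmin d 1)); [now apply Hf|apply Rmin_pos; lra|].
  intros z Hz Hzd. pose proof (Rmin_l d 1). pose proof (Rmin_r d 1).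
  eapply Rle_trans; [apply HK; [exact Hz|lra]|]. simpl.
  pose proof (Cmod_ge_0 z).
  assert (P : Cmod z ^ n <= 1) by (rewrite <- (pow1 n); apply pow_incr; lra).
  assert (P0 : 0 <= Cmod z ^ n) by now apply pow_le.
  apply Rle_trans with (Rabs K * (Cmod z * Cmod z ^ n)).
  - apply Rmult_le_compat_r; [now apply Rmult_le_pos|apply Rle_abs].
  - apply Rmult_le_compat_l; [apply Rabs_pos|]. nra. }
destruct (divq_holo R0 f f' Hf 0 H00) as [q' Hq].
assert (Eq : forall z, f z = (z * divq f f' z 0)%C).
{ intros z. pose proof (divq_mult f f' z 0) as M. rewrite E0 in M.
  transitivity (f z - 0)%C; [ring|]. rewrite <- M. ring. }
destruct (IH R0 (fun z => divq f f' z 0) q' K d HR Hq Hd) as (F & F' & HF & EF).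
- intros z Hz Hzd. specialize (HK z Hz Hzd). rewrite Eq, Cmod_mult in HK. simpl in HK.
  pose proof (proj1 (Cmod_gt_0 z) Hz) as Hp. apply (Rmult_le_reg_l (Cmod z)); [exact Hp|]. lra.
- exists F, F'. split; [exact HF|]. intros z. rewrite Eq, EF. simpl. ring.
Qed.

Lemma bounded_powers_le_1 (x K : R) : (forall N, x ^ N <= K) -> x <= 1.
Proof.
intros H. apply Rnot_lt_le. intros Hx.
destruct (Pow_x_infinity x ltac:(rewrite Rabs_pos_eq; lra) (K + 1)) as [N HN].
specialize (HN N (Nat.le_refl N)). rewrite Rabs_pos_eq in HN by (apply pow_le; lra).
specialize (H N). lra.
Qed.

Lemma bernoulli_sub (h : R) (n : nat) : 0 <= h <= 1 -> 1 - INR n * h <= (1 - h) ^ n.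
Proof.
intros Hh. induction n as [|n IH]; [simpl; lra|]. rewrite S_INR. cbn [pow].
assert (0 <= INR n * h * h) by (repeat apply Rmult_le_pos; try lra; apply pos_INR).
assert ((1 - h) * (1 - INR n * h) <= (1 - h) * (1 - h) ^ n) by (apply Rmult_le_compat_l; lra).
nra.
Qed.

(* Cauchy's estimate for the powers [F ^ N] loses only a factor independent of [N]. *)
Lemma factor_bound (n : nat) (om F F' : C -> C) :
  holo_disc 1 F F' -> (forall z, om z = (z ^ n * F z)%C) ->
  (forall z, Cmod z < 1 -> Cmod (om z) <= 1) ->
  forall a, Cmod a < 1 -> Cmod (F a) <= 1.
Proof.
intros HF EF Hom a Ha. pose proof (Cmod_ge_0 a) as Ha0.
assert (Hrho : forall rho, Cmod a < rho < 1 -> Cmod (F a) * rho ^ n <= 1).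
{ intros rho Hr. assert (Hrn : 0 < rho ^ n) by (apply pow_lt; lra).
  apply (bounded_powers_le_1 _ (2 * (rho / (rho - Cmod a)))). intros N.
  rewrite Rpow_mult_distr.
  assert (HFN : holo_disc 1 (fun z => F z ^ N)%C (fun z => F' z * (RtoC (INR N) * F z ^ pred N))%C).
  { intros z Hz. apply (has_cderiv_comp (fun w => w ^ N)%C F); [apply has_cderiv_pow|now apply HF]. }
  rewrite <- Cmod_pow, <- (cauchy_formula 1 rho _ _ a (proj2 Hr) (proj1 Hr) HFN).
  assert (HNa : forall t, (circ rho t - a)%C <> 0) by (intros; apply circ_sub_neq0; lra).
  apply Rle_trans with (2 * ((/ rho ^ n) ^ N * (rho / (rho - Cmod a))) * (rho ^ n) ^ N).
  - apply Rmult_le_compat_r; [apply pow_le; lra|]. apply Cmean_bound.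
    + intros t. apply ccont_mult.
      * apply ccont_pow, (holo_ccont 1 F F' HF); [rewrite Cmod_circ; lra|apply ccont_circ].
      * now apply ccont_cauchy_kernel.
    + intros t _. rewrite Cmod_mult, Cmod_pow, Cmod_div, Cmod_circ by (auto; lra).
      apply Rmult_le_compat.
      * apply pow_le, Cmod_ge_0.
      * apply Rdiv_le_0_compat; [lra|]. now apply Cmod_gt_0.
      * apply pow_incr. split; [apply Cmod_ge_0|].
        pose proof (Hom (circ rho t) ltac:(rewrite Cmod_circ; lra)) as B.
        rewrite EF, Cmod_mult, Cmod_pow, Cmod_circ in B by lra.
        apply (Rmult_le_reg_l (rho ^ n)); [exact Hrn|]. rewrite Rinv_r by lra. exact B.
      * apply Rmult_le_compat_l; [lra|]. apply Rinv_le_contravar; [lra|]. apply circ_sub_ge; lra.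
  - apply Req_le. rewrite pow_inv. field. split; [lra|]. apply pow_nonzero. lra. }
(* It remains to let [rho] tend to 1: for [rho = 1 - h], Bernoulli's inequality gives
   [|F a| * (1 - n h) <= 1], so [|F a|] exceeds 1 by at most [h * k]. *)
apply le_epsilon. intros eps He.
set (k := INR n * Cmod (F a) + 1).
assert (Hk : 0 < k).
{ unfold k. pose proof (Rmult_le_pos _ _ (pos_INR n) (Cmod_ge_0 (F a))). lra. }
set (h := Rmin ((1 - Cmod a) / 2) (eps / k)).
assert (Hh : 0 < h) by (apply Rmin_pos; [lra|now apply Rdiv_lt_0_compat]).
assert (h1 : h <= (1 - Cmod a) / 2) by apply Rmin_l.
assert (h2 : h * k <= eps).
{ apply Rmin_div_mult. lra. }
specialize (Hrho (1 - h) ltac:(lra)).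
pose proof (bernoulli_sub h n ltac:(lra)) as B.
apply Rmult_le_compat_l with (r := Cmod (F a)) in B; [|apply Cmod_ge_0].
unfold k in h2. nra.
Qed.

(** The [n]-th derivative is bounded near 0. Descending from it to [om], every lower derivative
    vanishes at 0, so [cder_bound] along the segment from 0 to [z] gains a factor [2 |z|] each
    time. *)
Lemma in_B_local_bound (n : nat) (om : C -> C) : in_B n om ->
  exists K d, 0 < d /\ forall z : C, z <> 0 -> Cmod z < d -> Cmod (om z) <= K * Cmod z ^ n.
Proof.
intros [_ [D (D0 & DD & Dk & _)]].
assert (H00 : inD 0) by (unfold inD; rewrite Cmod_0; lra).
destruct (has_cderiv_continuous (D n) 0 _ (DD n 0 H00) 1 Rlt_0_1) as [d1 [Hd1 H1]].
set (d := Rmin d1 1). assert (Hd : 0 < d) by (apply Rmin_pos; lra).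
assert (dd1 : d <= d1) by apply Rmin_l. assert (d1' : d <= 1) by apply Rmin_r.
assert (H : forall k, (k <= n)%nat -> exists K, 0 <= K /\
  forall z, Cmod z < d -> Cmod (D (n - k)%nat z) <= K * Cmod z ^ k).
{ induction k as [|k IH]; intros Hk.
  - exists (Cmod (D n 0) + 1). split; [pose proof (Cmod_ge_0 (D n 0)); lra|].
    intros z Hz. rewrite Nat.sub_0_r. simpl.
    specialize (H1 z). replace (z - 0)%C with z in H1 by ring. specialize (H1 ltac:(lra)).
    pose proof (Cmod_minus_ge (D n z) (D n 0)). lra.
  - destruct (IH ltac:(lia)) as [K [HK0 HK]]. exists (2 * K). split; [lra|]. intros z Hz.
    set (j := (n - S k)%nat). assert (Ej : S j = (n - k)%nat) by (unfold j; lia).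
    assert (Hseg : forall t, 0 <= t <= 1 -> Cmod (0 + RtoC t * z) <= Cmod z).
    { intros t Ht. rewrite Cplus_0_l, Cmod_mult, Cmod_R, Rabs_pos_eq by lra.
      pose proof (Cmod_ge_0 z). nra. }
    pose proof (cder_bound (fun t => D j (0 + RtoC t * z)%C) (fun t => D (S j) (0 + RtoC t * z)%C * z)%C
      0 1 (K * Cmod z ^ k * Cmod z)) as B.
    assert (E1 : (0 + RtoC 1 * z)%C = z) by ring. assert (E0 : (0 + RtoC 0 * z)%C = 0) by ring.
    specialize (B ltac:(intros t Ht; apply (cder_comp (D j)); [apply DD; unfold inD; pose proof (Hseg t Ht); lra|apply cder_line])).
    assert (B' : forall t, 0 <= t <= 1 -> Cmod (D (S j) (0 + RtoC t * z)%C * z) <= K * Cmod z ^ k * Cmod z).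
    { intros t Ht. rewrite Cmod_mult. apply Rmult_le_compat_r; [apply Cmod_ge_0|].
      rewrite Ej. pose proof (Hseg t Ht).
      eapply Rle_trans; [apply HK; lra|]. apply Rmult_le_compat_l; [exact HK0|].
      apply pow_incr. split; [apply Cmod_ge_0|assumption]. }
    specialize (B B' 1 0 ltac:(lra) ltac:(lra)). cbv beta in B. rewrite E1, E0 in B.
    rewrite (Dk j) in B by (unfold j; lia).
    replace (D j z - 0)%C with (D j z) in B by ring.
    eapply Rle_trans; [exact B|]. rewrite Rminus_0_r, Rabs_R1. apply Req_le. simpl. ring. }
destruct (H n (Nat.le_refl n)) as [K [_ HK]]. rewrite Nat.sub_diag, D0 in HK.
exists K, d. split; [exact Hd|]. intros z _ Hz. now apply HK.
Qed.

Lemma schwarz_order (n : nat) (om : C -> C) (z : C) :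
  in_B n om -> Cmod z < 1 -> Cmod (om z) <= Cmod z ^ n.
Proof.
intros HB Hz. destruct (in_B_local_bound n om HB) as (K & d & Hd & HK).
destruct HB as [Hom [D (D0 & DD & _)]].
assert (Hh : holo_disc 1 om (D 1%nat)).
{ intros w Hw. rewrite <- D0. now apply DD. }
destruct (holo_factor_zero n 1 om _ K d Rlt_0_1 Hh Hd HK) as (F & F' & HF & EF).
rewrite EF, Cmod_mult, Cmod_pow. apply Rle_trans with (Cmod z ^ n * 1); [|lra].
apply Rmult_le_compat_l; [apply pow_le, Cmod_ge_0|].
apply (factor_bound n om F F' HF EF); assumption.
Qed.

(** * Circle means and logarithmic energy *)

Definition Rcont (u : R -> R) : Prop := forall t, continuous u t.
Definition Rcont2 (k : R -> R -> R) : Prop := forall s t, continuity_2d_pt k s t.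

Lemma Rcont_const (c : R) : Rcont (fun _ => c).
Proof. intros t. apply continuous_const. Qed.

Lemma Rcont_plus (u v : R -> R) : Rcont u -> Rcont v -> Rcont (fun t => u t + v t).
Proof. intros Hu Hv t. exact (continuous_plus (V := R_NormedModule) _ _ t (Hu t) (Hv t)). Qed.

Lemma Rcont_opp (u : R -> R) : Rcont u -> Rcont (fun t => - u t).
Proof. intros Hu t. exact (continuous_opp (V := R_NormedModule) _ t (Hu t)). Qed.

Lemma Rcont_minus (u v : R -> R) : Rcont u -> Rcont v -> Rcont (fun t => u t - v t).
Proof. intros Hu Hv. exact (Rcont_plus u _ Hu (Rcont_opp v Hv)). Qed.

Lemma Rcont_mult (u v : R -> R) : Rcont u -> Rcont v -> Rcont (fun t => u t * v t).
Proof. intros Hu Hv t. exact (continuous_mult _ _ t (Hu t) (Hv t)). Qed.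

Lemma Rcont_comp (g u : R -> R) : Rcont u -> (forall t, continuous g (u t)) -> Rcont (fun t => g (u t)).
Proof. intros Hu Hg t. exact (continuous_comp u g t (Hu t) (Hg t)). Qed.

Lemma Rcont_inv (u : R -> R) : Rcont u -> (forall t, u t <> 0) -> Rcont (fun t => / u t).
Proof.
intros Hu Hn. apply Rcont_comp; [exact Hu|]. intros t.
apply continuity_pt_filterlim, (continuity_pt_inv (fun x => x)); [|apply Hn].
apply continuity_pt_id.
Qed.

Lemma continuous_ln (x : R) : 0 < x -> continuous ln x.
Proof.
intros Hx. apply continuity_pt_filterlim, derivable_continuous_pt.
exists (/ x). now apply derivable_pt_lim_ln.
Qed.

Lemma Rcont_ln (u : R -> R) : Rcont u -> (forall t, 0 < u t) -> Rcont (fun t => ln (u t)).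
Proof. intros Hu Hp. apply Rcont_comp; [exact Hu|]. intros t. now apply continuous_ln. Qed.

Lemma Rcont2_fst (u : R -> R) : Rcont u -> Rcont2 (fun s _ => u s).
Proof.
intros Hu s t. apply (continuity_1d_2d_pt_comp u (fun s _ => s)).
- apply continuity_pt_filterlim, Hu.
- apply continuity_2d_pt_id1.
Qed.

Lemma Rcont2_snd (u : R -> R) : Rcont u -> Rcont2 (fun _ t => u t).
Proof.
intros Hu s t. apply (continuity_1d_2d_pt_comp u (fun _ t => t)).
- apply continuity_pt_filterlim, Hu.
- apply continuity_2d_pt_id2.
Qed.

Lemma Rcont2_plus (k l : R -> R -> R) : Rcont2 k -> Rcont2 l -> Rcont2 (fun s t => k s t + l s t).
Proof. intros Hk Hl s t. now apply continuity_2d_pt_plus. Qed.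

Lemma Rcont2_opp (k : R -> R -> R) : Rcont2 k -> Rcont2 (fun s t => - k s t).
Proof. intros Hk s t. now apply continuity_2d_pt_opp. Qed.

Lemma Rcont2_minus (k l : R -> R -> R) : Rcont2 k -> Rcont2 l -> Rcont2 (fun s t => k s t - l s t).
Proof. intros Hk Hl s t. now apply continuity_2d_pt_minus. Qed.

Lemma Rcont2_mult (k l : R -> R -> R) : Rcont2 k -> Rcont2 l -> Rcont2 (fun s t => k s t * l s t).
Proof. intros Hk Hl s t. now apply continuity_2d_pt_mult. Qed.

Lemma Rcont2_inv (k : R -> R -> R) : Rcont2 k -> (forall s t, k s t <> 0) -> Rcont2 (fun s t => / k s t).
Proof. intros Hk Hn s t. now apply continuity_2d_pt_inv. Qed.

Lemma Rcont2_comp (g : R -> R) (k : R -> R -> R) :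
  Rcont2 k -> (forall s t, continuous g (k s t)) -> Rcont2 (fun s t => g (k s t)).
Proof.
intros Hk Hg s t. apply continuity_1d_2d_pt_comp; [|apply Hk].
apply continuity_pt_filterlim, Hg.
Qed.

Lemma Rcont2_ln (k : R -> R -> R) : Rcont2 k -> (forall s t, 0 < k s t) -> Rcont2 (fun s t => ln (k s t)).
Proof. intros Hk Hp. apply Rcont2_comp; [exact Hk|]. intros s t. now apply continuous_ln. Qed.

Lemma Rcont2_pow (k : R -> R -> R) (n : nat) : Rcont2 k -> Rcont2 (fun s t => k s t ^ n).
Proof.
intros Hk. induction n as [|n IH]; [exact (fun s t => continuity_2d_pt_const s t 1)|].
exact (Rcont2_mult k _ Hk IH).
Qed.

Lemma Rcont2_const (c : R) : Rcont2 (fun _ _ => c).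
Proof. intros s t. apply continuity_2d_pt_const. Qed.

Lemma Rcont2_RC (k : R -> R -> R) (s : R) : Rcont2 k -> Rcont (k s).
Proof.
intros Hk t. apply continuous_eps. intros e He.
destruct (Hk s t (mkposreal e He)) as [d Hd]. exists d. split; [apply cond_pos|].
intros r Hr. apply Hd; [|exact Hr]. rewrite Rminus_diag, Rabs_R0. apply cond_pos.
Qed.

Definition Rmean (u : R -> R) : R := RInt u 0 (2 * PI) / (2 * PI).

Lemma Rcont_ex_RInt (u : R -> R) (a b : R) : Rcont u -> ex_RInt u a b.
Proof. intros H. apply (ex_RInt_continuous (V := R_CompleteNormedModule)). intros; apply H. Qed.

Lemma Rmean_ext (u v : R -> R) : (forall t, u t = v t) -> Rmean u = Rmean v.
Proof. intros H. unfold Rmean. f_equal. apply RInt_ext. intros; apply H. Qed.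

Lemma Rmean_plus (u v : R -> R) : Rcont u -> Rcont v -> Rmean (fun t => u t + v t) = Rmean u + Rmean v.
Proof.
intros Hu Hv. pose proof two_PI_pos. unfold Rmean.
rewrite (RInt_plus (V := R_CompleteNormedModule) u v) by now apply Rcont_ex_RInt.
unfold plus; simpl. field. lra.
Qed.

Lemma Rmean_scal (c : R) (u : R -> R) : Rcont u -> Rmean (fun t => c * u t) = c * Rmean u.
Proof.
intros Hu. pose proof two_PI_pos. unfold Rmean.
rewrite (RInt_scal (V := R_CompleteNormedModule) u) by now apply Rcont_ex_RInt.
unfold scal; simpl. unfold mult; simpl. field. lra.
Qed.

Lemma Rmean_const (c : R) : Rmean (fun _ => c) = c.
Proof.
unfold Rmean. rewrite RInt_const. unfold scal; simpl. unfold mult; simpl.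
pose proof two_PI_pos. field. lra.
Qed.

Lemma Rmean_minus (u v : R -> R) : Rcont u -> Rcont v -> Rmean (fun t => u t - v t) = Rmean u - Rmean v.
Proof.
intros Hu Hv. rewrite (Rmean_ext _ (fun t => u t + -1 * v t)) by (intros; ring).
rewrite Rmean_plus, Rmean_scal by auto using Rcont_mult, Rcont_const. ring.
Qed.

Lemma Rmean_le (u v : R -> R) :
  Rcont u -> Rcont v -> (forall t, 0 <= t <= 2 * PI -> u t <= v t) -> Rmean u <= Rmean v.
Proof.
intros Hu Hv H. pose proof two_PI_pos. unfold Rmean.
apply Rmult_le_compat_r; [apply Rlt_le, Rinv_0_lt_compat; lra|].
apply RInt_le; [lra|now apply Rcont_ex_RInt|now apply Rcont_ex_RInt|]. intros; apply H; lra.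
Qed.

Lemma Rcont_Rmean (k : R -> R -> R) : Rcont2 k -> Rcont (fun s => Rmean (k s)).
Proof.
intros Hk s0. apply continuous_eps. intros e He. pose proof two_PI_pos as HP.
destruct (uniform_continuity_2d_1d' k 0 (2 * PI) s0 (fun x _ => Hk s0 x)
  (mkposreal (e / 2) ltac:(lra))) as [d Hd].
exists d. split; [apply cond_pos|]. intros s Hs. apply Rabs_def2 in Hs.
assert (H : forall t, 0 <= t <= 2 * PI -> Rabs (k s t - k s0 t) < e / 2).
{ intros t Ht. apply (Hd t s0 t s); try lra; rewrite ?Rminus_diag, ?Rabs_R0; try apply cond_pos;
    pose proof (cond_pos d); lra. }
rewrite <- Rmean_minus by now apply Rcont2_RC.
apply Rle_lt_trans with (e / 2); [|lra]. apply Rabs_le. split.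
- rewrite <- (Rmean_const (- (e / 2))). apply Rmean_le; [apply Rcont_const| |].
  + apply Rcont_minus; now apply Rcont2_RC.
  + intros t Ht. specialize (H t Ht). apply Rabs_def2 in H. lra.
- rewrite <- (Rmean_const (e / 2)). apply Rmean_le; [|apply Rcont_const|].
  + apply Rcont_minus; now apply Rcont2_RC.
  + intros t Ht. specialize (H t Ht). apply Rabs_def2 in H. lra.
Qed.

(** An iterated mean, with [s] outside throughout; the order of integration is never exchanged. *)
Definition Rmean2 (k : R -> R -> R) : R := Rmean (fun s => Rmean (k s)).

Lemma Rmean2_ext (k l : R -> R -> R) : (forall s t, k s t = l s t) -> Rmean2 k = Rmean2 l.
Proof. intros H. apply Rmean_ext. intros s. apply Rmean_ext, H. Qed.

Lemma Rmean2_plus (k l : R -> R -> R) : Rcont2 k -> Rcont2 l -> Rmean2 (fun s t => k s t + l s t) = Rmean2 k + Rmean2 l.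
Proof.
intros Hk Hl. unfold Rmean2. rewrite <- Rmean_plus by now apply Rcont_Rmean.
apply Rmean_ext. intros s. apply Rmean_plus; now apply Rcont2_RC.
Qed.

Lemma Rmean2_scal (c : R) (k : R -> R -> R) : Rcont2 k -> Rmean2 (fun s t => c * k s t) = c * Rmean2 k.
Proof.
intros Hk. unfold Rmean2. rewrite <- Rmean_scal by now apply Rcont_Rmean.
apply Rmean_ext. intros s. apply Rmean_scal. now apply Rcont2_RC.
Qed.

Lemma Rmean2_minus (k l : R -> R -> R) : Rcont2 k -> Rcont2 l -> Rmean2 (fun s t => k s t - l s t) = Rmean2 k - Rmean2 l.
Proof.
intros Hk Hl. unfold Rmean2. rewrite <- Rmean_minus by now apply Rcont_Rmean.
apply Rmean_ext. intros s. apply Rmean_minus; now apply Rcont2_RC.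
Qed.

Lemma Rmean2_le (k l : R -> R -> R) : Rcont2 k -> Rcont2 l ->
  (forall s t, 0 <= s <= 2 * PI -> 0 <= t <= 2 * PI -> k s t <= l s t) -> Rmean2 k <= Rmean2 l.
Proof.
intros Hk Hl H. apply Rmean_le; [now apply Rcont_Rmean|now apply Rcont_Rmean|].
intros s Hs. apply Rmean_le; [now apply Rcont2_RC|now apply Rcont2_RC|]. intros t Ht. now apply H.
Qed.

Lemma Rmean2_const (c : R) : Rmean2 (fun _ _ => c) = c.
Proof. unfold Rmean2. rewrite (Rmean_ext _ (fun _ => c)); intros; apply Rmean_const. Qed.

Lemma Rmean2_tensor (u v : R -> R) : Rcont u -> Rcont v -> Rmean2 (fun s t => u s * v t) = Rmean u * Rmean v.
Proof.
intros Hu Hv. unfold Rmean2. rewrite (Rmean_ext _ (fun s => Rmean v * u s)).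
- rewrite Rmean_scal by exact Hu. ring.
- intros s. rewrite Rmean_scal by exact Hv. ring.
Qed.

(** The partial sums of the series of [- ln (1 - x)], whose coefficients [1 / k] are positive; their
    signs are what the energy argument relies on. *)
Fixpoint ln_partial (n : nat) (x : R) : R :=
  match n with O => 0 | S m => ln_partial m x + x ^ S m / INR (S m) end.

Lemma is_derive_ln_remainder (n : nat) (x : R) :
  x < 1 -> is_derive (fun y => - ln (1 - y) - ln_partial n y) x (x ^ n / (1 - x)).
Proof.
intros Hx. induction n as [|n IH].
- simpl. auto_derive; [lra|]. field. lra.
- assert (HS : INR (S n) <> 0) by (apply not_0_INR; lia).
  apply (is_derive_ext (fun y => (- ln (1 - y) - ln_partial n y) - y ^ S n / INR (S n))).
  { intros y. cbn [ln_partial]. match goal with |- ?A = ?B => change (A = B :> R) end. ring. }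
  assert (D : is_derive (fun y => y ^ S n / INR (S n)) x (x ^ n)).
  { auto_derive; [exact I|]. simpl pred. field. exact HS. }
  pose proof (is_derive_minus (V := R_NormedModule) _ _ x _ _ IH D) as H.
  match type of H with is_derive _ _ ?l => replace (x ^ S n / (1 - x)) with l; [exact H|] end.
  unfold minus, plus, opp; simpl. field. lra.
Qed.

(** The remainder vanishes at 0 and has derivative [y^n / (1 - y)], so the mean value theorem bounds
    it uniformly for [|x| <= q]. *)
Lemma ln_remainder_bound (n : nat) (x q : R) :
  Rabs x <= q -> q < 1 -> Rabs (- ln (1 - x) - ln_partial n x) <= q ^ n / (1 - q).
Proof.
intros Hx Hq. assert (Hq0 : 0 <= q) by (eapply Rle_trans; [apply Rabs_pos|exact Hx]).
assert (Hb : forall y, Rmin 0 x <= y <= Rmax 0 x -> Rabs y <= q).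
{ intros y Hy. apply Rabs_le. destruct (proj1 (Rabs_le_between x q) Hx) as [A B].
  split.
  - eapply Rle_trans; [|apply Hy]. apply Rmin_glb; lra.
  - eapply Rle_trans; [apply Hy|]. apply Rmax_lub; lra. }
assert (H0 : forall m, ln_partial m 0 = 0).
{ induction m as [|m IH]; [reflexivity|]. cbn [ln_partial]. rewrite IH. simpl. unfold Rdiv. ring. }
destruct (MVT_gen (fun y => - ln (1 - y) - ln_partial n y) 0 x (fun y => y ^ n / (1 - y))) as [c [Hc E]].
- intros y Hy. apply is_derive_ln_remainder.
  assert (A : Rabs y <= q) by (apply Hb; lra). apply Rabs_le_between in A. lra.
- intros y Hy. apply continuity_pt_filterlim.
  apply (ex_derive_continuous (V := R_NormedModule) (fun y => - ln (1 - y) - ln_partial n y)).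
  eexists. apply is_derive_ln_remainder. pose proof (Hb y Hy) as A. apply Rabs_le_between in A. lra.
- rewrite H0 in E. replace (1 - 0) with 1 in E by ring. rewrite ln_1 in E.
  replace (- ln (1 - x) - ln_partial n x) with (c ^ n / (1 - c) * (x - 0)) by lra.
  pose proof (Hb c Hc) as A. pose proof (proj1 (Rabs_le_between _ _) A) as A'.
  unfold Rdiv. rewrite !Rabs_mult, Rminus_0_r, <- RPow_abs, (Rabs_pos_eq (/ (1 - c)))
    by (apply Rlt_le, Rinv_0_lt_compat; lra).
  replace (q ^ n * / (1 - q)) with (q ^ n * / (1 - q) * 1) by ring.
  apply Rmult_le_compat.
  + apply Rmult_le_pos; [apply pow_le, Rabs_pos|]. apply Rlt_le, Rinv_0_lt_compat; lra.
  + apply Rabs_pos.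
  + apply Rmult_le_compat.
    * apply pow_le, Rabs_pos.
    * apply Rlt_le, Rinv_0_lt_compat; lra.
    * apply pow_incr. split; [apply Rabs_pos|exact A].
    * apply Rinv_le_contravar; lra.
  + lra.
Qed.

Ltac Rcont2_step :=
  lazymatch goal with
  | |- Rcont2 (fun _ _ => ?c) => apply Rcont2_const
  | |- Rcont2 (fun s _ => @?u s) => apply (Rcont2_fst u)
  | |- Rcont2 (fun _ t => @?u t) => apply (Rcont2_snd u)
  | |- Rcont2 (fun s t => Rplus _ _) => apply Rcont2_plus
  | |- Rcont2 (fun s t => Rminus _ _) => apply Rcont2_minus
  | |- Rcont2 (fun s t => Ropp _) => apply Rcont2_opp
  | |- Rcont2 (fun s t => Rmult _ _) => apply Rcont2_mult
  | |- Rcont2 (fun s t => pow _ _) => apply Rcont2_pow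
  end.

Ltac Rcont_step :=
  lazymatch goal with
  | |- Rcont (fun _ => ?c) => apply Rcont_const
  | |- Rcont (fun s => Rplus _ _) => apply Rcont_plus
  | |- Rcont (fun s => Rminus _ _) => apply Rcont_minus
  | |- Rcont (fun s => Ropp _) => apply Rcont_opp
  | |- Rcont (fun s => Rmult _ _) => apply Rcont_mult
  end.

(* By Schur's product theorem the powers of a Gram kernel are positive semidefinite. *)
Lemma Rmean2_gram_pow_nonneg (v1 v2 v3 w : R -> R) (n : nat) :
  Rcont v1 -> Rcont v2 -> Rcont v3 -> Rcont w ->
  0 <= Rmean2 (fun s t => (v1 s * v1 t + v2 s * v2 t + v3 s * v3 t) ^ n * (w s * w t)).
Proof.
(* Expanding one factor of the kernel replaces the weight [w] by [v1 w], [v2 w] and [v3 w], so the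
   induction has to range over all weights. For [n = 0] the mean is the square of the mean of
   [w]. *)
intros H1 H2 H3. revert w. induction n as [|n IH]; intros w Hw.
- rewrite (Rmean2_ext _ (fun s t => w s * w t)) by (intros; simpl; ring).
  rewrite Rmean2_tensor by assumption. nra.
- set (k := fun s t => v1 s * v1 t + v2 s * v2 t + v3 s * v3 t).
  assert (Hk : Rcont2 k) by (unfold k; repeat first [Rcont2_step|Rcont_step]; assumption).
  assert (T : forall v, Rcont v -> Rcont2 (fun s t => k s t ^ n * ((v s * w s) * (v t * w t)))).
  { intros v Hv. apply Rcont2_mult; [now apply Rcont2_pow|]. repeat Rcont2_step; now apply Rcont_mult. }
  rewrite (Rmean2_ext _ (fun s t => k s t ^ n * ((v1 s * w s) * (v1 t * w t))
    + k s t ^ n * ((v2 s * w s) * (v2 t * w t)) + k s t ^ n * ((v3 s * w s) * (v3 t * w t)))).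
  2:{ intros s t. fold (k s t). simpl. unfold k at 1. ring. }
  rewrite !Rmean2_plus; [|now apply T|now apply T| |now apply T].
  + pose proof (IH _ (Rcont_mult _ _ H1 Hw)). pose proof (IH _ (Rcont_mult _ _ H2 Hw)).
    pose proof (IH _ (Rcont_mult _ _ H3 Hw)). unfold k in *. lra.
  + apply Rcont2_plus; now apply T.
Qed.

Lemma Rcont_bounded (u : R -> R) (a b : R) :
  a <= b -> Rcont u -> exists M, 0 <= M /\ forall t, a <= t <= b -> Rabs (u t) <= M.
Proof.
intros Hab Hu. destruct (ccont_bounded (fun t => RtoC (u t)) a b Hab) as [M [H0 HM]].
- intros t. apply ccont_RtoC, Hu.
- exists M. split; [exact H0|]. intros t Ht. rewrite <- Cmod_R. now apply HM.
Qed.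

Lemma Cmod_sqr (z : C) : Cmod z * Cmod z = Re z * Re z + Im z * Im z.
Proof. pose proof (Cmod2_alt z) as H. simpl in H. lra. Qed.

Lemma Rcont2_Cmod_sub_sqr (x : R -> C) :
  (forall t, ccont x t) -> Rcont2 (fun s t => Cmod (x s - x t) * Cmod (x s - x t)).
Proof.
intros Hx. assert (H1 : Rcont (fun t => Re (x t))) by (intros t; apply Hx).
assert (H2 : Rcont (fun t => Im (x t))) by (intros t; apply Hx).
intros s0 t0.
apply (continuity_2d_pt_ext (fun s t => (Re (x s) - Re (x t)) * (Re (x s) - Re (x t))
  + (Im (x s) - Im (x t)) * (Im (x s) - Im (x t)))).
- intros s t. rewrite Cmod_sqr. unfold Re, Im; simpl. ring.
- revert s0 t0. match goal with |- forall s0 t0, continuity_2d_pt ?k s0 t0 => change (Rcont2 k) end.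
  repeat first [Rcont2_step|Rcont_step]; assumption.
Qed.

(* Under stereographic projection [|x s - x t|^2 + e] becomes one minus a Gram kernel, up to a
   factor depending on [s] and one on [t]; a charge [u] of total mass zero does not see them. *)
Lemma log_energy_nonpos (x : R -> C) (u : R -> R) (e : R) :
  (forall t, ccont x t) -> Rcont u -> Rmean u = 0 -> 0 < e ->
  Rmean2 (fun s t => ln (Cmod (x s - x t) * Cmod (x s - x t) + e) * (u s * u t)) <= 0.
Proof.
intros Hx Hu Hu0 He. pose proof two_PI_pos as HP.
assert (Hx1 : Rcont (fun t => Re (x t))) by (intros t; apply Hx).
assert (Hx2 : Rcont (fun t => Im (x t))) by (intros t; apply Hx).
(* The stereographic denominator, with [e] shared equally between the two points, so that
   [1 - k s t = 2 (d s t + e) / (p s p t)]. The vector [(v1, v2, v3)] then lies strictly inside the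
   unit sphere, with [k t t = 1 - 2 e / (p t)^2], and the logarithmic series converges even on the
   diagonal. *)
set (p := fun t => Re (x t) * Re (x t) + Im (x t) * Im (x t) + e / 2 + 1).
assert (Hp : Rcont p) by (unfold p; repeat Rcont_step; assumption).
assert (Hp0 : forall t, 1 < p t).
{ intros t. unfold p. pose proof (Rle_0_sqr (Re (x t))). pose proof (Rle_0_sqr (Im (x t))).
  unfold Rsqr in *. lra. }
assert (Hpn : forall t, p t <> 0) by (intros t; specialize (Hp0 t); lra).
pose proof (Rcont_inv p Hp Hpn) as Hip.
set (v1 := fun t => 1 - 2 * / p t). set (v2 := fun t => 2 * Re (x t) * / p t).
set (v3 := fun t => 2 * Im (x t) * / p t).
assert (H1 : Rcont v1) by (unfold v1; repeat Rcont_step; assumption).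
assert (H2 : Rcont v2) by (unfold v2; repeat Rcont_step; assumption).
assert (H3 : Rcont v3) by (unfold v3; repeat Rcont_step; assumption).
set (k := fun s t => v1 s * v1 t + v2 s * v2 t + v3 s * v3 t).
assert (Hk : Rcont2 k) by (unfold k; repeat first [Rcont2_step|Rcont_step]; assumption).
set (d := fun s t => Cmod (x s - x t) * Cmod (x s - x t)).
assert (Hd : Rcont2 d) by (apply Rcont2_Cmod_sub_sqr; exact Hx).
assert (Hd0 : forall s t, 0 <= d s t) by (intros; apply Rmult_le_pos; apply Cmod_ge_0).
assert (Ek : forall s t, 1 - k s t = 2 * (d s t + e) * / p s * / p t).
{ intros s t. unfold d. rewrite Cmod_sqr.
  replace (Re (x s - x t)) with (Re (x s) - Re (x t)) by (unfold Re; simpl; ring).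
  replace (Im (x s - x t)) with (Im (x s) - Im (x t)) by (unfold Im; simpl; ring).
  assert (E : forall a b a' b' P P', P <> 0 -> P' <> 0 ->
    P = a * a + b * b + e / 2 + 1 -> P' = a' * a' + b' * b' + e / 2 + 1 ->
    1 - ((1 - 2 * / P) * (1 - 2 * / P') + 2 * a * / P * (2 * a' * / P') + 2 * b * / P * (2 * b' * / P'))
    = 2 * ((a - a') * (a - a') + (b - b') * (b - b') + e) * / P * / P').
  { intros a b a' b' P P' N N' EP EP'.
    replace ((a - a') * (a - a') + (b - b') * (b - b') + e)
      with (P + P' - 2 - 2 * a * a' - 2 * b * b') by (rewrite EP, EP'; field).
    field. split; assumption. }
  unfold k, v1, v2, v3. apply E; auto. }
assert (H1k : forall s t, 0 < 1 - k s t).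
{ intros s t. rewrite Ek. pose proof (Hd0 s t).
  repeat apply Rmult_lt_0_compat; try lra; apply Rinv_0_lt_compat; pose proof (Hp0 s); pose proof (Hp0 t); lra. }
destruct (Rcont_bounded p 0 (2 * PI) ltac:(lra) Hp) as [P [_ HPb]].
destruct (Rcont_bounded u 0 (2 * PI) ltac:(lra) Hu) as [U [HU0 HU]].
assert (HP1 : forall t, 0 <= t <= 2 * PI -> p t <= P).
{ intros t Ht. eapply Rle_trans; [apply Rle_abs|now apply HPb]. }
assert (HP2 : 1 < P) by (eapply Rlt_le_trans; [apply (Hp0 0)|apply HP1; lra]).
(* A bound for [k t t] that is uniform over the period; the Cauchy-Schwarz inequality extends it to
   [|k s t|]. *)
set (q := 1 - 2 * e * / P * / P).
assert (HiP : 0 < / P) by (apply Rinv_0_lt_compat; lra).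
assert (Hq1 : q < 1).
{ unfold q. assert (0 < 2 * e * / P * / P) by (repeat apply Rmult_lt_0_compat; lra). lra. }
assert (Hkd : forall t, 0 <= t <= 2 * PI -> k t t <= q).
{ intros t Ht. assert (E : k t t = 1 - 2 * e * / p t * / p t).
  { replace (k t t) with (1 - (1 - k t t)) by ring. rewrite Ek. unfold d.
    replace (x t - x t)%C with (RtoC 0) by ring. rewrite Cmod_0. ring. }
  rewrite E. unfold q. assert (/ P <= / p t) by (apply Rinv_le_contravar; [pose proof (Hp0 t); lra|now apply HP1]).
  assert (2 * e * / P * / P <= 2 * e * / p t * / p t); [|lra].
  rewrite !Rmult_assoc. apply Rmult_le_compat_l; [lra|]. apply Rmult_le_compat_l; [lra|].
  apply Rmult_le_compat; lra. }
assert (Hkq : forall s t, 0 <= s <= 2 * PI -> 0 <= t <= 2 * PI -> Rabs (k s t) <= q).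
(* [2 |k s t| <= k s s + k t t], from the squares of [v s - v t] and [v s + v t] in each
   coordinate. *)
{ intros s t Hs Ht. pose proof (Hkd s Hs). pose proof (Hkd t Ht). apply Rabs_le.
  unfold k in *.
  pose proof (Rle_0_sqr (v1 s - v1 t)). pose proof (Rle_0_sqr (v2 s - v2 t)).
  pose proof (Rle_0_sqr (v3 s - v3 t)). pose proof (Rle_0_sqr (v1 s + v1 t)).
  pose proof (Rle_0_sqr (v2 s + v2 t)). pose proof (Rle_0_sqr (v3 s + v3 t)).
  unfold Rsqr in *. split; nra. }
assert (Hq0 : 0 <= q) by (eapply Rle_trans; [apply Rabs_pos|apply (Hkq 0 0); lra]).
assert (CL : Rcont2 (fun s t => - ln (1 - k s t) * (u s * u t))).
{ apply Rcont2_mult; [|repeat first [Rcont2_step|Rcont_step]; assumption]. apply Rcont2_opp, Rcont2_ln; [|exact H1k].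
  apply Rcont2_minus; [apply Rcont2_const|exact Hk]. }
assert (CP : forall n, Rcont2 (fun s t => ln_partial n (k s t) * (u s * u t))).
{ intros n. apply Rcont2_mult; [|repeat first [Rcont2_step|Rcont_step]; assumption].
  induction n as [|n IH]; [exact (Rcont2_const 0)|]. cbn [ln_partial]. apply Rcont2_plus; [exact IH|].
  apply Rcont2_mult; [apply Rcont2_pow, Hk|apply Rcont2_const]. }
assert (Hpart : forall n, 0 <= Rmean2 (fun s t => ln_partial n (k s t) * (u s * u t))).
{ induction n as [|n IH].
  - rewrite (Rmean2_ext _ (fun _ _ => 0)) by (intros; simpl; ring). rewrite Rmean2_const. lra.
  - assert (CS : Rcont2 (fun s t => k s t ^ S n * (u s * u t))).
    { apply Rcont2_mult; [apply Rcont2_pow, Hk|repeat first [Rcont2_step|Rcont_step]; assumption]. }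
    rewrite (Rmean2_ext _ (fun s t => ln_partial n (k s t) * (u s * u t)
      + / INR (S n) * (k s t ^ S n * (u s * u t)))).
    2:{ intros s t. cbn [ln_partial]. unfold Rdiv. ring. }
    rewrite Rmean2_plus, Rmean2_scal; [|exact CS|apply CP|repeat Rcont2_step; [exact Hk|assumption|assumption]].
    pose proof (Rmean2_gram_pow_nonneg v1 v2 v3 u (S n) H1 H2 H3 Hu) as G. fold k in G.
    assert (0 <= / INR (S n)).
    { apply Rlt_le, Rinv_0_lt_compat, lt_0_INR. lia. }
    assert (0 <= / INR (S n) * Rmean2 (fun s t => k s t ^ S n * (u s * u t))) by (apply Rmult_le_pos; assumption).
    lra. }
assert (HL : 0 <= Rmean2 (fun s t => - ln (1 - k s t) * (u s * u t))).
(* The partial sums have nonnegative energy, and the tail of the series costs at most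
   [U^2 q^n / (1 - q)]. *)
{ apply (nonneg_of_geometric _ q (/ (1 - q) * (U * U))); [lra|]. intros n.
  apply Rle_trans with (Rmean2 (fun s t => - (/ (1 - q) * (U * U) * q ^ n) + ln_partial n (k s t) * (u s * u t))).
  - rewrite Rmean2_plus, Rmean2_const; [|apply Rcont2_const|apply CP]. specialize (Hpart n). lra.
  - apply Rmean2_le; [apply Rcont2_plus; [apply Rcont2_const|apply CP]|exact CL|].
    intros s t Hs Ht.
    pose proof (ln_remainder_bound n (k s t) q (Hkq s t Hs Ht) Hq1) as B.
    assert (BU : Rabs (u s * u t) <= U * U).
    { rewrite Rabs_mult. apply Rmult_le_compat; auto using Rabs_pos. }
    assert (B2 : Rabs ((- ln (1 - k s t) - ln_partial n (k s t)) * (u s * u t)) <= q ^ n / (1 - q) * (U * U)).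
    { rewrite Rabs_mult. apply Rmult_le_compat; auto using Rabs_pos. }
    apply Rabs_le_between in B2. unfold Rdiv in B2. lra. }
set (w := fun t => ln (p t)).
assert (Hw : Rcont w) by (apply Rcont_ln; [exact Hp|intros t; pose proof (Hp0 t); lra]).
(* [ln (d + e)] is [ln (1 - k s t) + w s + w t - ln 2]. The last three terms depend on at most one
   variable, so integrating [u] in the other makes them vanish. *)
rewrite (Rmean2_ext _ (fun s t => - (- ln (1 - k s t) * (u s * u t)) + (u s * w s * u t + u s * (u t * w t)) - ln 2 * (u s * u t))).
- assert (C1 : Rcont2 (fun s t => u s * w s * u t)) by (repeat first [Rcont2_step|Rcont_step]; assumption).
  assert (C3 : Rcont2 (fun s t => u s * (u t * w t))) by (repeat first [Rcont2_step|Rcont_step]; assumption).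
  assert (C4 : Rcont2 (fun s t => u s * u t)) by (repeat first [Rcont2_step|Rcont_step]; assumption).
  rewrite Rmean2_minus, Rmean2_plus, Rmean2_plus, Rmean2_scal; auto using Rcont2_opp, Rcont2_plus.
  + rewrite (Rmean2_tensor (fun s => u s * w s) u), (Rmean2_tensor u (fun t => u t * w t)), (Rmean2_tensor u u);
      auto using Rcont_mult.
    rewrite Hu0.
    rewrite (Rmean2_ext (fun s t => - (- ln (1 - k s t) * (u s * u t))) (fun s t => -1 * (- ln (1 - k s t) * (u s * u t))))
      by (intros; ring).
    rewrite Rmean2_scal by exact CL. lra.
  + repeat first [Rcont2_step|Rcont_step]; assumption.
- intros s t. fold (d s t). rewrite Ek. unfold w.
  pose proof (Hp0 s). pose proof (Hp0 t). pose proof (Hd0 s t).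
  assert (0 < / p s) by (apply Rinv_0_lt_compat; lra). assert (0 < / p t) by (apply Rinv_0_lt_compat; lra).
  rewrite !ln_mult, !ln_Rinv by (repeat apply Rmult_lt_0_compat; lra). ring.
Qed.

(** * Poisson's formula *)

Lemma ccont_cis (t : R) : ccont cis t.
Proof. exact (cder_ccont _ _ _ (cder_cis t)). Qed.

Lemma circ_1 (t : R) : circ 1 t = cis t.
Proof. unfold circ. ring. Qed.

Lemma cis_conj (t : R) : (cis t * Cconj (cis t))%C = 1.
Proof. rewrite <- Cmod2_conj, Cmod_cis. now rewrite pow1. Qed.

Lemma cis_sub_neq0 (t : R) (b : C) : Cmod b < 1 -> (cis t - b)%C <> 0.
Proof. intros H. rewrite <- circ_1. now apply circ_sub_neq0. Qed.

(* The Poisson kernel of the unit disc at [b]. *)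
Definition poisson (b : C) (t : R) : R := 2 * Re (cis t / (cis t - b)) - 1.

Lemma Rcont_poisson (b : C) : Cmod b < 1 -> Rcont (poisson b).
Proof.
intros Hb. unfold poisson. repeat Rcont_step. intros t.
apply (ccont_div cis (fun t => cis t - b)%C t (ccont_cis t)); [|now apply cis_sub_neq0].
apply ccont_minus; [apply ccont_cis|apply ccont_const].
Qed.

Lemma one_sub_neq0 (z : C) : Cmod z < 1 -> (1 - z)%C <> 0.
Proof.
intros Hz H. replace z with (1 - (1 - z))%C in Hz by ring. rewrite H in Hz.
replace (1 - 0)%C with (RtoC 1) in Hz by ring. rewrite Cmod_1 in Hz. lra.
Qed.

(** On the unit circle [conj(cis t) = 1 / cis t], so the conjugate of Cauchy's kernel, less 1,
    extends to a holomorphic function that vanishes at 0. Poisson's formula is then Cauchy's formula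
    plus a term of mean zero. *)
Lemma poisson_split (b : C) (t : R) : Cmod b < 1 ->
  RtoC (poisson b t) = (cis t / (cis t - b) + Cconj b * cis t / (1 - Cconj b * cis t))%C.
Proof.
intros Hb. set (w := (cis t / (cis t - b))%C).
assert (N1 : (cis t - b)%C <> 0) by now apply cis_sub_neq0.
assert (N2 : (1 - Cconj b * cis t)%C <> 0).
{ apply one_sub_neq0. rewrite Cmod_mult, Cmod_conj, Cmod_cis. lra. }
replace (Cconj b * cis t / (1 - Cconj b * cis t))%C with (Cconj w - 1)%C.
- unfold poisson. fold w. destruct w as [wx wy]. apply injective_projections; simpl; ring.
- assert (N3 : Cconj (cis t - b) <> 0).
  { intros E. apply N1. apply Cmod_eq_0. rewrite <- Cmod_conj, E. apply Cmod_0. }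
  unfold w. rewrite Cdiv_conj by exact N1.
  assert (E : Cconj (cis t - b) = (Cconj (cis t) * (1 - Cconj b * cis t))%C).
  { rewrite Cminus_conj. transitivity (Cconj (cis t) - Cconj b * (cis t * Cconj (cis t)))%C.
    - rewrite cis_conj. ring.
    - ring. }
  rewrite E. field. split; [exact N2|].
  intros E2. pose proof (cis_conj t) as H. rewrite E2 in H. apply (f_equal fst) in H. simpl in H. lra.
Qed.

Lemma Re_Cmean (f : R -> C) : Re (Cmean f) = Rmean (fun t => Re (f t)).
Proof.
pose proof two_PI_pos. unfold Cmean, Rmean, Cdiv.
replace (/ RtoC (2 * PI))%C with (RtoC (/ (2 * PI))) by (apply RtoC_inv; lra).
unfold CInt, Re. simpl. unfold Rdiv. ring.
Qed.

Lemma poisson_formula (R0 : R) (L L' : C -> C) (b : C) :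
  1 < R0 -> holo_disc R0 L L' -> Cmod b < 1 ->
  Rmean (fun t => Re (L (cis t)) * poisson b t) = Re (L b).
Proof.
intros HR HL Hb. pose proof (Cmod_ge_0 b) as Hb0.
assert (CLc : forall t, ccont (fun r => L (cis r)) t).
{ intros t. apply (ccont_comp L cis t (L' (cis t))); [|apply ccont_cis]. apply HL. rewrite Cmod_cis. lra. }
assert (N1 : forall t, (cis t - b)%C <> 0) by (intros; now apply cis_sub_neq0).
assert (N2 : forall t, (1 - Cconj b * cis t)%C <> 0).
{ intros t. apply one_sub_neq0. rewrite Cmod_mult, Cmod_conj, Cmod_cis. lra. }
assert (A1 : Cmean (fun t => L (cis t) * (cis t / (cis t - b)))%C = L b).
{ rewrite <- (cauchy_formula R0 1 L L' b HR Hb HL). apply Cmean_ext. intros t. now rewrite circ_1. }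
assert (A2 : Cmean (fun t => L (cis t) * (Cconj b * cis t / (1 - Cconj b * cis t)))%C = 0).
(* [2 / (1 + |b|)] exceeds 1, and its product with [|b|] is below 1; so the second kernel is
   holomorphic beyond the closed unit disc, and [A2] is the mean value property at 0. *)
{ set (R1 := Rmin R0 (2 / (1 + Cmod b))).
  assert (HR1 : 1 < R1).
  { apply Rmin_glb_lt; [exact HR|]. apply Rlt_div_r; lra. }
  assert (HR1b : R1 * Cmod b < 1).
  { apply Rle_lt_trans with (2 / (1 + Cmod b) * Cmod b).
    - apply Rmult_le_compat_r; [exact Hb0|apply Rmin_r].
    - replace (2 / (1 + Cmod b) * Cmod b) with ((2 * Cmod b) / (1 + Cmod b)) by (field; lra).
      apply Rlt_div_l; lra. }
  set (G := fun z => (L z * (Cconj b * z / (1 - Cconj b * z)))%C).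
  assert (HG : exists G', holo_disc R1 G G').
  { eexists (fun z => _). intros z Hz. unfold G.
    assert (N : (1 - Cconj b * z)%C <> 0).
    { apply one_sub_neq0. rewrite Cmod_mult, Cmod_conj.
      apply Rle_lt_trans with (R1 * Cmod b); [|exact HR1b]. rewrite Rmult_comm.
      apply Rmult_le_compat_r; lra. }
    apply has_cderiv_mult; [apply HL; eapply Rlt_le_trans; [exact Hz|apply Rmin_l]|].
    apply has_cderiv_div; [apply has_cderiv_scal, has_cderiv_id| |exact N].
    apply has_cderiv_minus; [apply has_cderiv_const|apply has_cderiv_scal, has_cderiv_id]. }
  destruct HG as [G' HG].
  transitivity (G 0).
  - rewrite <- (cauchy_formula R1 1 G G' 0 HR1); [|rewrite Cmod_0; lra|exact HG].
    apply Cmean_ext. intros t. rewrite circ_1. unfold G. field. split; [apply cis_neq0|apply N2].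
  - unfold G. replace (1 - Cconj b * 0)%C with (RtoC 1) by ring. unfold Cdiv. ring. }
assert (Ccis2 : forall t, ccont (fun t => 1 - Cconj b * cis t)%C t).
{ intros t. repeat ccont_step. apply ccont_cis. }
rewrite (Rmean_ext _ (fun t => Re (L (cis t) * (cis t / (cis t - b))
  + L (cis t) * (Cconj b * cis t / (1 - Cconj b * cis t)))%C)).
- rewrite <- Re_Cmean, Cmean_plus, A1, A2.
  + f_equal. ring.
  + intros t. apply ccont_mult; [apply CLc|]. apply ccont_div; [apply ccont_cis| |apply N1].
    apply ccont_minus; [apply ccont_cis|apply ccont_const].
  + intros t. apply ccont_mult; [apply CLc|]. apply ccont_div; [|apply Ccis2|apply N2].
    apply ccont_mult; [apply ccont_const|apply ccont_cis].
- intros t. rewrite <- Cmult_plus_distr_l, <- poisson_split by exact Hb.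
  unfold Re. simpl. ring.
Qed.

Lemma Rmean_poisson (b : C) : Cmod b < 1 -> Rmean (poisson b) = 1.
Proof.
intros Hb.
rewrite (Rmean_ext _ (fun t => Re ((fun _ => RtoC 1) (cis t)) * poisson b t)) by (intros; simpl; ring).
rewrite (poisson_formula 2 (fun _ => RtoC 1) (fun _ => RtoC 0)); [reflexivity|lra| |exact Hb].
intros z _. apply has_cderiv_const.
Qed.

Lemma ln_Cmod_cexp (a z : C) : a <> 0 -> ln (Cmod (a * cexp z)) = ln (Cmod a) + Re z.
Proof.
intros Ha. rewrite Cmod_mult, Cmod_cexp, ln_mult, ln_exp; [reflexivity|now apply Cmod_gt_0|apply exp_pos].
Qed.

(** [ln |q|] is the real part of the holomorphic function [ln |q 0| + L] with [L] from
    [holo_log]. *)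
Lemma poisson_log (R0 : R) (q q' : C -> C) (b : C) :
  1 < R0 -> holo_disc R0 q q' -> (forall z, Cmod z < R0 -> q z <> 0) -> Cmod b < 1 ->
  Rmean (fun t => ln (Cmod (q (cis t))) * poisson b t) = ln (Cmod (q b)).
Proof.
intros HR Hq Hn Hb.
destruct (holo_log R0 q q' ltac:(lra) Hq Hn) as (L & L' & HL & E).
assert (N0 : q 0 <> 0) by (apply Hn; rewrite Cmod_0; lra).
assert (EL : forall z, Cmod z < R0 -> ln (Cmod (q z)) = Re (RtoC (ln (Cmod (q 0))) + L z)%C).
{ intros z Hz. rewrite (E z Hz), ln_Cmod_cexp by exact N0. reflexivity. }
rewrite EL by lra.
rewrite <- (poisson_formula R0 (fun z => RtoC (ln (Cmod (q 0))) + L z)%C (fun z => 0 + L' z)%C); auto.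
- apply Rmean_ext. intros t. rewrite EL; [reflexivity|]. rewrite Cmod_cis. exact HR.
- intros z Hz. apply has_cderiv_plus; [apply has_cderiv_const|now apply HL].
Qed.

(** The density of the charge: against a harmonic function [u] it gives [u b - u (- b)], and its
    total mass is zero. *)
Definition dipole (b : C) (t : R) : R := poisson b t - poisson (- b)%C t.

Lemma Rcont_dipole (b : C) : Cmod b < 1 -> Rcont (dipole b).
Proof. intros Hb. apply Rcont_minus; apply Rcont_poisson; rewrite ?Cmod_opp; exact Hb. Qed.

Lemma Rmean_dipole (b : C) : Cmod b < 1 -> Rmean (dipole b) = 0.
Proof.
intros Hb. assert (Hb' : Cmod (- b) < 1) by now rewrite Cmod_opp.
unfold dipole. rewrite Rmean_minus, !Rmean_poisson; auto using Rcont_poisson. ring.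
Qed.

Lemma Rcont_ln_Cmod (f : C -> C) (R0 : R) (f' : C -> C) :
  1 < R0 -> holo_disc R0 f f' -> (forall z, Cmod z < R0 -> f z <> 0) ->
  Rcont (fun t => ln (Cmod (f (cis t)))).
Proof.
intros HR Hf Hn. assert (Hc : forall t, Cmod (cis t) < R0) by (intros; rewrite Cmod_cis; lra).
assert (Hcf : forall t, ccont (fun r => f (cis r)) t).
{ intros t. apply (ccont_comp f cis t _ (Hf _ (Hc t)) (ccont_cis t)). }
apply Rcont_ln.
- intros t. apply continuous_eps. intros e He.
  destruct (proj1 (ccont_eps _ _) (Hcf t) e He) as [d [Hd H]]. exists d. split; [exact Hd|].
  intros s Hs. eapply Rle_lt_trans; [|exact (H s Hs)].
  apply Rabs_le. pose proof (Cmod_minus_ge (f (cis s)) (f (cis t))).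
  pose proof (Cmod_minus_ge (f (cis t)) (f (cis s))). rewrite (Cmod_sub_sym (f (cis t))) in *. lra.
- intros t. apply Cmod_gt_0, Hn, Hc.
Qed.

Lemma dipole_log (R0 : R) (q q' : C -> C) (b : C) :
  1 < R0 -> holo_disc R0 q q' -> (forall z, Cmod z < R0 -> q z <> 0) -> Cmod b < 1 ->
  Rmean (fun t => ln (Cmod (q (cis t))) * dipole b t) = ln (Cmod (q b)) - ln (Cmod (q (- b)%C)).
Proof.
intros HR Hq Hn Hb. assert (Hb' : Cmod (- b) < 1) by now rewrite Cmod_opp.
pose proof (Rcont_ln_Cmod q R0 q' HR Hq Hn) as Hc.
rewrite <- (poisson_log R0 q q' b), <- (poisson_log R0 q q' (- b)%C) by assumption.
rewrite <- Rmean_minus by auto using Rcont_mult, Rcont_poisson.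
apply Rmean_ext. intros t. unfold dipole. ring.
Qed.

(** The radius [2 / (1 + |a|)] lies above 1, and [|a|] times it lies below 1. This makes [1 - a z]
    an admissible function for [dipole_log]. *)
Lemma one_sub_linear (a : C) : Cmod a < 1 -> exists R0, 1 < R0 /\
  holo_disc R0 (fun z => 1 - a * z)%C (fun _ => 0 - a * 1)%C /\
  forall z, Cmod z < R0 -> (1 - a * z)%C <> 0.
Proof.
intros Ha. pose proof (Cmod_ge_0 a) as Ha0. set (R0 := 2 / (1 + Cmod a)).
exists R0. split; [apply Rlt_div_r; lra|split].
- intros z _. apply has_cderiv_minus; [apply has_cderiv_const|apply has_cderiv_scal, has_cderiv_id].
- intros z Hz. apply one_sub_neq0. rewrite Cmod_mult.
  apply Rle_lt_trans with (Cmod a * R0); [apply Rmult_le_compat_l; lra|].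
  unfold R0. replace (Cmod a * (2 / (1 + Cmod a))) with (2 * Cmod a / (1 + Cmod a)) by (field; lra).
  apply Rlt_div_l; lra.
Qed.

Lemma Rcont_ln_linear (a : C) : Cmod a < 1 -> Rcont (fun t => ln (Cmod (1 - a * cis t))).
Proof.
intros Ha. destruct (one_sub_linear a Ha) as (R0 & HR & Hh & Hn).
exact (Rcont_ln_Cmod (fun z => 1 - a * z)%C R0 _ HR Hh Hn).
Qed.

Lemma dipole_log_linear (a b : C) :
  Cmod a < 1 -> Cmod b < 1 ->
  Rmean (fun t => ln (Cmod (1 - a * cis t)) * dipole b t) = ln (Cmod (1 - a * b)) - ln (Cmod (1 + a * b)).
Proof.
intros Ha Hb. destruct (one_sub_linear a Ha) as (R0 & HR & Hh & Hn).
rewrite (dipole_log R0 (fun z => 1 - a * z)%C _ b HR Hh Hn Hb). do 3 f_equal. ring.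
Qed.

(** * The energy of a univalent function *)

(** By uniform continuity [k] changes by less than 1 over a step [h] in [s]; finitely many such
    steps lead back to the edge [s = a], where the one-variable bound applies. *)
Lemma Rcont2_bounded (k : R -> R -> R) (a b : R) : a <= b -> Rcont2 k ->
  exists M, 0 <= M /\ forall s t, a <= s <= b -> a <= t <= b -> Rabs (k s t) <= M.
Proof.
intros Hab Hk.
destruct (uniform_continuity_2d k a b a b (fun s t _ _ => Hk s t) (mkposreal 1 Rlt_0_1)) as [d Hd].
destruct (Rcont_bounded (k a) a b Hab (Rcont2_RC k a Hk)) as [M [HM0 HM]].
assert (Hd0 := cond_pos d). set (h := d / 2).
assert (Hh : 0 < h) by (unfold h; lra).
assert (H : forall n s t, a <= s <= b -> a <= t <= b -> s <= a + INR n * h -> Rabs (k s t) <= M + INR n).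
{ induction n as [|n IH]; intros s t Hs Ht Hn.
  - simpl in *. replace s with a by lra. rewrite Rplus_0_r. now apply HM.
  - rewrite S_INR in *. destruct (Rle_lt_dec (s - h) a) as [Hsa|Hsa].
    + assert (B : Rabs (k s t - k a t) < 1).
      { apply (Hd a t s t); try lra; [|rewrite Rminus_diag, Rabs_R0; exact Hd0].
        apply Rabs_def1; unfold h in *; lra. }
      pose proof (HM t Ht). pose proof (pos_INR n).
      replace (k s t) with ((k s t - k a t) + k a t) by ring.
      eapply Rle_trans; [apply Rabs_triang|]. lra.
    + assert (B : Rabs (k s t - k (s - h) t) < 1).
      { apply (Hd (s - h) t s t); try lra; [|rewrite Rminus_diag, Rabs_R0; exact Hd0].
        apply Rabs_def1; unfold h in *; lra. }
      assert (B2 : Rabs (k (s - h) t) <= M + INR n) by (apply IH; lra).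
      replace (k s t) with ((k s t - k (s - h) t) + k (s - h) t) by ring.
      eapply Rle_trans; [apply Rabs_triang|]. lra. }
destruct (nfloor_ex ((b - a) / h)) as [n [_ Hn]].
{ apply Rdiv_le_0_compat; lra. }
exists (M + INR (S n)). split; [pose proof (pos_INR (S n)); lra|].
intros s t Hs Ht. apply H; auto. rewrite S_INR.
apply Rmult_lt_compat_r with (r := h) in Hn; [|exact Hh].
replace ((b - a) / h * h) with (b - a) in Hn by (field; lra). lra.
Qed.

Lemma ln_le_sub (x : R) : 0 < x -> ln x <= x - 1.
Proof.
intros Hx. pose proof (exp_ineq1_le (ln x)) as H. rewrite exp_ln in H by exact Hx. lra.
Qed.

(* Replacing [K] by the ratio of the regularized squared distances [K b + e] and [b + e]. *)
Lemma ln_regularization (K b e E : R) :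
  0 < K -> K <= E -> / K <= E -> 1 <= E -> 0 <= b -> 0 < e ->
  Rabs (ln K - (ln (K * b + e) - ln (b + e))) <= 4 * E * E * (e / (b + e)).
Proof.
intros HK HKE HiK HE Hb He.
assert (HiK0 : 0 < / K) by now apply Rinv_0_lt_compat.
assert (P1 : 0 < b + e) by lra.
assert (P2 : 0 < K * b + e) by (pose proof (Rmult_le_pos K b ltac:(lra) Hb); lra).
(* The quantity to be bounded is [- ln y]. Since [y - 1] and [/ y - 1] both carry the factor
   [r = e / (b + e)], the inequality [ln x <= x - 1] at [y] and at [/ y] gives both signs. *)
set (y := (K * b + e) / (K * (b + e))).
assert (Hy : 0 < y) by (apply Rdiv_lt_0_compat; [lra|now apply Rmult_lt_0_compat]).
assert (Ey : ln y = ln (K * b + e) - (ln K + ln (b + e))).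
{ unfold y, Rdiv. rewrite ln_mult, ln_Rinv, ln_mult; auto; try apply Rinv_0_lt_compat;
    now apply Rmult_lt_0_compat. }
replace (ln K - (ln (K * b + e) - ln (b + e))) with (- ln y) by lra.
rewrite Rabs_Ropp. set (r := e / (b + e)).
assert (Hr : 0 < r) by now apply Rdiv_lt_0_compat.
assert (U : y - 1 <= 4 * E * E * r).
{ replace (y - 1) with (r * (/ K - 1)) by (unfold y, r; field; split; lra).
  apply Rle_trans with (r * E); [apply Rmult_le_compat_l; lra|].
  assert (E * 1 <= E * E) by (apply Rmult_le_compat_l; lra). nra. }
assert (V : / y - 1 <= 4 * E * E * r).
{ replace (/ y - 1) with (r * ((K - 1) * ((b + e) / (K * b + e))))
    by (unfold y, r; field; repeat split; lra).
  rewrite (Rmult_comm _ r). apply Rmult_le_compat_l; [lra|].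
  assert (Q : 0 < (b + e) / (K * b + e) <= E).
  { split; [now apply Rdiv_lt_0_compat|]. apply Rle_div_l; [lra|].
    assert (1 <= E * K).
    { apply Rmult_le_compat_r with (r := K) in HiK; [|lra].
      rewrite Rinv_l in HiK by lra. exact HiK. }
    assert (b <= E * K * b) by nra. nra. }
  apply Rle_trans with (E * E); [|nra].
  apply Rle_trans with (E * ((b + e) / (K * b + e))).
  - apply Rmult_le_compat_r; lra.
  - apply Rmult_le_compat_l; lra. }
assert (H1 : ln y <= y - 1) by now apply ln_le_sub.
assert (H2 : - ln y <= / y - 1).
{ rewrite <- ln_Rinv by exact Hy. apply ln_le_sub. now apply Rinv_0_lt_compat. }
apply Rabs_le. lra.
Qed.

Lemma Cmod_1_sub_cis (sg s t : R) :
  Cmod (1 - RtoC sg * Cconj (cis s) * cis t) * Cmod (1 - RtoC sg * Cconj (cis s) * cis t)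
  = 1 + sg * sg - 2 * sg * cos (s - t).
Proof.
rewrite Cmod_sqr. unfold Re, Im, cis. simpl. rewrite cos_minus.
pose proof (sin2_cos2 s) as Hs. pose proof (sin2_cos2 t) as Ht. unfold Rsqr in *.
match goal with |- ?A = ?B =>
  replace A with (1 - 2 * sg * (cos s * cos t + sin s * sin t)
   + sg * sg * ((sin s * sin s + cos s * cos s) * (sin t * sin t + cos t * cos t))) by ring end.
rewrite Hs, Ht. ring.
Qed.

Lemma Cmod_cis_sub (s t : R) :
  Cmod (cis s - cis t) * Cmod (cis s - cis t) = 2 - 2 * cos (s - t).
Proof.
pose proof (Cmod_1_sub_cis 1 s t) as H.
replace (Cmod (cis s - cis t)) with (Cmod (1 - RtoC 1 * Cconj (cis s) * cis t)).
- rewrite H. ring.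
- transitivity (Cmod (cis s * (1 - RtoC 1 * Cconj (cis s) * cis t))).
  + rewrite Cmod_mult, Cmod_cis. ring.
  + f_equal. transitivity (cis s - (cis s * Cconj (cis s)) * cis t)%C; [ring|].
    rewrite cis_conj. ring.
Qed.

(** The origin of the value of [e]: both sides are affine in [cos (s - t)], and [(1 - sg)^2 / sg] is
    the constant that makes them agree. The logarithm of the right side is, up to a constant, twice
    that of the modulus of a nonvanishing linear function of [cis t], within reach of Poisson's
    formula. *)
Lemma cis_dist_regularized (sg s t : R) : 0 < sg < 1 ->
  Cmod (cis s - cis t) * Cmod (cis s - cis t) + (1 - sg) * (1 - sg) / sg
  = Cmod (1 - RtoC sg * Cconj (cis s) * cis t) * Cmod (1 - RtoC sg * Cconj (cis s) * cis t) / sg.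
Proof. intros Hs. rewrite Cmod_cis_sub, Cmod_1_sub_cis. field. lra. Qed.

(** The classical form [(1 - |b|^2) / |cis t - b|^2] of the kernel at [b = sg * cis s], with the
    denominator written as in [cis_dist_regularized]. *)
Lemma poisson_ratio (sg s t : R) : 0 < sg < 1 ->
  poisson (RtoC sg * cis s) t
  = (1 - sg * sg) / (Cmod (1 - RtoC sg * Cconj (cis s) * cis t) * Cmod (1 - RtoC sg * Cconj (cis s) * cis t)).
Proof.
intros Hs. set (w := (1 - RtoC sg * Cconj (cis s) * cis t)%C).
assert (Hb : Cmod (RtoC sg * cis s) < 1) by (rewrite Cmod_mult, Cmod_R, Cmod_cis, Rabs_pos_eq; lra).
assert (N : (cis t - RtoC sg * cis s)%C <> 0) by now apply cis_sub_neq0.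
assert (Ei : forall r, Cconj (cis r) = (/ cis r)%C).
{ intros r. transitivity (/ cis r * (cis r * Cconj (cis r)))%C; [field; apply cis_neq0|].
  rewrite cis_conj. ring. }
assert (Nw : w <> 0).
{ apply one_sub_neq0. now rewrite Cmod_mult, Cmod_cis, Rmult_1_r, Cmod_mult, Cmod_conj, <- Cmod_mult. }
assert (Ew : w = (1 - RtoC sg * / cis s * cis t)%C) by (unfold w; now rewrite Ei).
assert (N2 : (cis s - RtoC sg * cis t)%C <> 0).
{ intros E. apply Nw. rewrite Ew. transitivity ((cis s - RtoC sg * cis t) / cis s)%C;
    [field; apply cis_neq0|]. rewrite E. unfold Cdiv. ring. }
assert (Ec : Cconj (RtoC sg) = RtoC sg) by (apply injective_projections; simpl; ring).
assert (Ewc : Cconj w = (1 - RtoC sg * cis s * / cis t)%C).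
{ unfold w. rewrite Cminus_conj, !Cmult_conj, Cconj_conj, Ei, Ec. f_equal.
  apply injective_projections; simpl; ring. }
assert (D : RtoC (Cmod w * Cmod w) = (w * Cconj w)%C) by (rewrite <- Cmod2_conj; f_equal; ring).
apply RtoC_inj. rewrite poisson_split, RtoC_div, D, RtoC_minus, RtoC_mult, Cmult_conj, Ei, Ec, Ewc, Ew by
  (exact Hb || apply Rgt_not_eq, Rmult_lt_0_compat; now apply Cmod_gt_0).
field. repeat split; auto using cis_neq0.
Qed.

Lemma Rcont2_cis_dist : Rcont2 (fun s t => Cmod (cis s - cis t) * Cmod (cis s - cis t)).
Proof. apply Rcont2_Cmod_sub_sqr, ccont_cis. Qed.

Lemma cis_dist_nonneg (s t : R) : 0 <= Cmod (cis s - cis t) * Cmod (cis s - cis t).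
Proof. apply Rmult_le_pos; apply Cmod_ge_0. Qed.

(** The ratio is [(1 - sg) / (1 + sg)] times a Poisson kernel, which has mean 1. It governs the
    error of the regularization and shows that it vanishes as [sg] tends to 1. *)
Lemma Rmean2_circle_ratio (sg : R) : 0 < sg < 1 ->
  let e := (1 - sg) * (1 - sg) / sg in
  Rmean2 (fun s t => e / (Cmod (cis s - cis t) * Cmod (cis s - cis t) + e)) = (1 - sg) / (1 + sg).
Proof.
intros Hs e.
rewrite (Rmean2_ext _ (fun s t => (1 - sg) / (1 + sg) * poisson (RtoC sg * cis s)%C t)).
- unfold Rmean2. rewrite (Rmean_ext _ (fun _ => (1 - sg) / (1 + sg))); [apply Rmean_const|].
  intros s. assert (H : Cmod (RtoC sg * cis s) < 1) by (rewrite Cmod_mult, Cmod_R, Cmod_cis, Rabs_pos_eq; lra).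
  rewrite Rmean_scal, Rmean_poisson by auto using Rcont_poisson. ring.
- intros s t. unfold e. rewrite cis_dist_regularized, poisson_ratio by exact Hs.
  assert (N : Cmod (1 - RtoC sg * Cconj (cis s) * cis t) <> 0).
  { apply Rgt_not_eq, Cmod_gt_0, one_sub_neq0.
    rewrite !Cmod_mult, Cmod_conj, Cmod_R, !Cmod_cis, Rabs_pos_eq; lra. }
  field. repeat split; lra || exact N.
Qed.

(** The regularized logarithm is [2 ln |1 - sg conj(cis s) cis t| - ln sg]; the constant is lost
    because the dipole has mass zero. The dipole in [t] evaluates the rest at [b] and [- b], and the
    result is again of this type in [s]. The factor 4 is the 2 of the square times the 2 that the
    difference over [b] and [- b] contributes in the second integration. *)
Lemma Rmean2_circle_log (sg : R) (b : C) : 0 < sg < 1 -> Cmod b < 1 ->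
  let e := (1 - sg) * (1 - sg) / sg in
  let beta := Cmod b * Cmod b in
  Rmean2 (fun s t => ln (Cmod (cis s - cis t) * Cmod (cis s - cis t) + e) * (dipole b s * dipole b t))
  = 4 * (ln (1 - sg * beta) - ln (1 + sg * beta)).
Proof.
intros Hs Hb e beta. pose proof (Cmod_ge_0 b) as Hb0.
pose proof (Rcont_dipole b Hb) as Hu.
assert (Hsm : forall s, Cmod (RtoC sg * Cconj (cis s)) < 1).
{ intros s. rewrite Cmod_mult, Cmod_conj, Cmod_R, Cmod_cis, Rabs_pos_eq; lra. }
assert (Hsb : Cmod (RtoC sg * Cconj b) < 1).
{ rewrite Cmod_mult, Cmod_conj, Cmod_R, Rabs_pos_eq by lra. nra. }
assert (Hsbn : Cmod (- (RtoC sg * Cconj b)) < 1) by now rewrite Cmod_opp.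
assert (Hbeta : 0 <= beta < 1) by (unfold beta; nra).
assert (CL : forall s, Rcont (fun t => ln (Cmod (1 - RtoC sg * Cconj (cis s) * cis t)))).
{ intros s. apply Rcont_ln_linear, Hsm. }
assert (Inner : forall s, Rmean (fun t => ln (Cmod (cis s - cis t) * Cmod (cis s - cis t) + e) * (dipole b s * dipole b t))
  = 2 * (ln (Cmod (1 - (RtoC sg * Cconj b) * cis s)) * dipole b s)
    - 2 * (ln (Cmod (1 - (- (RtoC sg * Cconj b)) * cis s)) * dipole b s)).
{ intros s.
  rewrite (Rmean_ext _ (fun t => 2 * dipole b s * (ln (Cmod (1 - RtoC sg * Cconj (cis s) * cis t)) * dipole b t)
    + - ln sg * dipole b s * dipole b t)).
  - rewrite Rmean_plus, !Rmean_scal, Rmean_dipole, dipole_log_linear; auto using Rcont_mult, Rcont_const.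
    (* Conjugation moves the bar from [cis s] to [b], so that the function is holomorphic in [cis s]
       and the outer mean can be evaluated in the same way. *)
    assert (Cj : forall x y, Cmod (1 - RtoC x * Cconj y * b) = Cmod (1 - RtoC x * Cconj b * y)).
    { intros x y. rewrite <- Cmod_conj. f_equal. rewrite Cminus_conj, !Cmult_conj, Cconj_conj.
      replace (Cconj 1) with (RtoC 1) by (apply injective_projections; simpl; ring).
      replace (Cconj (RtoC x)) with (RtoC x) by (apply injective_projections; simpl; ring). ring. }
    rewrite (Cj sg (cis s)).
    replace (1 + RtoC sg * Cconj (cis s) * b)%C with (1 - RtoC (- sg) * Cconj (cis s) * b)%C
      by (rewrite RtoC_opp; ring).
    rewrite (Cj (- sg) (cis s)).
    replace (1 - RtoC (- sg) * Cconj b * cis s)%C with (1 - - (RtoC sg * Cconj b) * cis s)%C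
      by (rewrite RtoC_opp; ring).
    ring.
  - intros t. unfold e. rewrite cis_dist_regularized by exact Hs.
    assert (N : 0 < Cmod (1 - RtoC sg * Cconj (cis s) * cis t)).
    { apply Cmod_gt_0, one_sub_neq0. rewrite Cmod_mult, Cmod_cis, Rmult_1_r. apply Hsm. }
    unfold Rdiv. rewrite !ln_mult, ln_Rinv by
      (try apply Rmult_lt_0_compat; try apply Rinv_0_lt_compat; lra). ring. }
unfold Rmean2. rewrite (Rmean_ext _ _ Inner).
rewrite Rmean_minus, !Rmean_scal, !dipole_log_linear; auto 6 using Rcont_mult, Rcont_const, Rcont_ln_linear.
assert (Eb : (RtoC sg * Cconj b * b)%C = RtoC (sg * beta)).
{ unfold beta. rewrite RtoC_mult, <- Cmult_assoc. f_equal. rewrite (Cmult_comm (Cconj b)), <- Cmod2_conj.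
  f_equal. ring. }
replace (- (RtoC sg * Cconj b) * b)%C with (- RtoC (sg * beta))%C by (rewrite <- Eb; ring).
rewrite Eb.
assert (Hsbeta : 0 <= sg * beta < 1) by nra.
assert (M1 : Cmod (1 - RtoC (sg * beta)) = 1 - sg * beta).
{ rewrite <- RtoC_minus, Cmod_R. apply Rabs_pos_eq. lra. }
assert (M2 : Cmod (1 + RtoC (sg * beta)) = 1 + sg * beta).
{ rewrite <- RtoC_plus, Cmod_R. apply Rabs_pos_eq. lra. }
replace (1 - - RtoC (sg * beta))%C with (1 + RtoC (sg * beta))%C by ring.
replace (1 + - RtoC (sg * beta))%C with (1 - RtoC (sg * beta))%C by ring.
rewrite M1, M2. ring.
Qed.

Section Energy.
Variables (R0 : R) (G G' : C -> C).
Hypothesis HR : 1 < R0.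
Hypothesis HG : holo_disc R0 G G'.
Hypothesis Ginj : forall z w, Cmod z < R0 -> Cmod w < R0 -> G z = G w -> z = w.
Hypothesis HG0 : forall z, Cmod z < R0 -> G' z <> 0.

Let Q := divq G G'.

(** Injectivity gives this off the diagonal, the nonvanishing derivative on it. This is where
    univalence enters: it makes [ln |Q|] harmonic in each variable. *)
Lemma divq_neq0 (z w : C) : Cmod z < R0 -> Cmod w < R0 -> Q z w <> 0.
Proof.
intros Hz Hw. unfold Q. destruct (Ceq_dec z w) as [->|H].
- rewrite divq_diag. now apply HG0.
- intros E. apply H. apply Ginj; auto.
  pose proof (divq_mult G G' z w) as M. rewrite E in M.
  replace (G z) with ((G z - G w) + G w)%C by ring. rewrite <- M. ring.
Qed.

Let lnQ (s t : R) : R := ln (Cmod (Q (cis s) (cis t))).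

Let cis_in (t : R) : Cmod (cis t) < R0.
Proof. rewrite Cmod_cis. exact HR. Qed.

Lemma Rcont2_lnQ : Rcont2 lnQ.
Proof.
apply Rcont2_ln; [|intros s t; apply Cmod_gt_0, divq_neq0; apply cis_in].
destruct (divq_Lipschitz R0 G G' HG 1 ltac:(lra)) as [L [HL0 HL]].
intros s t eps. assert (He := cond_pos eps).
assert (Hk : 0 < eps / (2 * (L + 1))) by (apply Rdiv_lt_0_compat; lra).
destruct (proj1 (ccont_eps cis s) (ccont_cis s) _ Hk) as [d1 [Hd1 H1]].
destruct (proj1 (ccont_eps cis t) (ccont_cis t) _ Hk) as [d2 [Hd2 H2]].
exists (mkposreal (Rmin d1 d2) (Rmin_pos _ _ Hd1 Hd2)). simpl. intros u v Hu Hv.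
specialize (H1 u ltac:(eapply Rlt_le_trans; [exact Hu|apply Rmin_l])).
specialize (H2 v ltac:(eapply Rlt_le_trans; [exact Hv|apply Rmin_r])).
specialize (HL (cis u) (cis s) (cis v) (cis t)). rewrite !Cmod_cis in HL.
specialize (HL (Rle_refl 1) (Rle_refl 1) (Rle_refl 1) (Rle_refl 1)). fold Q in HL.
apply Rle_lt_trans with (Cmod (Q (cis u) (cis v) - Q (cis s) (cis t))).
- apply Rabs_le. pose proof (Cmod_minus_ge (Q (cis u) (cis v)) (Q (cis s) (cis t))).
  pose proof (Cmod_minus_ge (Q (cis s) (cis t)) (Q (cis u) (cis v))).
  rewrite (Cmod_sub_sym (Q (cis s) (cis t))) in *. lra.
- eapply Rle_lt_trans; [exact HL|].
  apply Rle_lt_trans with ((L + 1) * (Cmod (cis u - cis s) + Cmod (cis v - cis t))).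
  + apply Rmult_le_compat_r; [|lra]. apply Rplus_le_le_0_compat; apply Cmod_ge_0.
  + replace (pos eps) with ((L + 1) * (eps / (2 * (L + 1)) + eps / (2 * (L + 1)))) by (field; lra).
    apply Rmult_lt_compat_l; lra.
Qed.

Lemma dipole_log_divq (b w : C) : Cmod b < 1 -> Cmod w < R0 ->
  Rmean (fun t => ln (Cmod (Q (cis t) w)) * dipole b t) = ln (Cmod (Q b w)) - ln (Cmod (Q (- b)%C w)).
Proof.
intros Hb Hw. destruct (divq_holo R0 G G' HG w Hw) as [q' Hq].
apply (dipole_log R0 (fun z => Q z w) q' b HR Hq); [|exact Hb].
intros z Hz. now apply divq_neq0.
Qed.

Lemma Rcont_lnQ (w : C) : Cmod w < R0 -> Rcont (fun t => ln (Cmod (Q (cis t) w))).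
Proof.
intros Hw. destruct (divq_holo R0 G G' HG w Hw) as [q' Hq].
apply (Rcont_ln_Cmod (fun z => Q z w) R0 q' HR Hq). intros z Hz. now apply divq_neq0.
Qed.

(** The dipole is applied in each variable in turn; the two mixed terms agree by the symmetry of
    [Q]. *)
Lemma Rmean2_lnQ (b : C) : Cmod b < 1 ->
  Rmean2 (fun s t => lnQ s t * (dipole b s * dipole b t))
  = ln (Cmod (Q b b)) + ln (Cmod (Q (- b)%C (- b)%C)) - 2 * ln (Cmod (Q b (- b)%C)).
Proof.
intros Hb. assert (Hb' : Cmod (- b) < 1) by now rewrite Cmod_opp.
pose proof (Rcont_dipole b Hb) as Hu.
assert (Hbi : Cmod b < R0) by lra. assert (Hbi' : Cmod (- b) < R0) by lra.
unfold Rmean2. rewrite (Rmean_ext _ (fun s => ln (Cmod (Q (cis s) b)) * dipole b s - ln (Cmod (Q (cis s) (- b)%C)) * dipole b s)).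
- rewrite Rmean_minus, !dipole_log_divq by auto using Rcont_mult, Rcont_lnQ.
  unfold Q. rewrite (divq_sym G G' (- b) b). ring.
- intros s. rewrite (Rmean_ext _ (fun t => dipole b s * (ln (Cmod (Q (cis t) (cis s))) * dipole b t))).
  + rewrite Rmean_scal, dipole_log_divq by auto using Rcont_mult, Rcont_lnQ.
    unfold Q. rewrite (divq_sym G G' b), (divq_sym G G' (- b)). ring.
  + intros t. unfold lnQ, Q. rewrite (divq_sym G G' (cis s)). ring.
Qed.

(** [2 ln |Q|] is [ln |G z - G w|^2 - ln |z - w|^2]. With both logarithms regularized by the same
    [e], the first has nonpositive mean against the charge by [log_energy_nonpos], and the second is
    known from [Rmean2_circle_log]. *)
Lemma divq_energy (b : C) : Cmod b < 1 ->
  ln (Cmod (Q b b)) + ln (Cmod (Q (- b)%C (- b)%C)) - 2 * ln (Cmod (Q b (- b)%C))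
  <= 2 * (ln (1 + Cmod b * Cmod b) - ln (1 - Cmod b * Cmod b)).
Proof.
intros Hb. rewrite <- Rmean2_lnQ by exact Hb.
pose proof (Cmod_ge_0 b) as Hb0. pose proof two_PI_pos as HP.
pose proof (Rcont_dipole b Hb) as Hu. set (u := dipole b) in *.
set (beta := Cmod b * Cmod b).
assert (Hbeta : 0 <= beta < 1) by (unfold beta; nra).
pose proof Rcont2_lnQ as HQ.
destruct (Rcont2_bounded lnQ 0 (2 * PI) ltac:(lra) HQ) as [B [HB0 HB]].
destruct (Rcont_bounded u 0 (2 * PI) ltac:(lra) Hu) as [U [HU0 HU]].
set (E := exp (2 * B)).
assert (HE : 1 <= E) by (unfold E; pose proof (exp_ineq1_le (2 * B)); lra).
set (d := fun s t => Cmod (cis s - cis t) * Cmod (cis s - cis t)).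
pose proof Rcont2_cis_dist as Hd. fold d in Hd.
pose proof cis_dist_nonneg as Hd0.
set (x := fun t => G (cis t)).
assert (Hx : forall t, ccont x t).
{ intros t. apply (ccont_comp G cis t _ (HG _ (cis_in t)) (ccont_cis t)). }
set (dx := fun s t => Cmod (x s - x t) * Cmod (x s - x t)).
assert (Hdx : Rcont2 dx) by (apply Rcont2_Cmod_sub_sqr; exact Hx).
assert (Cu : Rcont2 (fun s t => u s * u t)) by (repeat Rcont2_step; exact Hu).
assert (Key : forall sg, 0 < sg < 1 -> 2 * Rmean2 (fun s t => lnQ s t * (u s * u t))
  <= 4 * (ln (1 + beta) - ln (1 - beta)) + 4 * E * E * (U * U) * ((1 - sg) / (1 + sg))).
{ intros sg Hsg. set (e := (1 - sg) * (1 - sg) / sg).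
  assert (He : 0 < e) by (apply Rdiv_lt_0_compat; [apply Rmult_lt_0_compat; lra|lra]).
  assert (C1 : Rcont2 (fun s t => ln (dx s t + e) * (u s * u t))).
  { apply Rcont2_mult; [|exact Cu]. apply Rcont2_ln; [apply Rcont2_plus; [exact Hdx|apply Rcont2_const]|].
    intros s t. assert (0 <= dx s t) by (apply Rmult_le_pos; apply Cmod_ge_0). lra. }
  assert (C3 : Rcont2 (fun s t => ln (d s t + e) * (u s * u t))).
  { apply Rcont2_mult; [|exact Cu]. apply Rcont2_ln; [apply Rcont2_plus; [exact Hd|apply Rcont2_const]|].
    intros s t. specialize (Hd0 s t). unfold d. lra. }
  assert (C4 : Rcont2 (fun s t => e / (d s t + e))).
  { unfold Rdiv. apply Rcont2_mult; [apply Rcont2_const|]. apply Rcont2_inv; [apply Rcont2_plus; [exact Hd|apply Rcont2_const]|].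
    intros s t. specialize (Hd0 s t). unfold d. lra. }
  assert (C5 : Rcont2 (fun s t => lnQ s t * (u s * u t))) by now apply Rcont2_mult.
  pose proof (log_energy_nonpos x u e Hx Hu (Rmean_dipole b Hb) He) as E1.
  change (Rmean2 (fun s t => ln (dx s t + e) * (u s * u t)) <= 0) in E1.
  pose proof (Rmean2_circle_log sg b Hsg Hb) as E2. cbv zeta in E2.
  change (Rmean2 (fun s t => ln (d s t + e) * (u s * u t)) = 4 * (ln (1 - sg * beta) - ln (1 + sg * beta))) in E2.
  pose proof (Rmean2_circle_ratio sg Hsg) as E3. cbv zeta in E3.
  change (Rmean2 (fun s t => e / (d s t + e)) = (1 - sg) / (1 + sg)) in E3.
  assert (Bd : Rmean2 (fun s t => 2 * (lnQ s t * (u s * u t)))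
    <= Rmean2 (fun s t => ln (dx s t + e) * (u s * u t) - ln (d s t + e) * (u s * u t)
                      + 4 * E * E * (U * U) * (e / (d s t + e)))).
  { apply Rmean2_le.
    - apply Rcont2_mult; [apply Rcont2_const|exact C5].
    - apply Rcont2_plus; [now apply Rcont2_minus|]. apply Rcont2_mult; [apply Rcont2_const|exact C4].
    (* [K = |Q|^2] is the ratio of the squared distances of the images and of the points. As an
       exponential it is bounded by [E = exp (2 B)] together with its inverse, also where the points
       coincide. *)
    - intros s t Hs Ht. set (K := exp (2 * lnQ s t)).
      assert (EK : K = Cmod (Q (cis s) (cis t)) * Cmod (Q (cis s) (cis t))).
      { unfold K, lnQ. replace (2 * ln (Cmod (Q (cis s) (cis t))))
          with (ln (Cmod (Q (cis s) (cis t))) + ln (Cmod (Q (cis s) (cis t)))) by ring.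
        rewrite exp_plus, exp_ln; [reflexivity|]. apply Cmod_gt_0, divq_neq0; apply cis_in. }
      assert (Edx : dx s t = K * d s t).
      { unfold dx, d, x. rewrite <- (divq_mult G G'), Cmod_mult. fold Q. rewrite EK. ring. }
      pose proof (HB s t Hs Ht) as HBst. apply Rabs_le_between in HBst.
      assert (R : Rabs (ln K - (ln (K * d s t + e) - ln (d s t + e))) <= 4 * E * E * (e / (d s t + e))).
      { apply ln_regularization; auto.
        - apply exp_pos.
        - unfold K, E. destruct (Req_dec (lnQ s t) B) as [->|]; [lra|].
          apply Rlt_le, exp_increasing. lra.
        - unfold K, E. rewrite <- exp_Ropp. destruct (Req_dec (- (2 * lnQ s t)) (2 * B)) as [->|]; [lra|].
          apply Rlt_le, exp_increasing. lra.
        - apply Hd0. }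
      unfold K in R at 1. rewrite ln_exp in R. rewrite <- Edx in R.
      assert (BU : Rabs (u s * u t) <= U * U).
      { rewrite Rabs_mult. apply Rmult_le_compat; auto using Rabs_pos. }
      assert (B2 : Rabs ((2 * lnQ s t - (ln (dx s t + e) - ln (d s t + e))) * (u s * u t))
                   <= 4 * E * E * (e / (d s t + e)) * (U * U)).
      { rewrite Rabs_mult. apply Rmult_le_compat; auto using Rabs_pos. }
      apply Rabs_le_between in B2. lra. }
  rewrite Rmean2_scal, Rmean2_plus, Rmean2_minus, Rmean2_scal, E2, E3 in Bd;
    [|exact C4|exact C1|exact C3|now apply Rcont2_minus|apply Rcont2_mult; [apply Rcont2_const|exact C4]|exact C5].
  (* Monotonicity replaces [sg] by 1 in the energy of the circle, so only the error term requires a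
     limit. *)
  assert (L1 : ln (1 - beta) <= ln (1 - sg * beta)) by (apply ln_le; nra).
  assert (L2 : ln (1 + sg * beta) <= ln (1 + beta)) by (apply ln_le; nra).
  lra. }
(* [Key] is used at [sg = 1 - h], where [(1 - sg) / (1 + sg) = h / (2 - h)] is at most [h]. *)
apply Rmult_le_reg_l with 2; [lra|]. apply le_epsilon. intros eps Heps.
set (k := 4 * E * E * (U * U) + 1).
assert (Hk : 0 < k).
{ unfold k. assert (0 <= 4 * E * E * (U * U)) by (repeat apply Rmult_le_pos; lra). lra. }
set (h := Rmin (/ 2) (eps / k)).
assert (Hh : 0 < h <= / 2).
{ split; [apply Rmin_pos; [lra|now apply Rdiv_lt_0_compat]|apply Rmin_l]. }
assert (Hhk : h * k <= eps).
{ apply Rmin_div_mult. lra. }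
specialize (Key (1 - h) ltac:(lra)).
assert (Hr : (1 - (1 - h)) / (1 + (1 - h)) <= h).
{ apply Rle_div_l; [lra|]. nra. }
assert (Hr0 : 0 <= (1 - (1 - h)) / (1 + (1 - h))) by (apply Rdiv_le_0_compat; lra).
assert (M : 4 * E * E * (U * U) * ((1 - (1 - h)) / (1 + (1 - h))) <= k * h).
{ apply Rmult_le_compat; [repeat apply Rmult_le_pos; lra|exact Hr0|unfold k; lra|exact Hr]. }
lra.
Qed.
End Energy.

(** * Growth and distortion of univalent functions *)

Lemma Csqrt_exists (z : C) : exists t, (t * t)%C = z.
Proof.
set (r := Cmod z). set (x := Re z). set (y := Im z).
assert (Hr : r * r = x * x + y * y) by apply Cmod_sqr.
pose proof (re_le_Cmod z) as Hx. fold x r in Hx. apply Rabs_le_between in Hx.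
set (a := sqrt ((r + x) / 2)). set (b := sqrt ((r - x) / 2)).
assert (Ha : a * a = (r + x) / 2) by (apply sqrt_sqrt; lra).
assert (Hb : b * b = (r - x) / 2) by (apply sqrt_sqrt; lra).
assert (Hab : a * b = Rabs y / 2).
{ unfold a, b. rewrite <- sqrt_mult by lra.
  replace ((r + x) / 2 * ((r - x) / 2)) with (Rsqr (y / 2)).
  - rewrite sqrt_Rsqr_abs. unfold Rdiv. rewrite Rabs_mult, (Rabs_pos_eq (/ 2)) by lra. reflexivity.
  - unfold Rsqr. nra. }
destruct (Rle_lt_dec 0 y) as [Hy|Hy].
- exists (a, b). rewrite Rabs_pos_eq in Hab by exact Hy.
  rewrite (surjective_pairing z). apply injective_projections; simpl; unfold x, y, Re, Im in *; lra.
- exists (a, - b). rewrite Rabs_left in Hab by exact Hy.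
  rewrite (surjective_pairing z). apply injective_projections; simpl; unfold x, y, Re, Im in *; lra.
Qed.

Lemma Csqr_eq (z w : C) : (z * z)%C = (w * w)%C -> z = w \/ z = (- w)%C.
Proof.
intros H. destruct (Ceq_dec z w) as [E|E]; [now left|right].
pose proof (Csub_neq0 z w E) as N.
assert (P : ((z - w) * (z + w))%C = 0).
{ transitivity (z * z - w * w)%C; [ring|]. rewrite H. ring. }
destruct (Ceq_dec (z + w) 0) as [E2|E2].
- replace z with (z + w - w)%C by ring. rewrite E2. ring.
- exfalso. exact (Cmult_neq_0 _ _ N E2 P).
Qed.

(** Removes the dilation by [r]. The value [r = sqrt (1 - h)] makes [r * r = 1 - h], so the limit
    becomes linear in [h]. *)
Lemma le_of_scaled_limit (X tau : R) :
  0 <= X -> (forall r, 0 < r -> tau < r * r < 1 -> X * (r * r - tau) <= r * r + tau) -> 0 <= tau < 1 ->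
  X * (1 - tau) <= 1 + tau.
Proof.
intros HX H Ht. apply le_epsilon. intros eps He.
set (h := Rmin ((1 - tau) / 2) (eps / (X + 1))).
assert (Hh : 0 < h).
{ apply Rmin_pos; [lra|]. apply Rdiv_lt_0_compat; lra. }
assert (H1 : h <= (1 - tau) / 2) by apply Rmin_l.
assert (H2 : h * (X + 1) <= eps).
{ apply Rmin_div_mult. lra. }
assert (Hs : sqrt (1 - h) * sqrt (1 - h) = 1 - h) by (apply sqrt_sqrt; lra).
specialize (H (sqrt (1 - h))). rewrite Hs in H. specialize (H ltac:(apply sqrt_lt_R0; lra) ltac:(lra)).
nra.
Qed.

Section Schlicht.
Variables f f' : C -> C.
Hypothesis Hf : holo_disc 1 f f'.
Hypothesis f0 : f 0 = 0.
Hypothesis f'0 : f' 0 = 1.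
Hypothesis finj : forall z w, Cmod z < 1 -> Cmod w < 1 -> f z = f w -> z = w.
Hypothesis f'n : forall z, Cmod z < 1 -> f' z <> 0.

Let Cmod00 : Cmod 0 < 1.
Proof. rewrite Cmod_0. lra. Qed.

Let Cmod_square_lt (z : C) : Cmod z < 1 -> Cmod (z * z) < 1.
Proof. intros Hz. rewrite Cmod_mult. pose proof (Cmod_ge_0 z). nra. Qed.

Lemma schlicht_neq0 (z : C) : Cmod z < 1 -> z <> 0 -> f z <> 0.
Proof. intros Hz Hn E. apply Hn. apply finj; auto. now rewrite f0. Qed.

(** Write [f z = z H z] with [H] free of zeros. The function [g z = z exp (L (z^2) / 2)], with [L] a
    logarithm of [H], is odd because the exponential depends on [z^2] only. The last property is
    half the derivative of [g^2 = f (z^2)]. *)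
Lemma odd_sqrt_transform : exists g g' : C -> C,
  holo_disc 1 g g' /\
  (forall z, Cmod z < 1 -> (g z * g z)%C = f (z * z)%C) /\
  (forall z, g (- z)%C = (- g z)%C) /\
  (forall z w, Cmod z < 1 -> Cmod w < 1 -> g z = g w -> z = w) /\
  (forall z, Cmod z < 1 -> g' z <> 0) /\
  (forall z, Cmod z < 1 -> (g z * g' z)%C = (z * f' (z * z)%C)%C).
Proof.
destruct (divq_holo 1 f f' Hf 0 Cmod00) as [H' HH].
set (H := fun z => divq f f' z 0) in *.
assert (Hn : forall z, Cmod z < 1 -> H z <> 0).
{ intros z Hz. apply (divq_neq0 1 f f'); auto. }
assert (H0 : H 0 = 1) by (unfold H; now rewrite divq_diag).
assert (HfH : forall z, f z = (z * H z)%C).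
{ intros z. pose proof (divq_mult f f' z 0) as M. fold (H z) in M. rewrite f0 in M.
  transitivity (f z - 0)%C; [ring|]. rewrite <- M. ring. }
destruct (holo_log 1 H H' Rlt_0_1 HH Hn) as (L & L' & HL & EL).
assert (EL' : forall z, Cmod z < 1 -> H z = cexp (L z)).
{ intros z Hz. rewrite (EL z Hz), H0. ring. }
set (k := fun z : C => cexp (/ 2 * L (z * z)%C)).
set (k' := fun z : C => ((/ 2 * ((1 * z + z * 1) * L' (z * z)%C)) * k z)%C).
assert (Hk : holo_disc 1 k k').
{ intros z Hz. unfold k', k. eapply has_cderiv_eq.
  - apply (has_cderiv_comp cexp (fun z : C => / 2 * L (z * z)%C)%C); [apply has_cderiv_cexp|].
    apply has_cderiv_scal, (has_cderiv_comp L (fun z : C => z * z)%C); [now apply HL, Cmod_square_lt|].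
    apply has_cderiv_mult; apply has_cderiv_id.
  - reflexivity. }
set (g := fun z : C => (z * k z)%C). set (g' := fun z : C => (1 * k z + z * k' z)%C).
assert (Hg : holo_disc 1 g g').
{ intros z Hz. apply has_cderiv_mult; [apply has_cderiv_id|now apply Hk]. }
assert (Hgg : forall z, Cmod z < 1 -> (g z * g z)%C = f (z * z)%C).
{ intros z Hz. rewrite HfH, EL' by now apply Cmod_square_lt. unfold g, k.
  transitivity (z * z * (cexp (/ 2 * L (z * z)%C) * cexp (/ 2 * L (z * z)%C)))%C; [ring|].
  rewrite <- cexp_plus. do 2 f_equal. field. }
assert (Hodd : forall z, g (- z)%C = (- g z)%C).
{ intros z. unfold g, k. replace (- z * - z)%C with (z * z)%C by ring. ring. }
assert (Hg0 : forall z, Cmod z < 1 -> g z = 0 -> z = 0).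
{ intros z _ E. destruct (Ceq_dec z 0) as [|N]; [assumption|exfalso].
  exact (Cmult_neq_0 _ _ N (cexp_neq0 _) E). }
assert (Hgg' : forall z, Cmod z < 1 -> (g z * g' z)%C = (z * f' (z * z)%C)%C).
{ intros z Hz.
  assert (D : (g' z * g z + g z * g' z)%C = ((1 * z + z * 1) * f' (z * z)%C)%C).
  { apply (has_cderiv_unique (fun z => g z * g z)%C z).
    - apply has_cderiv_mult; now apply Hg.
    - apply (has_cderiv_ext_loc (fun z => f (z * z)%C) _ _ _ (1 - Cmod z)); [lra| |].
      + intros w Hw. symmetry. apply Hgg. pose proof (Cmod_minus_ge w z). lra.
      + apply (has_cderiv_comp f (fun z : C => z * z)%C); [now apply Hf, Cmod_square_lt|].
        apply has_cderiv_mult; apply has_cderiv_id. }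
  transitivity (/ 2 * (g' z * g z + g z * g' z))%C; [field|]. rewrite D. field. }
exists g, g'. split; [exact Hg|]. split; [exact Hgg|]. split; [exact Hodd|].
split; [|split; [|exact Hgg']].
- intros z w Hz Hw E.
  (* Squaring gives [f (z^2) = f (w^2)], hence [z = w] or [z = - w]. In the second case oddness
     yields [g w = - g w], so both points are 0. *)
  destruct (Csqr_eq z w) as [E2|E2]; [|exact E2|].
  + apply finj; auto. now rewrite <- !Hgg, E by assumption.
  + assert (Z : g w = 0).
    { assert (E3 : g w = (- g w)%C) by (rewrite <- Hodd, <- E2; now symmetry).
      transitivity (/ 2 * (g w + g w))%C; [field|]. rewrite E3 at 2. field. }
    apply Hg0 in Z; [|exact Hw]. subst z. rewrite Z. ring.
- intros z Hz E. destruct (Ceq_dec z 0) as [->|N].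
  + unfold g' in E. apply (cexp_neq0 (/ 2 * L (0 * 0)%C)). fold (k 0).
    transitivity (1 * k 0 + 0 * k' 0)%C; [ring|exact E].
  + specialize (Hgg' z Hz). rewrite E in Hgg'.
    apply (Cmult_neq_0 _ _ N (f'n _ (Cmod_square_lt z Hz))). rewrite <- Hgg'. ring.
Qed.

(** Let [z = t^2]. [divq_energy] is applied to [G w = g (r w)] at [b = t / r]. As [g] is odd, the
    quotient at [b] and [- b] is [r g t / t], and [|G'|] takes the value [r |g' t|] at both points;
    so the energy is [2 ln X] with [X = |t g' t / g t|], free of [r]. Finally
    [t g' t / g t = z f' z / f z], and [r] tends to 1. *)
Lemma schlicht_log_derivative_bound (z : C) : Cmod z < 1 ->
  Cmod z * Cmod (f' z) * (1 - Cmod z) <= Cmod (f z) * (1 + Cmod z).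
Proof.
intros Hz. destruct (Ceq_dec z 0) as [->|Hz0].
{ rewrite f0, Cmod_0. lra. }
destruct odd_sqrt_transform as (g & g' & Hg & Hgg & Hodd & Hinj & Hg'n & Hgg').
destruct (Csqrt_exists z) as [t Ht]. subst z.
assert (Ht0 : t <> 0).
{ intros ->. apply Hz0. ring. }
assert (Ett : Cmod (t * t) = Cmod t * Cmod t) by apply Cmod_mult.
pose proof (proj1 (Cmod_gt_0 t) Ht0) as Htp.
assert (Ht1 : Cmod t < 1) by nra.
set (tau := Cmod t * Cmod t) in *.
assert (Htau : 0 < tau < 1) by (unfold tau in *; nra).
assert (Ht1' : Cmod (- t) < 1) by now rewrite Cmod_opp.
assert (Hgt0 : g t <> 0).
{ intros E. pose proof (Hgg t Ht1) as P. rewrite E in P. apply (schlicht_neq0 (t * t)%C); auto.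
  rewrite <- P. ring. }
pose proof (proj1 (Cmod_gt_0 _) Hgt0) as Hgp.
pose proof (proj1 (Cmod_gt_0 _) (Hg'n t Ht1)) as Hg'p.
(* Read off from [g z * g' z = z f' (z^2)]: replacing [t] by [- t] changes the sign of the right
   side and of [g]. *)
assert (Eg' : Cmod (g' (- t)%C) = Cmod (g' t)).
{ pose proof (Hgg' t Ht1) as E1. pose proof (Hgg' (- t)%C Ht1') as E2.
  rewrite Hodd in E2. replace (- t * - t)%C with (t * t)%C in E2 by ring.
  apply (Rmult_eq_reg_l (Cmod (g t))); [|lra]. rewrite <- !Cmod_mult, E1.
  replace (t * f' (t * t)%C)%C with (- (- t * f' (t * t)%C))%C by ring. rewrite <- E2.
  f_equal. ring. }
set (X := Cmod t * Cmod (g' t) / Cmod (g t)).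
assert (HX : X * (1 - tau) <= 1 + tau).
{ apply le_of_scaled_limit; [apply Rdiv_le_0_compat; [apply Rmult_le_pos; lra|lra]| |lra].
  intros r Hr [Hr1 Hr2].
  assert (Hr3 : r < 1) by nra.
  assert (Htr : Cmod t < r) by (unfold tau in *; nra).
  assert (Hrn : RtoC r <> 0) by (intros E; apply RtoC_inj in E; lra).
  assert (Hin : forall w, Cmod w < / r -> Cmod (RtoC r * w) < 1).
  { intros w Hw. rewrite Cmod_mult, Cmod_R, Rabs_pos_eq by lra.
    apply Rmult_lt_compat_l with (r := r) in Hw; [|exact Hr]. rewrite Rinv_r in Hw by lra. exact Hw. }
  set (G := fun w => g (RtoC r * w)%C). set (G' := fun w => (RtoC r * g' (RtoC r * w))%C).
  assert (HR : 1 < / r).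
  { rewrite <- Rinv_1. apply Rinv_lt_contravar; lra. }
  assert (HG : holo_disc (/ r) G G').
  { intros w Hw. unfold G, G'. eapply has_cderiv_eq.
    - apply (has_cderiv_comp g (fun w => RtoC r * w)%C); [now apply Hg, Hin|].
      apply has_cderiv_scal, has_cderiv_id.
    - ring. }
  assert (HGi : forall z w, Cmod z < / r -> Cmod w < / r -> G z = G w -> z = w).
  { intros z w Hz' Hw' E. apply Hinj in E; auto.
    transitivity (/ RtoC r * (RtoC r * z))%C; [field; exact Hrn|]. rewrite E. field. exact Hrn. }
  assert (HGn : forall w, Cmod w < / r -> G' w <> 0).
  { intros w Hw. apply Cmult_neq_0; auto. }
  set (b := (t / RtoC r)%C).
  assert (Hb : Cmod b = Cmod t / r).
  { unfold b. rewrite Cmod_div, Cmod_R, Rabs_pos_eq by (auto; lra). reflexivity. }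
  assert (Hb1 : Cmod b < 1) by (rewrite Hb; apply Rlt_div_l; lra).
  assert (Erb : (RtoC r * b)%C = t) by (unfold b; field; exact Hrn).
  assert (Erb' : (RtoC r * - b)%C = (- t)%C) by (rewrite <- Erb; ring).
  pose proof (divq_energy (/ r) G G' HR HG HGi HGn b Hb1) as E.
  rewrite !divq_diag in E.
  assert (Ebb : b <> (- b)%C).
  { intros H. apply Ht0. rewrite <- Erb. replace b with (/ 2 * (b + b))%C by field.
    rewrite H at 2. ring. }
  rewrite (divq_neq G G' b (- b) Ebb) in E. unfold G, G' in E. rewrite Erb, Erb', Hodd in E.
  replace ((g t - - g t) / (b - - b))%C with (RtoC r * (g t / t))%C in E.
  2:{ unfold b. field. split; [exact Hrn|split; [|exact Ht0]]. intros E3. apply Ht0.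
      replace t with (/ 2 * (t - - t))%C by field. rewrite E3. ring. }
  rewrite !Cmod_mult, Cmod_div, Eg', Hb, Cmod_R, Rabs_pos_eq in E by (auto; lra).
  replace (Cmod t / r * (Cmod t / r)) with (tau / (r * r)) in E by (unfold tau; field; lra).
  assert (Hrr : 0 < r * r) by nra.
  assert (Hbeta : 0 < tau / (r * r) < 1).
  { split; [apply Rdiv_lt_0_compat; lra|apply Rlt_div_l; lra]. }
  assert (HXln : ln X <= ln ((1 + tau / (r * r)) / (1 - tau / (r * r)))).
  { unfold X, Rdiv at 1 2. unfold Rdiv in E.
    rewrite !ln_mult, !ln_Rinv in *; try apply Rinv_0_lt_compat; try apply Rmult_lt_0_compat;
      try apply Rinv_0_lt_compat; try lra; unfold Rdiv in *; lra. }
  assert (HX1 : X <= (1 + tau / (r * r)) / (1 - tau / (r * r))).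
  { apply Rnot_lt_le. intros Hlt. apply ln_increasing in Hlt; [lra|].
    apply Rdiv_lt_0_compat; lra. }
  apply Rmult_le_compat_r with (r := r * r - tau) in HX1; [|lra].
  replace ((1 + tau / (r * r)) / (1 - tau / (r * r)) * (r * r - tau)) with (r * r + tau) in HX1.
  - exact HX1.
  - field. split; lra. }
rewrite <- Hgg by exact Ht1. rewrite Ett, Cmod_mult.
assert (E2 : Cmod t * Cmod (f' (t * t)%C) = Cmod (g t) * Cmod (g' t)).
{ rewrite <- !Cmod_mult. f_equal. symmetry. now apply Hgg'. }
replace (tau * Cmod (f' (t * t)%C) * (1 - tau)) with (Cmod (g t) * Cmod (g t) * (X * (1 - tau))).
- apply Rmult_le_compat_l; [nra|exact HX].
- unfold tau at 2. replace (Cmod t * Cmod t * Cmod (f' (t * t)%C)) with (Cmod t * (Cmod (g t) * Cmod (g' t)))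
    by (rewrite <- E2; ring).
  unfold X. field. lra.
Qed.
End Schlicht.

Lemma nonincreasing_of_derive (m dm : R -> R) (a b : R) :
  a <= b -> (forall t, a <= t <= b -> is_derive m t (dm t)) ->
  (forall t, a <= t <= b -> dm t <= 0) -> m b <= m a.
Proof.
intros Hab Hm Hd.
destruct (MVT_gen m a b dm) as [c [Hc E]]; rewrite ?Rmin_left, ?Rmax_right in * by exact Hab.
- intros x Hx. apply Hm. lra.
- intros x Hx. apply continuity_pt_filterlim, (ex_derive_continuous (V := R_NormedModule) m).
  exists (dm x). now apply Hm.
- specialize (Hd c Hc). nra.
Qed.

Lemma is_derive_Cmod_sqr (F : R -> C) (t : R) (l : C) : cder F t l ->
  is_derive (fun r => Cmod (F r) * Cmod (F r)) t (2 * (Re (F t) * Re l + Im (F t) * Im l)).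
Proof.
intros [H1 H2].
apply (is_derive_ext (fun r => Re (F r) * Re (F r) + Im (F r) * Im (F r))).
{ intros r. now rewrite Cmod_sqr. }
pose proof (is_derive_mult (K := R_AbsRing) _ _ t _ _ H1 H1 Rmult_comm) as D1.
pose proof (is_derive_mult (K := R_AbsRing) _ _ t _ _ H2 H2 Rmult_comm) as D2.
pose proof (is_derive_plus (V := R_NormedModule) _ _ t _ _ D1 D2) as D.
match type of D with is_derive _ _ ?x => replace (2 * (Re (F t) * Re l + Im (F t) * Im l)) with x end.
- exact D.
- unfold plus, mult; simpl. unfold mult; simpl. ring.
Qed.

Lemma Re_Im_le_Cmod (z w : C) : Re z * Re w + Im z * Im w <= Cmod z * Cmod w.
Proof.
pose proof (re_le_Cmod (z * Cconj w)) as H. rewrite Cmod_mult, Cmod_conj in H.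
eapply Rle_trans; [|exact H]. eapply Rle_trans; [|apply Rle_abs]. unfold Re, Im. simpl. lra.
Qed.

Section Growth.
Variables f f' : C -> C.
Hypothesis Hf : holo_disc 1 f f'.
Hypothesis f0 : f 0 = 0.
Hypothesis f'0 : f' 0 = 1.
Hypothesis Hlog : forall z, Cmod z < 1 ->
  Cmod z * Cmod (f' z) * (1 - Cmod z) <= Cmod (f z) * (1 + Cmod z).

(* [|f (t e)| (1 - t)^2 / t] is nonincreasing on rays and tends to [1] at the origin. *)
Lemma growth_bound (z : C) : Cmod z < 1 -> Cmod (f z) * ((1 - Cmod z) * (1 - Cmod z)) <= Cmod z.
Proof.
intros Hz. destruct (Ceq_dec z 0) as [->|Hz0].
{ rewrite f0, Cmod_0. lra. }
pose proof (proj1 (Cmod_gt_0 z) Hz0) as Hp. set (r := Cmod z) in *.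
assert (Hrn : RtoC r <> 0) by (intros E; apply RtoC_inj in E; lra).
set (e := (z / RtoC r)%C).
assert (He : Cmod e = 1).
{ unfold e. rewrite Cmod_div, Cmod_R, Rabs_pos_eq by (auto; lra). fold r. field. lra. }
assert (Ez : (0 + RtoC r * e)%C = z) by (unfold e; field; exact Hrn).
set (F := fun t : R => f (0 + RtoC t * e)%C).
assert (HFm : forall t, 0 <= t -> Cmod (0 + RtoC t * e) = t).
{ intros t Ht. rewrite Cplus_0_l, Cmod_mult, He, Cmod_R, Rabs_pos_eq; lra. }
assert (HF : forall t, 0 <= t < 1 -> cder F t (f' (0 + RtoC t * e)%C * e)%C).
{ intros t Ht. apply (cder_comp f); [|apply cder_line]. apply Hf. rewrite HFm; lra. }
(* The monotone quantity is squared, because [|F|^2] is differentiable without any condition on the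
   zeros of [F]. *)
set (w := fun t => (1 - t) ^ 4 / t ^ 2).
assert (Hw : forall t, 0 < t -> is_derive w t (- (2 * (1 - t) ^ 3 * (1 + t) / t ^ 3))).
{ intros t Ht. unfold w. auto_derive; [repeat split; lra || (apply Rgt_not_eq; nra)|]. field. lra. }
set (m := fun t => Cmod (F t) * Cmod (F t) * w t).
assert (Hm : forall t0, 0 < t0 <= r -> m r <= m t0).
{ intros t0 Ht0.
  apply (nonincreasing_of_derive m (fun t =>
    2 * (Re (F t) * Re (f' (0 + RtoC t * e)%C * e)%C + Im (F t) * Im (f' (0 + RtoC t * e)%C * e)%C) * w t
    + Cmod (F t) * Cmod (F t) * (- (2 * (1 - t) ^ 3 * (1 + t) / t ^ 3)))); [lra| |].
  - intros t Ht. pose proof (is_derive_Cmod_sqr F t _ (HF t ltac:(lra))) as D1.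
    exact (is_derive_mult (K := R_AbsRing) _ _ t _ _ D1 (Hw t ltac:(lra)) Rmult_comm).
  - intros t Ht.
    pose proof (Re_Im_le_Cmod (F t) (f' (0 + RtoC t * e)%C * e)) as B.
    rewrite Cmod_mult, He, Rmult_1_r in B.
    pose proof (Hlog (0 + RtoC t * e) ltac:(rewrite HFm; lra)) as B2. rewrite HFm in B2 by lra.
    fold (F t) in B2. set (X := Cmod (F t)) in *. set (Y := Cmod (f' (0 + RtoC t * e)%C)) in *.
    set (S := Re (F t) * Re (f' (0 + RtoC t * e)%C * e)%C + Im (F t) * Im (f' (0 + RtoC t * e)%C * e)%C) in *.
    assert (HX : 0 <= X) by apply Cmod_ge_0.
    (* A nonnegative factor times a bracket; [S <= X * Y] by the Cauchy-Schwarz inequality, and then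
       [Hlog] makes the bracket nonpositive. *)
    replace (2 * S * w t + X * X * (- (2 * (1 - t) ^ 3 * (1 + t) / t ^ 3)))
      with (2 * (1 - t) ^ 3 / t ^ 3 * (t * S * (1 - t) - X * X * (1 + t)))
      by (unfold w; field; lra).
    assert (P : 0 <= 2 * (1 - t) ^ 3 / t ^ 3).
    { apply Rdiv_le_0_compat; [|apply pow_lt; lra]. apply Rmult_le_pos; [lra|apply pow_le; lra]. }
    assert (N : t * S * (1 - t) - X * X * (1 + t) <= 0).
    { assert (t * S * (1 - t) <= t * (X * Y) * (1 - t)).
      { apply Rmult_le_compat_r; [lra|]. apply Rmult_le_compat_l; lra. }
      assert (X * (t * Y * (1 - t)) <= X * (X * (1 + t))) by (apply Rmult_le_compat_l; lra). nra. }
    nra. }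
assert (Hle1 : Cmod (F r) * ((1 - r) * (1 - r)) / r <= 1).
{ apply le_epsilon. intros eps Heps.
  destruct (proj1 (has_cderiv_eps f 0 _) (Hf 0 ltac:(rewrite Cmod_0; lra)) eps Heps) as [d [Hd Hfd]].
  set (t0 := Rmin (d / 2) r). assert (Ht0 : 0 < t0 <= r) by (split; [apply Rmin_pos; lra|apply Rmin_r]).
  assert (Ht0d : t0 < d) by (apply Rle_lt_trans with (d / 2); [apply Rmin_l|lra]).
  assert (B : Cmod (F t0) <= (1 + eps) * t0).
  { set (u := (0 + RtoC t0 * e)%C). assert (Eu : Cmod u = t0) by (apply HFm; lra).
    specialize (Hfd u). replace (u - 0)%C with u in Hfd by ring. specialize (Hfd ltac:(lra)).
    rewrite f0, f'0, Eu in Hfd. unfold F. fold u.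
    replace (f u) with ((f u - 0 - 1 * u) + u)%C by ring.
    eapply Rle_trans; [apply Cmod_triangle|]. rewrite Eu. lra. }
  specialize (Hm t0 Ht0). unfold m in Hm.
  assert (B2 : Cmod (F t0) * Cmod (F t0) * w t0 <= (1 + eps) * (1 + eps)).
  { unfold w.
    apply Rle_trans with ((1 + eps) * t0 * ((1 + eps) * t0) * (1 / t0 ^ 2)).
    - apply Rmult_le_compat.
      + apply Rmult_le_pos; apply Cmod_ge_0.
      + apply Rdiv_le_0_compat; [apply pow_le; lra|apply pow_lt; lra].
      + apply Rmult_le_compat; auto using Cmod_ge_0.
      + apply Rmult_le_compat_r; [apply Rlt_le, Rinv_0_lt_compat, pow_lt; lra|].
        rewrite <- (pow1 4). apply pow_incr. lra.
    - apply Req_le. field. lra. }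
  set (n := Cmod (F r) * ((1 - r) * (1 - r)) / r).
  assert (En : Cmod (F r) * Cmod (F r) * w r = n * n) by (unfold n, w; field; lra).
  rewrite En in Hm.
  apply Rnot_lt_le. intros Hlt. assert ((1 + eps) * (1 + eps) < n * n) by nra. lra. }
apply Rmult_le_compat_r with (r := r) in Hle1; [|lra].
replace (Cmod (F r) * ((1 - r) * (1 - r)) / r * r) with (Cmod (F r) * ((1 - r) * (1 - r))) in Hle1 by (field; lra).
unfold F in Hle1. rewrite Ez in Hle1. lra.
Qed.

(** The bound of the logarithmic derivative times the growth bound; the common factor [|z|]
    cancels. *)
Lemma distortion_bound (z : C) : Cmod z < 1 ->
  Cmod (f' z) * ((1 - Cmod z) * (1 - Cmod z) * (1 - Cmod z)) <= 1 + Cmod z.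
Proof.
intros Hz. destruct (Ceq_dec z 0) as [->|Hz0].
{ rewrite f'0, Cmod_0, Cmod_1. lra. }
pose proof (proj1 (Cmod_gt_0 z) Hz0) as Hp.
pose proof (growth_bound z Hz) as B1. pose proof (Hlog z Hz) as B2.
set (r := Cmod z) in *. set (Y := Cmod (f' z)) in *. set (X := Cmod (f z)) in *.
apply (Rmult_le_reg_l r); [exact Hp|].
apply Rle_trans with (X * (1 + r) * ((1 - r) * (1 - r))).
- replace (r * (Y * ((1 - r) * (1 - r) * (1 - r)))) with (r * Y * (1 - r) * ((1 - r) * (1 - r))) by ring.
  apply Rmult_le_compat_r; [nra|exact B2].
- replace (X * (1 + r) * ((1 - r) * (1 - r))) with (X * ((1 - r) * (1 - r)) * (1 + r)) by ring.
  apply Rmult_le_compat_r; lra.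
Qed.
End Growth.

(** * The radius *)

Lemma exists_aligning (a b : C) : exists lam, Cmod lam = 1 /\ Cmod (a + lam * b) = Cmod a + Cmod b.
Proof.
destruct (Ceq_dec b 0) as [->|Nb].
{ exists 1. split; [apply Cmod_1|]. rewrite Cmod_0, Rplus_0_r. f_equal. ring. }
destruct (Ceq_dec a 0) as [->|Na].
{ exists 1. split; [apply Cmod_1|]. rewrite Cmod_0, Rplus_0_l. f_equal. ring. }
pose proof (proj1 (Cmod_gt_0 a) Na) as Ha. pose proof (proj1 (Cmod_gt_0 b) Nb) as Hb.
assert (Ra : RtoC (Cmod a) <> 0) by (intros E; apply RtoC_inj in E; lra).
(* The quotient of the directions of [a] and [b], so that [lam * b] is a positive multiple of
   [a]. *)
exists (a / b * RtoC (Cmod b / Cmod a))%C. split.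
- rewrite Cmod_mult, Cmod_div, Cmod_R, Rabs_pos_eq by (auto; apply Rlt_le, Rdiv_lt_0_compat; lra).
  field. lra.
- replace (a + a / b * RtoC (Cmod b / Cmod a) * b)%C with (a * RtoC (1 + Cmod b / Cmod a))%C
    by (rewrite RtoC_plus; field; exact Nb).
  assert (P : 0 < Cmod b / Cmod a) by (apply Rdiv_lt_0_compat; lra).
  rewrite Cmod_mult, Cmod_R, Rabs_pos_eq by lra. field. lra.
Qed.

(** * Bounds for stable harmonic mappings *)

Section Stable.
Variables h h' g g' : C -> C.
Hypothesis Hst : stable_SH0 h h' g g'.

Lemma stable_analytic_univalent (lam z w : C) :
  Cmod lam = 1 -> inD z -> inD w -> (h z + lam * g z)%C = (h w + lam * g w)%C -> z = w.
Proof.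
intros Hl Hz Hw E. destruct Hst as (_ & _ & _ & _ & _ & _ & _ & _ & Hu).
set (dg := (g z - g w)%C).
assert (Eh : (h z - h w)%C = (- (lam * dg))%C).
{ transitivity (h z + lam * g z - (h w + lam * g w) - lam * dg)%C; [unfold dg; ring|]. rewrite E. ring. }
assert (X : exists mu, Cmod mu = 1 /\ (mu * Cconj dg)%C = (lam * dg)%C).
{ destruct (Ceq_dec dg 0) as [->|N].
  - exists 1. split; [apply Cmod_1|]. apply injective_projections; simpl; ring.
  - assert (Nc : Cconj dg <> 0).
    { intros E0. apply N, Cmod_eq_0. rewrite <- Cmod_conj, E0. apply Cmod_0. }
    exists (lam * dg / Cconj dg)%C. split; [|field; exact Nc].
    rewrite Cmod_div, Cmod_mult, Cmod_conj, Hl by exact Nc. field.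
    apply Rgt_not_eq. now apply Cmod_gt_0. }
destruct X as [mu [Hmu Emu]]. apply (Hu mu Hmu z w Hz Hw).
assert (Ec : Cconj dg = (Cconj (g z) - Cconj (g w))%C) by (unfold dg; apply Cminus_conj).
rewrite Ec in Emu.
transitivity (h z - h w + h w + (mu * (Cconj (g z) - Cconj (g w)) + mu * Cconj (g w)))%C; [ring|].
rewrite Eh, Emu. ring.
Qed.

Lemma stable_schlicht (lam : C) : Cmod lam = 1 ->
  let f := fun z => (h z + lam * g z)%C in
  let f' := fun z => (h' z + lam * g' z)%C in
  forall z, Cmod z < 1 ->
    Cmod (f z) * ((1 - Cmod z) * (1 - Cmod z)) <= Cmod z /\
    Cmod (f' z) * ((1 - Cmod z) * (1 - Cmod z) * (1 - Cmod z)) <= 1 + Cmod z.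
Proof.
intros Hl f f' z Hz.
destruct Hst as (Hh & Hg & h0 & h'0 & g0 & g'0 & Hsp & _ & _).
assert (Hf : holo_disc 1 f f').
{ intros w Hw. apply has_cderiv_plus; [now apply Hh|]. now apply has_cderiv_scal, Hg. }
assert (f0 : f 0 = 0) by (unfold f; rewrite h0, g0; ring).
assert (f'0 : f' 0 = 1) by (unfold f'; rewrite h'0, g'0; ring).
(* Taken from the sense-preserving condition: as [|lam| = 1], a zero of [h' + lam g'] would force
   [|h'| = |g'|]. *)
assert (f'n : forall w, Cmod w < 1 -> f' w <> 0).
{ intros w Hw E. pose proof (Hsp w Hw) as S.
  assert (E2 : h' w = (- (lam * g' w))%C).
  { transitivity (f' w - lam * g' w)%C; [unfold f'; ring|]. rewrite E. ring. }
  rewrite E2, Cmod_opp, Cmod_mult, Hl in S. lra. }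
assert (finj : forall z w, Cmod z < 1 -> Cmod w < 1 -> f z = f w -> z = w).
{ intros u v Hu Hv E. exact (stable_analytic_univalent lam u v Hl Hu Hv E). }
assert (Hlog := schlicht_log_derivative_bound f f' Hf f0 f'0 finj f'n).
split.
- exact (growth_bound f f' Hf f0 f'0 Hlog z Hz).
- exact (distortion_bound f f' Hf f0 f'0 Hlog z Hz).
Qed.

Lemma stable_growth (z : C) : Cmod z < 1 ->
  Cmod (h z) + Cmod (g z) <= Cmod z / ((1 - Cmod z) * (1 - Cmod z)).
Proof.
intros Hz. destruct (exists_aligning (h z) (g z)) as [lam [Hl E]]. rewrite <- E.
apply Rle_div_r; [apply Rmult_lt_0_compat; lra|]. now apply (stable_schlicht lam Hl z Hz).
Qed.

Lemma stable_distortion (z : C) : Cmod z < 1 ->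
  Cmod (h' z) + Cmod (g' z) <= (1 + Cmod z) / ((1 - Cmod z) * (1 - Cmod z) * (1 - Cmod z)).
Proof.
intros Hz. destruct (exists_aligning (h' z) (g' z)) as [lam [Hl E]]. rewrite <- E.
apply Rle_div_r; [repeat apply Rmult_lt_0_compat; lra|]. now apply (stable_schlicht lam Hl z Hz).
Qed.
End Stable.

(** * Monotonicity and the root of the radius equation *)

Lemma pow_lt_compat (x y : R) (n : nat) : (1 <= n)%nat -> 0 <= x < y -> x ^ n < y ^ n.
Proof.
intros Hn Hxy. destruct n as [|n]; [lia|]. clear Hn. induction n as [|n IH]; [simpl; lra|].
cbn [pow] in *. apply Rmult_le_0_lt_compat; try lra. apply Rmult_le_pos; [lra|apply pow_le; lra].
Qed.

(** With [koebe_growth], the values of [z k'(z)] and [k(z)] at [z = x] for the Koebe function [k].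
    [F3] combines them at [r^m] and [r^q], and inherits their strict monotonicity. *)
Definition koebe_dist (x : R) : R := x * (1 + x) / (1 - x) ^ 3.
Definition koebe_growth (x : R) : R := x / (1 - x) ^ 2.

Lemma div_pow_incr (a b x y : R) (n : nat) :
  (1 <= n)%nat -> 0 <= a < b -> x < y < 1 -> a / (1 - x) ^ n < b / (1 - y) ^ n.
Proof.
intros Hn Hab Hxy.
assert (H1 : (1 - y) ^ n < (1 - x) ^ n) by (apply pow_lt_compat; [exact Hn|lra]).
assert (H2 : 0 < (1 - y) ^ n) by (apply pow_lt; lra).
assert (H3 : / (1 - x) ^ n < / (1 - y) ^ n) by (apply Rinv_lt_contravar; [apply Rmult_lt_0_compat|]; lra).
assert (H4 : 0 < / (1 - x) ^ n) by (apply Rinv_0_lt_compat; lra).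
apply Rmult_le_0_lt_compat; lra.
Qed.

Lemma koebe_dist_incr (x y : R) : 0 <= x -> x < y -> y < 1 -> koebe_dist x < koebe_dist y.
Proof. intros Hx Hxy Hy. apply div_pow_incr; [lia|nra|lra]. Qed.

Lemma koebe_growth_incr (x y : R) : 0 <= x -> x < y -> y < 1 -> koebe_growth x < koebe_growth y.
Proof. intros Hx Hxy Hy. apply div_pow_incr; [lia|lra|lra]. Qed.

Lemma koebe_dist_nonneg (x : R) : 0 <= x < 1 -> 0 <= koebe_dist x.
Proof. intros Hx. apply Rdiv_le_0_compat; [nra|apply pow_lt; lra]. Qed.

Lemma koebe_growth_nonneg (x : R) : 0 <= x < 1 -> 0 <= koebe_growth x.
Proof. intros Hx. apply Rdiv_le_0_compat; [lra|apply pow_lt; lra]. Qed.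

Lemma le_of_incr (K : R -> R) (x y : R) :
  (forall x y, 0 <= x -> x < y -> y < 1 -> K x < K y) -> 0 <= x -> x <= y -> y < 1 -> K x <= K y.
Proof. intros HK Hx [H|<-] Hy; [apply Rlt_le; now apply HK|lra]. Qed.

Lemma pow_lt_1 (x : R) (n : nat) : (1 <= n)%nat -> 0 <= x < 1 -> 0 <= x ^ n < 1.
Proof.
intros Hn Hx. split; [apply pow_le; lra|]. rewrite <- (pow1 n). now apply pow_lt_compat.
Qed.

Lemma F3_koebe (s m p q : nat) (r : R) : (1 <= m)%nat -> 0 <= r < 1 ->
  F3 s m p q r = koebe_dist (r ^ m) ^ s + koebe_growth (r ^ q) ^ p - 1.
Proof.
intros Hm Hr. pose proof (pow_lt_1 r m Hm Hr) as Hx.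
unfold F3, koebe_growth, koebe_dist. do 2 f_equal.
rewrite (Nat.mul_comm s m), !pow_mult. unfold Rdiv. rewrite !Rpow_mult_distr, pow_inv. reflexivity.
Qed.

Lemma F3_incr (s m p q : nat) (x y : R) :
  (1 <= s)%nat -> (1 <= m)%nat -> (1 <= p)%nat -> (1 <= q)%nat ->
  0 <= x -> x < y -> y < 1 -> F3 s m p q x < F3 s m p q y.
Proof.
intros Hs Hm Hp Hq Hx Hxy Hy. rewrite !F3_koebe by (auto; lra).
pose proof (pow_lt_1 x m Hm ltac:(lra)). pose proof (pow_lt_1 y m Hm ltac:(lra)).
pose proof (pow_lt_1 x q Hq ltac:(lra)). pose proof (pow_lt_1 y q Hq ltac:(lra)).
pose proof (pow_lt_compat x y m Hm ltac:(lra)). pose proof (pow_lt_compat x y q Hq ltac:(lra)).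
assert (koebe_dist (x ^ m) ^ s < koebe_dist (y ^ m) ^ s).
{ apply pow_lt_compat; [exact Hs|]. split; [apply koebe_dist_nonneg; lra|apply koebe_dist_incr; lra]. }
assert (koebe_growth (x ^ q) ^ p < koebe_growth (y ^ q) ^ p).
{ apply pow_lt_compat; [exact Hp|]. split; [apply koebe_growth_nonneg; lra|apply koebe_growth_incr; lra]. }
lra.
Qed.

Lemma F3_continuous (s m p q : nat) (r : R) :
  (1 <= m)%nat -> (1 <= q)%nat -> 0 <= r < 1 -> continuity_pt (F3 s m p q) r.
Proof.
intros Hm Hq Hr. pose proof (pow_lt_1 r m Hm Hr). pose proof (pow_lt_1 r q Hq Hr).
apply continuity_pt_filterlim.
apply (ex_derive_continuous (V := R_NormedModule) (F3 s m p q)). unfold F3.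
auto_derive. split; [apply pow_nonzero; lra|]. split; [|exact I].
apply Rgt_not_eq. nra.
Qed.

Lemma F3_root (s m p q : nat) :
  (1 <= s)%nat -> (1 <= m)%nat -> (1 <= p)%nat -> (1 <= q)%nat ->
  exists r, 0 < r < 1 /\ F3 s m p q r = 0.
Proof.
intros Hs Hm Hp Hq.
assert (HQ : 1 <= INR q) by (rewrite <- INR_1; now apply le_INR).
(* By Bernoulli's inequality [(1 - h)^q >= 3/4], where [x / (1 - x)^2] is at least 12. The second
   summand of [F3] then already exceeds 1, and the first is positive. *)
set (h := / (4 * INR q)).
assert (Hh : 0 < h <= / 4).
{ split; [apply Rinv_0_lt_compat; lra|]. apply Rinv_le_contravar; lra. }
assert (Hb : 3 / 4 <= (1 - h) ^ q).
{ eapply Rle_trans; [|apply bernoulli_sub; lra]. apply Req_le. unfold h. field. lra. }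
assert (H1 : 0 < F3 s m p q (1 - h)).
{ rewrite F3_koebe by (auto; lra).
  pose proof (pow_lt_1 (1 - h) m Hm ltac:(lra)) as Bm. pose proof (pow_lt_1 (1 - h) q Hq ltac:(lra)) as Bq.
  assert (P : 0 < (1 - h) ^ m) by (apply pow_lt; lra).
  assert (P1 : 0 < koebe_dist ((1 - h) ^ m)).
  { apply Rdiv_lt_0_compat; [nra|apply pow_lt; lra]. }
  assert (P2 : 1 <= koebe_growth ((1 - h) ^ q)).
  { apply Rle_div_r; [apply pow_lt; lra|]. simpl. nra. }
  assert (P3 : 1 <= koebe_growth ((1 - h) ^ q) ^ p) by now apply pow_R1_Rle.
  pose proof (pow_lt _ s P1). lra. }
assert (H0 : F3 s m p q 0 = -1).
{ rewrite F3_koebe by (auto; lra). rewrite !pow_i by lia.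
  unfold koebe_dist, koebe_growth. unfold Rdiv. rewrite !Rmult_0_l, !pow_i by lia. ring. }
destruct (IVT_interv (F3 s m p q) 0 (1 - h)) as [r [Hr E]]; try lra.
- intros a Ha. apply F3_continuous; auto. lra.
- exists r. split; [|exact E]. split; [|lra].
  destruct (Req_dec r 0) as [->|N]; lra.
Qed.

(** * The Koebe function and powers as extremal functions *)

Definition koebe (z : C) : C := (z / ((1 - z) * (1 - z)))%C.
Definition koebe' (z : C) : C := ((1 + z) / ((1 - z) * (1 - z) * (1 - z)))%C.

Lemma koebe_stable : stable_SH0 koebe koebe' (fun _ => 0) (fun _ => 0).
Proof.
assert (Hn : forall z, inD z -> (1 - z)%C <> 0) by (intros z Hz; now apply one_sub_neq0).
assert (Hu : univalent_D koebe).
{ intros z w Hz Hw E. pose proof (Hn z Hz) as Nz. pose proof (Hn w Hw) as Nw.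
  (* The numerator of [koebe z - koebe w]; its second factor has no zero in the disc. *)
  assert (P : ((z - w) * (1 - z * w))%C = 0).
  { transitivity ((koebe z - koebe w) * ((1 - z) * (1 - z)) * ((1 - w) * (1 - w)))%C.
    - unfold koebe. field. split; assumption.
    - rewrite E. ring. }
  destruct (Ceq_dec z w) as [|N]; [assumption|exfalso].
  refine (Cmult_neq_0 _ _ _ _ P).
  - now apply Csub_neq0.
  - apply one_sub_neq0. rewrite Cmod_mult. unfold inD in *.
    pose proof (Cmod_ge_0 z). pose proof (Cmod_ge_0 w). nra. }
assert (C0 : Cconj 0 = 0) by (apply injective_projections; simpl; ring).
split; [|split; [|repeat split]].
- intros z Hz. pose proof (Hn z Hz) as N. unfold koebe. eapply has_cderiv_eq.
  + apply has_cderiv_div; [apply has_cderiv_id| |now apply Cmult_neq_0].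
    apply has_cderiv_mult; (apply has_cderiv_minus; [apply has_cderiv_const|apply has_cderiv_id]).
  + unfold koebe'. field. exact N.
- intros z Hz. apply has_cderiv_const.
- unfold koebe. unfold Cdiv. ring.
- unfold koebe'. transitivity (RtoC 1 / RtoC 1)%C; [f_equal; ring|field].
- intros z Hz. rewrite Cmod_0. apply Cmod_gt_0. unfold koebe'.
  pose proof (Hn z Hz) as N. intros E.
  assert (E2 : (1 + z)%C = 0).
  { transitivity ((1 + z) / ((1 - z) * (1 - z) * (1 - z)) * ((1 - z) * (1 - z) * (1 - z)))%C.
    - field. exact N.
    - rewrite E. ring. }
  apply (one_sub_neq0 (- z)); [rewrite Cmod_opp; exact Hz|]. rewrite <- E2. ring.
- intros z w Hz Hw E. rewrite C0, !Cplus_0_r in E. now apply Hu.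
- intros mu _ z w Hz Hw E. rewrite C0, Cmult_0_r, !Cplus_0_r in E. now apply Hu.
Qed.

(** The falling factorial [n (n - 1) ... (n - k + 1)], the coefficient of the [k]-th derivative of
    [z^n]. Truncated subtraction makes it 0 for [k > n], as those derivatives require. *)
Fixpoint falling (n k : nat) : R :=
  match k with O => 1 | S j => falling n j * INR (n - j) end.

Lemma falling_diag_neq0 (n k : nat) : (k <= n)%nat -> falling n k <> 0.
Proof.
induction k as [|k IH]; intros Hk; [simpl; lra|]. cbn [falling].
apply Rmult_integral_contrapositive_currified; [apply IH; lia|]. apply not_0_INR. lia.
Qed.

Lemma in_B_pow (n : nat) : in_B n (fun z => z ^ n)%C.
Proof.
split.
- intros z Hz. rewrite Cmod_pow. unfold inD in Hz. rewrite <- (pow1 n). apply pow_incr.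
  split; [apply Cmod_ge_0|lra].
(* The case [k = 0] is kept apart so that [d 0] is the power function itself: [in_B] asks for an
   equality of functions. *)
- set (d := fun (k : nat) (z : C) =>
    match k with O => (z ^ n)%C | _ => (RtoC (falling n k) * z ^ (n - k))%C end).
  assert (E : forall k z, d k z = (RtoC (falling n k) * z ^ (n - k))%C).
  { intros [|k] z; [|reflexivity]. unfold d. simpl falling. rewrite Nat.sub_0_r. ring. }
  exists d.
  split; [reflexivity|]. split; [|split].
  + intros k z _. rewrite E.
    apply (has_cderiv_ext (fun z => RtoC (falling n k) * z ^ (n - k))%C); [intros w; symmetry; apply E|].
    eapply has_cderiv_eq; [apply has_cderiv_scal, has_cderiv_pow|].
    cbn [falling]. rewrite RtoC_mult. replace (pred (n - k)) with (n - S k)%nat by lia. ring.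
  + intros k Hk. rewrite E. replace (n - k)%nat with (S (n - k - 1)) by lia. cbn [Cpow]. ring.
  + rewrite E, Nat.sub_diag. cbn [Cpow]. rewrite Cmult_1_r. intros H. apply RtoC_inj in H.
    now apply (falling_diag_neq0 n n).
Qed.

Lemma koebe_modulus (x : R) : 0 <= x < 1 -> Cmod (koebe (RtoC x)) = koebe_growth x.
Proof.
intros Hx. unfold koebe, koebe_growth. rewrite <- RtoC_minus, <- RtoC_mult, <- RtoC_div, Cmod_R.
- rewrite Rabs_pos_eq.
  + f_equal. ring.
  + apply Rdiv_le_0_compat; [lra|]. nra.
- nra.
Qed.

Lemma koebe'_modulus (x : R) : 0 <= x < 1 -> Cmod (RtoC x * koebe' (RtoC x)) = koebe_dist x.
Proof.
intros Hx. unfold koebe', koebe_dist.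
assert (P : 0 < (1 - x) * (1 - x) * (1 - x)) by (repeat apply Rmult_lt_0_compat; lra).
rewrite <- RtoC_minus, <- RtoC_plus, <- !RtoC_mult, <- RtoC_div, <- RtoC_mult, Cmod_R by lra.
rewrite Rabs_pos_eq.
- unfold Rdiv. rewrite <- Rmult_assoc. do 2 f_equal. ring.
- apply Rmult_le_pos; [lra|]. apply Rdiv_le_0_compat; lra.
Qed.

(** * Bounds at the inner functions, and the theorem *)

Section Composite.
Variables h h' g g' : C -> C.
Hypothesis Hst : stable_SH0 h h' g g'.

(** The two operators differ only by the sign of one summand, so a bound of [|w| (|h' w| + |g' w|)]
    serves both. Monotonicity passes from [|w|] to the bound [x] that Schwarz's lemma supplies. *)
Lemma Dop_bound (w : C) (x : R) : Cmod w <= x -> x < 1 ->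
  Cmod (Dop h' g' w) <= koebe_dist x /\ Cmod (Dscr h' g' w) <= koebe_dist x.
Proof.
intros Hw Hx. pose proof (Cmod_ge_0 w) as Hw0.
assert (B : Cmod w * (Cmod (h' w) + Cmod (g' w)) <= koebe_dist x).
{ eapply Rle_trans; [apply Rmult_le_compat_l; [exact Hw0|apply (stable_distortion h h' g g' Hst); lra]|].
  replace (Cmod w * ((1 + Cmod w) / ((1 - Cmod w) * (1 - Cmod w) * (1 - Cmod w)))) with (koebe_dist (Cmod w)).
  - apply (le_of_incr koebe_dist); auto using koebe_dist_incr.
  - unfold koebe_dist. field. lra. }
unfold Dop, Dscr, Cminus.
split; (eapply Rle_trans; [apply Cmod_triangle|]); rewrite ?Cmod_opp, Cmod_conj, !Cmod_mult; lra.
Qed.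

Lemma harm_bound (w : C) (x : R) : Cmod w <= x -> x < 1 -> Cmod (harm h g w) <= koebe_growth x.
Proof.
intros Hw Hx. pose proof (Cmod_ge_0 w) as Hw0.
unfold harm. eapply Rle_trans; [apply Cmod_triangle|]. rewrite Cmod_conj.
eapply Rle_trans; [apply (stable_growth h h' g g' Hst); lra|].
replace (Cmod w / ((1 - Cmod w) * (1 - Cmod w))) with (koebe_growth (Cmod w)).
- apply (le_of_incr koebe_growth); auto using koebe_growth_incr.
- unfold koebe_growth. field. lra.
Qed.
End Composite.

Theorem theorem3p3 (s m p q : nat) :
  (1 <= s)%nat -> (1 <= m)%nat -> (1 <= p)%nat -> (1 <= q)%nat ->
  exists r3 : R,
    0 < r3 < 1 /\ F3 s m p q r3 = 0 /\
    (forall r, 0 < r < 1 -> F3 s m p q r = 0 -> r = r3) /\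
    (forall (h h' g g' om oq : C -> C),
       stable_SH0 h h' g g' -> in_B m om -> in_B q oq ->
       forall z : C, Cmod z <= r3 ->
         Cmod (Dop h' g' (om z)) ^ s + Cmod (harm h g (oq z)) ^ p <= 1 /\
         Cmod (Dscr h' g' (om z)) ^ s + Cmod (harm h g (oq z)) ^ p <= 1) /\
    (forall r, r3 < r < 1 ->
       (exists (h h' g g' om oq : C -> C) (z : C),
          stable_SH0 h h' g g' /\ in_B m om /\ in_B q oq /\ Cmod z = r /\
          Cmod (Dop h' g' (om z)) ^ s + Cmod (harm h g (oq z)) ^ p > 1) /\
       (exists (h h' g g' om oq : C -> C) (z : C),
          stable_SH0 h h' g g' /\ in_B m om /\ in_B q oq /\ Cmod z = r /\
          Cmod (Dscr h' g' (om z)) ^ s + Cmod (harm h g (oq z)) ^ p > 1)).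
Proof.
intros Hs Hm Hp Hq. destruct (F3_root s m p q Hs Hm Hp Hq) as [r3 [Hr3 E3]].
exists r3. split; [exact Hr3|]. split; [exact E3|]. split; [|split].
- intros r Hr E. destruct (Rtotal_order r r3) as [H|[H|H]]; [exfalso|exact H|exfalso].
  + pose proof (F3_incr s m p q r r3 Hs Hm Hp Hq ltac:(lra) H ltac:(lra)). lra.
  + pose proof (F3_incr s m p q r3 r Hs Hm Hp Hq ltac:(lra) H ltac:(lra)). lra.
- intros h h' g g' om oq Hst Hom Hoq z Hz.
  pose proof (pow_lt_1 r3 m Hm ltac:(lra)) as Bm. pose proof (pow_lt_1 r3 q Hq ltac:(lra)) as Bq.
  assert (Wm : Cmod (om z) <= r3 ^ m).
  { eapply Rle_trans; [apply (schwarz_order m om z Hom); lra|].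
    apply pow_incr. split; [apply Cmod_ge_0|exact Hz]. }
  assert (Wq : Cmod (oq z) <= r3 ^ q).
  { eapply Rle_trans; [apply (schwarz_order q oq z Hoq); lra|].
    apply pow_incr. split; [apply Cmod_ge_0|exact Hz]. }
  destruct (Dop_bound h h' g g' Hst (om z) (r3 ^ m) Wm ltac:(lra)) as [B1 B2].
  pose proof (harm_bound h h' g g' Hst (oq z) (r3 ^ q) Wq ltac:(lra)) as B3.
  rewrite F3_koebe in E3 by (auto; lra).
  pose proof (pow_incr _ _ s (conj (Cmod_ge_0 _) B1)). pose proof (pow_incr _ _ s (conj (Cmod_ge_0 _) B2)).
  pose proof (pow_incr _ _ p (conj (Cmod_ge_0 _) B3)). lra.
(* At the real point [z = r] every estimate becomes an equality for the Koebe function, so both left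
   sides equal [F3 s m p q r + 1], which exceeds 1 beyond the root. *)
- intros r Hr.
  pose proof (pow_lt_1 r m Hm ltac:(lra)) as Bm. pose proof (pow_lt_1 r q Hq ltac:(lra)) as Bq.
  pose proof (F3_incr s m p q r3 r Hs Hm Hp Hq ltac:(lra) ltac:(lra) ltac:(lra)) as Hlt.
  rewrite E3, F3_koebe in Hlt by (auto; lra).
  assert (C0 : forall w : C, Cconj (w * 0) = 0) by (intros w; apply injective_projections; simpl; ring).
  assert (X1 : Cmod (harm koebe (fun _ => 0) (RtoC r ^ q)%C) = koebe_growth (r ^ q)).
  { unfold harm. rewrite <- RtoC_pow, <- (koebe_modulus (r ^ q)) by lra. f_equal.
    apply injective_projections; simpl; ring. }
  assert (X2 : Cmod (Dop koebe' (fun _ => 0) (RtoC r ^ m)%C) = koebe_dist (r ^ m)).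
  { unfold Dop. rewrite C0, <- RtoC_pow, <- (koebe'_modulus (r ^ m)) by lra. f_equal. ring. }
  assert (X3 : Cmod (Dscr koebe' (fun _ => 0) (RtoC r ^ m)%C) = koebe_dist (r ^ m)).
  { unfold Dscr. rewrite C0, <- RtoC_pow, <- (koebe'_modulus (r ^ m)) by lra. f_equal. ring. }
  assert (Xr : Cmod (RtoC r) = r) by (rewrite Cmod_R; apply Rabs_pos_eq; lra).
  split; exists koebe, koebe', (fun _ => RtoC 0), (fun _ => RtoC 0), (fun z => z ^ m)%C, (fun z => z ^ q)%C, (RtoC r);
    (split; [exact koebe_stable|split; [apply in_B_pow|split; [apply in_B_pow|split; [exact Xr|]]]]).
  + rewrite X1, X2. lra.
  + rewrite X1, X3. lra.
Qed.
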